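(* Let $\{\nu_i\}_{i\in\mathbb{N}}\subset\mathcal{P}(\mathbb{R})$ be a family of measures such that each $\nu_i$ is $(N_i,\gamma_i)$-uniformly perfect. Then, for all $q\in(1,\infty)$, the sequence $\big(D(\ast_{i=1}^n\nu_i,q)\big)_n$ is strictly increasing, until the possible point where it reaches $1$. Moreover, if $N_i\equiv N$ and $\gamma_i\equiv\gamma$, then the sequence $D(\ast_{i=1}^n\nu_i,\infty)$ converges to $1$ as $n\to\infty$ at a rate that depends only on $N$ and $\gamma$ (and hence so does $D(\ast_{i=1}^n\nu_i,q)$ for all finite $q>1$).
   Context: $\mathcal{P}(\mathbb{R})$ denotes the family of compactly supported Borel probability measures on $\mathbb{R}$. Logarithms are to base $2$. For $m\in\mathbb{N}$, $\mathcal{D}_m=\{[k2^{-m},(k+1)2^{-m}):k\in\mathbb{Z}\}$. For $1<q<\infty$ and $\nu\in\mathcal{P}(\mathbb{R})$, the $L^q$ dimension of $\nu$ is $$D(\nu,q)=\liminf_{m\to\infty}\frac{-\log\sum_{Q\in\mathcal{D}_m}\nu(Q)^q}{(q-1)m},$$ and $D(\nu,\infty)=\lim_{q\to\infty}D(\nu,q)$ (the limit exists since $q\mapsto D(\nu,q)$ is non-increasing and non-negative). The convolution $\mu\ast\nu$ is the push-forward of $\mu\times\nu$ under $(x,y)\mapsto x+y$, and $\ast_{i=1}^n\nu_i=\nu_1\ast\cdots\ast\nu_n$. $B(x,r)$ denotes the ball in $\mathbb{R}$ with centre $x$ and radius $r$, and $\operatorname{spt}\nu$ the support of $\nu$. For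 $N>1$ (not necessarily an integer) and $0<\gamma\le 1$, a measure $\nu\in\mathcal{P}(\mathbb{R})$ is $(N,\gamma)$-uniformly perfect if $\nu(B(x,Nr))\ge 2^{\gamma}\nu(B(x,r))$ for all $x\in\mathbb{R}$ and $r>0$ such that $\operatorname{spt}\nu\not\subset B(x,Nr)$.
   Formalization: The measures are also assumed not to be point masses: under the stated definition a Dirac mass is trivially uniformly perfect, and if all measures are Dirac masses at 0 every dimension is 0, so both claims fail. *)

(* Defs.v *)
From HB Require Import structures.
From mathcomp Require Import all_boot all_order all_algebra.
From mathcomp Require Import all_classical all_reals all_analysis.
From mathcomp Require Import measurable_realfun.
Import Order.TTheory GRing.Theory Num.Theory.
Import numFieldNormedType.Exports.

Set Implicit Arguments.
Unset Strict Implicit.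
Unset Printing Implicit Defensive.

Local Open Scope classical_set_scope.
Local Open Scope ring_scope.

(* Borel probability measures on the real line. *)
Notation borel_prob R := (probability (measurableTypeR R) R).

Section measures_on_the_line.
Context {R : realType}.
Implicit Types (mu nu : borel_prob R) (q N gamma : R).

Definition spt nu : set R :=
  [set x | forall r : R, 0 < r -> (0 < nu (ball x r))%E].

Definition compactly_supported nu := compact (spt nu).

(* Balls are open.  Closed balls give an equivalent condition, with the same N
   and gamma: pass to the limit in the radius, the support being closed.
   A point mass satisfies it trivially: if ball x (N * r) misses the atom then
   both sides are 0.  Degenerate measures must be excluded separately. *)
Definition uniformly_perfect N gamma nu :=
  [/\ 1 < N, 0 < gamma <= 1 &
    forall x r : R, 0 < r -> ~ (spt nu `<=` ball x (N * r)) ->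
      ((2 `^ gamma)%:E * nu (ball x r) <= nu (ball x (N * r)))%E].

Definition point_mass nu := exists x : R, spt nu = [set x].

Definition add_pair (z : measurableTypeR R * measurableTypeR R) :
  measurableTypeR R := (z.1 : R) + (z.2 : R).

Lemma measurable_add_pair : measurable_fun [set: _] add_pair.
Proof.
exact: (@measurable_funD _ _ R setT (fun z => z.1) (fun z => z.2)
  measurable_fst measurable_snd).
Qed.

HB.instance Definition _ :=
  isMeasurableFun.Build _ _ _ _ add_pair measurable_add_pair.

Definition convolution mu nu : borel_prob R :=
  distribution (mu \x nu)%E add_pair.

(* nu 0 * ... * nu n : indices start at 0, so there are n + 1 factors. *)
Fixpoint convolutions (nu : nat -> borel_prob R) (n : nat) : borel_prob R :=
  if n is n'.+1 then convolution (convolutions nu n') (nu n) else nu 0%N.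

Definition dyadic (m : nat) (k : int) : set R :=
  `[k%:~R / 2 ^+ m, (k + 1)%:~R / 2 ^+ m[%classic.

Definition log2e (x : \bar R) : \bar R := (lne x * ((ln 2)^-1)%:E)%E.

Definition Lq_moment nu q (m : nat) : \bar R :=
  \esum_(k in [set: int]) (nu (dyadic m k) `^ q)%E.

Definition Lq_dim nu q : \bar R :=
  limn_einf (fun m : nat =>
    (- log2e (Lq_moment nu q m) * (((q - 1) * m%:R)^-1)%:E)%E).

Definition Linfty_dim nu : \bar R := lim (Lq_dim nu q @[q --> +oo]).

End measures_on_the_line.

(* Main.v *)
Require Import Defs.
From mathcomp Require Import all_boot all_order all_algebra.
From mathcomp Require Import all_classical all_reals all_analysis.
From mathcomp Require Import ring lra zify.
From mathcomp Require Import complex.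
Import Order.TTheory GRing.Theory Num.Theory.
Import numFieldNormedType.Exports.
Set Implicit Arguments.
Unset Strict Implicit.
Unset Printing Implicit Defensive.
Local Open Scope classical_set_scope.
Local Open Scope ring_scope.

(** A compactly supported measure is replaced, at
each scale [2 ^- m], by the vector of its masses on dyadic cells, read as a
probability vector on a cyclic group of order [L], a fixed multiple of
[2 ^ m].  Its L^q dimension is the growth exponent of the sum of the q-th
powers of the entries, and a convolution of measures becomes a convolution of
vectors, up to a carry of one cell coming from the integer parts
([disc_convolution_smear]).

The only way in which uniform perfectness and the exclusion of point masses
are used is a halving property: a ball carries at most half of the mass of
the ball with the same centre and a fixed multiple of its radius, as long as
the support is not exhausted ([uniformly_perfect_halving], [nonconc_line]).
The heart of the proof is that halving at all scales forces decay of the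
Fourier transform in a high-moment sense: for every [kap > 0] there is [n],
depending only on [N], [gamma] and [kap], such that the mean of
[|ft nu k| ^ (2 * n)] over all frequencies is at most
[C * 2 ^ (m * (kap - 1))] ([energy_bound], [disc_energy_le]).

This is proved by induction on scales.  Let [E lam] be the best constant for
which the energy of [v * u] is at most [E lam] times the [2 * n]-th power of
its mass, for all positive weights [v] whose logarithm is [lam]-Lipschitz.
The energy of [f] is the squared L^2 norm of its [n]-fold convolution.
Localising each of the [n] factors with kernels [exp (- a |x - t|)] keeps
the weights Lipschitz, with constant [lam + a], so that [E (lam + a)]
applies to each localised piece; what remains is the energy of the smoothed
function [f * exp (- a |.|)] ([energy_step]).  That one is small: the
frequencies below [8 * lam] are few, those of intermediate size see the
halving property at one scale, which gives a fixed factor smaller than 1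
each ([pw_single_scale]), and the high ones are damped by the kernel
([sum_pw_kern_high]).  With [a = b * lam] and [b] exponentially large in
[n], one step of the induction multiplies [lam] by [1 + b] and gains almost
[1 + b] in the constant, the loss being only a factor linear in [n].
Running it from [lam] of the order of [2 ^- m] up to [lam] of order 1 gives
the bound.

Both assertions follow.  For the first one, Hoelder reduces the L^q norm of
[u * p] to the L^2 norm of the convolution of [u] with [p ^ (q / 2)];
by Parseval and convexity the latter is controlled by the energy of [u],
which yields a gain of a power of [2 ^ m] unless [p] is already almost
uniformly spread at that scale ([convol_moment_gain]).  Scales of the second
sort do not matter when the dimension is smaller than 1
([Lq_dim_convolution_gt]).  For the second one, Fourier inversion and the
inequality of the means bound all cell masses of a convolution of at least
[2 * n] measures by the mean of their energies ([disc_convolutions_sup]), so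
that all the dimensions, including the one for infinite [q], are at least
[1 - kap] from an index on which depends only on [N], [gamma] and [kap].
The rate is the infimum of the errors valid for all admissible sequences. *)

(** * Inequalities for finite sums *)

Lemma powRV {R : realType} (x r : R) : 0 <= x -> (x^-1) `^ r = (x `^ r)^-1.
Proof. by move=> x0; rewrite -powR_inv1 // powRAC powR_inv1 // powR_ge0. Qed.

Section finite_sums.
Context {R : realType} {I : finType}.
Implicit Types (P : pred I) (a b g m w x : I -> R).

(** Lagrange's identity: the difference of the two sides is half of the sum
of the squares of [a i * b j - a j * b i]. *)
Lemma sum_cauchy_schwarz P a b :
  (\sum_(i | P i) a i * b i) ^+ 2 <=
  (\sum_(i | P i) a i ^+ 2) * (\sum_(i | P i) b i ^+ 2).
Proof.
have H : 0 <= \sum_(i | P i) \sum_(j | P j) (a i * b j - a j * b i) ^+ 2.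
  by apply: sumr_ge0 => i _; apply: sumr_ge0 => j _; exact: sqr_ge0.
suff E : \sum_(i | P i) \sum_(j | P j) (a i * b j - a j * b i) ^+ 2 =
  ((\sum_(i | P i) a i ^+ 2) * (\sum_(i | P i) b i ^+ 2) -
   (\sum_(i | P i) a i * b i) ^+ 2) *+ 2.
  by move: H; rewrite E pmulrn_lge0 // subr_ge0.
rewrite mulrnBl -[in RHS]mulr_natl.
transitivity (\sum_(i | P i) \sum_(j | P j)
  (a i ^+ 2 * b j ^+ 2 + b i ^+ 2 * a j ^+ 2 - 2 * ((a i * b i) * (a j * b j)))).
  by apply: eq_bigr => i _; apply: eq_bigr => j _; ring.
transitivity (\sum_(i | P i) (a i ^+ 2 * (\sum_(j | P j) b j ^+ 2) +
    b i ^+ 2 * (\sum_(j | P j) a j ^+ 2) -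
    2 * (a i * b i * (\sum_(j | P j) a j * b j)))).
  by apply: eq_bigr => i _; rewrite sumrB big_split /= -!mulr_sumr.
rewrite sumrB big_split /= -!mulr_suml -mulr_sumr -mulr_suml; ring.
Qed.

(** Cauchy-Schwarz for [g = sqrt m * (g / sqrt m)].  Where [m] vanishes the
quotient is 0 by convention, hence the condition on [g]. *)
Lemma sum_sqr_le_weighted P g m : (forall i, 0 <= m i) ->
  (forall i, m i = 0 -> g i = 0) ->
  (\sum_(i | P i) g i) ^+ 2 <=
  (\sum_(i | P i) m i) * (\sum_(i | P i) g i ^+ 2 / m i).
Proof.
move=> m0 mg; have := sum_cauchy_schwarz P (fun i => Num.sqrt (m i))
  (fun i => g i / Num.sqrt (m i)).
rewrite (eq_bigr g) => [|i _]; last first.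
  have [/mg ->|mi0] := eqVneq (m i) 0; first by rewrite mul0r mulr0.
  by rewrite mulrC divfK // sqrtr_eq0 -ltNge lt_neqAle eq_sym mi0 m0.
under [X in _ <= X * _ -> _]eq_bigr do rewrite sqr_sqrtr //.
by under [X in _ <= _ * X -> _]eq_bigr do rewrite expr_div_n sqr_sqrtr//.
Qed.

Lemma powR_geo_arith_mean (al u v : R) : 0 < al < 1 -> 0 <= u -> 0 <= v ->
  u `^ al * v `^ (1 - al) <= al * u + (1 - al) * v.
Proof.
move=> /andP[a0 a1] u0 v0.
have b0 : 0 < 1 - al by rewrite subr_gt0.
have := @conjugate_powR _ (u `^ al) (v `^ (1 - al)) al^-1 (1 - al)^-1
  (powR_ge0 _ _) (powR_ge0 _ _).
rewrite !invr_gt0 !invrK => /(_ a0 b0) H.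
have {H} := H (subrKC al 1).
rewrite -!powRrM !mulfV ?gt_eqF // !powRr1 //; lra.
Qed.

(** Young's inequality applied to [a i / A] and [b i / B], where [A] and [B]
are the two sums, and summed. *)
Lemma sum_powR_holder P a b (al : R) : 0 < al < 1 ->
  (forall i, 0 <= a i) -> (forall i, 0 <= b i) ->
  \sum_(i | P i) a i `^ al * b i `^ (1 - al) <=
  (\sum_(i | P i) a i) `^ al * (\sum_(i | P i) b i) `^ (1 - al).
Proof.
move=> al01 a0 b0; have /andP[l0 l1] := al01.
set A := \sum_(i | P i) a i; set B := \sum_(i | P i) b i.
have A0 : 0 <= A by apply: sumr_ge0.
have B0 : 0 <= B by apply: sumr_ge0.
have [AE|An0] := eqVneq A 0.
  rewrite AE powR0 ?gt_eqF // mul0r big1 // => i Pi.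
  have /eqP := AE; rewrite psumr_eq0 // => /allP /(_ i (mem_index_enum i)).
  by rewrite Pi /= => /eqP ->; rewrite powR0 ?mul0r // gt_eqF.
have [BE|Bn0] := eqVneq B 0.
  have l1' : 1 - al != 0 by rewrite gt_eqF // subr_gt0.
  rewrite BE powR0 // mulr0 big1 // => i Pi.
  have /eqP := BE; rewrite psumr_eq0 // => /allP /(_ i (mem_index_enum i)).
  by rewrite Pi /= => /eqP ->; rewrite powR0 ?mulr0.
have Ap : 0 < A by rewrite lt_neqAle eq_sym An0.
have Bp : 0 < B by rewrite lt_neqAle eq_sym Bn0.
rewrite -[leRHS]mul1r -ler_pdivrMr; last by rewrite mulr_gt0 // powR_gt0.
rewrite mulr_suml.
apply: (@le_trans _ _ (\sum_(i | P i) (al * (a i / A) + (1 - al) * (b i / B)))).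
  apply: ler_sum => i _.
  have := powR_geo_arith_mean al01 (divr_ge0 (a0 i) A0) (divr_ge0 (b0 i) B0).
  rewrite (powRM _ (a0 i)) ?invr_ge0 // (powRM _ (b0 i)) ?invr_ge0 //.
  by rewrite !powRV // mulrACA -invfM.
rewrite big_split /= -!mulr_sumr -!mulr_suml !mulfV //; lra.
Qed.

(** Hoelder with exponents [r^-1] and [1 - r^-1], since
[w * x = (w * x ^ r) ^ r^-1 * w ^ (1 - r^-1)]. *)
Lemma sum_powR_jensen P w x (r : R) : 1 <= r ->
  (forall i, 0 <= w i) -> (forall i, 0 <= x i) -> \sum_(i | P i) w i = 1 ->
  (\sum_(i | P i) w i * x i) `^ r <= \sum_(i | P i) w i * x i `^ r.
Proof.
rewrite le_eqVlt => /predU1P[<- w0 x0 _|r1 w0 x0 w1].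
  rewrite powRr1; last by apply: sumr_ge0 => i _; rewrite mulr_ge0.
  by under [leRHS]eq_bigr do rewrite powRr1 //.
have r0 : 0 < r by lra.
have ri : 0 < r^-1 < 1 by rewrite invr_gt0 r0 /= invf_lt1.
have := @sum_powR_holder P (fun i => w i * x i `^ r) w _ ri.
move=> /(_ (fun i => mulr_ge0 (w0 i) (powR_ge0 _ _)) w0).
rewrite w1 powR1 mulr1.
rewrite (eq_bigr (fun i => w i * x i)) => [H|i _]; last first.
  rewrite powRM ?powR_ge0 // -powRrM mulfV ?gt_eqF // powRr1 // mulrAC.
  have [->|wi] := eqVneq (w i) 0; first by rewrite powR0 ?invr_neq0 ?gt_eqF // !mul0r.
  by rewrite -powRD ?wi ?implybT // subrKC powRr1.
have := ge0_ler_powR (ltW r0) _ _ H.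
rewrite !nnegrE powR_ge0 -powRrM mulVf ?gt_eqF // powRr1; last first.
  by apply: sumr_ge0 => i _; rewrite mulr_ge0 // powR_ge0.
by apply => //; apply: sumr_ge0 => i _; rewrite mulr_ge0.
Qed.

Lemma sum_expr_jensen P w x (n : nat) : (0 < n)%N ->
  (forall i, 0 <= w i) -> (forall i, 0 <= x i) -> \sum_(i | P i) w i = 1 ->
  (\sum_(i | P i) w i * x i) ^+ n <= \sum_(i | P i) w i * x i ^+ n.
Proof.
move=> n0 w0 x0 w1.
have := @sum_powR_jensen P w x n%:R _ w0 x0 w1; rewrite ler1n => /(_ n0).
rewrite powR_mulrn; last by apply: sumr_ge0 => i _; rewrite mulr_ge0.
by under [X in _ <= X -> _]eq_bigr do rewrite powR_mulrn //.
Qed.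

End finite_sums.

(** The inequality of the means, followed by convexity of the n-th power.
It decouples a product of [n] different Fourier transforms into energies. *)
Lemma prod_le_mean_expr {R : realType} (n : nat) (a : 'I_n -> R) : (0 < n)%N ->
  (forall i, 0 <= a i) -> \prod_i a i <= n%:R^-1 * \sum_i a i ^+ n.
Proof.
move=> n0 a0; have nR : 0 < n%:R :> R by rewrite ltr0n.
have := leif_AGM (A := 'I_n) (E := a) (in1W a0).
rewrite card_ord => -[+ _] => /le_trans; apply.
have := @sum_expr_jensen R 'I_n xpredT (fun=> n%:R^-1) a n n0.
rewrite -!mulr_sumr mulrC; apply => //.
by rewrite sumr_const card_ord -[LHS]mulr_natl mulfV ?gt_eqF.
Qed.

(** * Fourier analysis on a cyclic group *)

Section fourier.
Context {R : realType} {M : nat}.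
Local Notation G := 'I_M.+1.
Local Notation C := R[i]%C.
Implicit Types (f g : G -> R) (xi x y s : G).

Definition cis (t : R) : C := (cos t +i* sin t)%C.

(** The squared modulus as a real number; the norm of [R[i]] takes its values
in [R[i]] itself. *)
Definition abs2 (z : C) : R := complex.Re z ^+ 2 + complex.Im z ^+ 2.

Lemma cisD (s t : R) : cis (s + t) = cis s * cis t.
Proof. by rewrite /cis cosD sinD; congr Complex; rewrite addrC. Qed.

Lemma cis0 : cis 0 = 1.
Proof. by rewrite /cis cos0 sin0. Qed.

Lemma abs2M z w : abs2 (z * w) = abs2 z * abs2 w.
Proof. by case: z => a b; case: w => c d; rewrite /abs2 /=; ring. Qed.

Lemma abs21 : abs2 1 = 1.
Proof. by rewrite /abs2 /= expr1n expr0n addr0. Qed.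

Lemma abs2_ge0 z : 0 <= abs2 z.
Proof. by rewrite addr_ge0 ?sqr_ge0. Qed.

Lemma abs2_prod (I : finType) (F : I -> C) :
  abs2 (\prod_i F i) = \prod_i abs2 (F i).
Proof. exact: (big_morph abs2 abs2M abs21). Qed.

Lemma cis_2pi (k : nat) : cis (k%:R * (2 * pi)) = 1.
Proof.
elim: k => [|k IH]; first by rewrite mul0r cis0.
rewrite -addn1 natrD mulrDl cisD IH !mul1r.
by rewrite /cis mulrC mulr_natr cos2pi sin2pi.
Qed.

Definition freq (k x : nat) : R := 2 * pi * (k%:R * x%:R / M.+1%:R).

Definition chi (k x : nat) : C := cis (freq k x).

(** Residues are represented by naturals, so this is what makes [chi k] a
character of the cyclic group. *)
Lemma chi_modr (k x : nat) : chi k (x %% M.+1) = chi k x.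
Proof.
rewrite /chi [in RHS](divn_eq x M.+1).
have -> : freq k (x %/ M.+1 * M.+1 + x %% M.+1) =
  (k * (x %/ M.+1))%N%:R * (2 * pi) + freq k (x %% M.+1).
  have : M.+1%:R != 0 :> R by rewrite pnatr_eq0.
  rewrite /freq natrD !natrM; move: (M.+1%:R) (x %/ _)%:R (x %% _)%:R => N u v N0.
  by field.
by rewrite cisD cis_2pi mul1r.
Qed.

Lemma chiD k (x y : nat) : chi k (x + y) = chi k x * chi k y.
Proof. by rewrite /chi -cisD /freq natrD; congr cis; ring. Qed.

Lemma chi0 k : chi k 0 = 1.
Proof. by rewrite /chi /freq !(mulr0, mul0r) cis0. Qed.

Lemma chi_addr k x y : chi k (x + y)%R = chi k x * chi k y.
Proof. by rewrite -chiD -[RHS]chi_modr. Qed.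

Lemma chi_subr k x y : chi k (x - y)%R = cis (freq k x - freq k y).
Proof.
have E : chi k x = chi k (x - y)%R * chi k y by rewrite -chi_addr subrK.
by rewrite cisD -/(chi k x) E /chi -mulrA -cisD subrr cis0 mulr1.
Qed.

Lemma chi_sumr k (I : finType) (F : I -> G) :
  chi k (\sum_i F i)%R = \prod_i chi k (F i).
Proof. by apply: (big_morph (fun x : G => chi k x) (chi_addr k)); rewrite chi0. Qed.

Lemma abs2_chi (k x : nat) : abs2 (chi k x) = 1.
Proof. by rewrite /abs2 /= cos2Dsin2. Qed.

Lemma chiX (k x : nat) : chi k x = chi 1 x ^+ k.
Proof.
elim: k => [|k IH]; first by rewrite expr0 /chi /freq !mul0r mulr0 cis0.
rewrite exprS -IH /chi -cisD /freq; congr cis.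
by rewrite -addn1 natrD; ring.
Qed.

Lemma cos_lt1 (t : R) : 0 < t < 2 * pi -> cos t < 1.
Proof.
move=> /andP[t0 t2]; rewrite -[t](@divfK _ 2) // mulr_natr cos_mulr2n.
have /lt_le_trans : 0 < sin (t / 2) by apply: sin_gt0_pi; lra.
move: (sin2cos2 (t / 2)) => E /(_ _ (lexx _)) s0.
have : 0 < sin (t / 2) ^+ 2 by rewrite exprn_gt0.
by rewrite E; move: (cos _ ^+ 2) => u; lra.
Qed.

Lemma chi1_neq1 x : x != 0 -> chi 1 x != 1.
Proof.
move=> x0; apply/eqP => /(congr1 (@complex.Re R)) /=.
suff : cos (freq 1 x) < 1 by move=> /lt_eqF /eqP.
have px : (0 < x)%N by rewrite lt0n.
have pi0 := @pi_gt0 R.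
apply: cos_lt1; rewrite /freq mul1r; apply/andP; split.
  by rewrite !mulr_gt0 // ?ltr0n // invr_gt0 ltr0n.
rewrite -[ltRHS]mulr1 ltr_pM2l ?mulr_gt0 // ltr_pdivrMr ?ltr0n // mul1r ltr_nat.
exact: ltn_ord.
Qed.

(** Orthogonality of characters: a geometric sum of powers of a root of unity
other than 1 vanishes. *)
Lemma sum_chi x : \sum_(xi : G) chi xi x = if x == 0 then M.+1%:R else 0.
Proof.
case: eqP => [->|/eqP x0].
  rewrite (eq_bigr (fun=> 1)) => [|xi _]; last by rewrite chi0.
  by rewrite sumr_const card_ord.
rewrite (eq_bigr (fun xi : G => chi 1 x ^+ xi)) => [|xi _]; last exact: chiX.
have E := subrX1 (chi 1 x) M.+1.
have : chi 1 x ^+ M.+1 = 1.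
  rewrite -chiX /chi.
  have -> : freq M.+1 x = x%:R * (2 * pi).
    by rewrite /freq [M.+1%:R * _]mulrC mulfK ?pnatr_eq0 // mulrC.
  by rewrite cis_2pi.
move=> E1; rewrite E1 subrr in E; move: E => /esym/eqP.
by rewrite mulf_eq0 subr_eq0 (negbTE (chi1_neq1 x0)) /= => /eqP.
Qed.

(** The unnormalised Fourier transform; [pw] below is the power spectrum.
Frequencies are naturals rather than group elements, so that negative ones can
be written as [M.+1 - k]. *)
Definition ft f (k : nat) : C := \sum_x (f x)%:C%C * chi k x.

Definition pw f (k : nat) : R := abs2 (ft f k).

Lemma pw_ge0 f k : 0 <= pw f k.
Proof. exact: abs2_ge0. Qed.

(** A real form of the power spectrum.  It reduces the frequency estimates to
estimates of cosines of differences. *)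
Lemma pwE f k : pw f k =
  \sum_x \sum_y f x * f y * cos (freq k x - freq k y).
Proof.
have RE : complex.Re (ft f k) = \sum_x f x * cos (freq k x).
  rewrite /ft (big_morph (@complex.Re R) (id1 := 0) (op1 := +%R)) //.
    by apply: eq_bigr => x _ /=; rewrite mul0r subr0.
  by case=> a b [c d].
have IE : complex.Im (ft f k) = \sum_x f x * sin (freq k x).
  rewrite /ft (big_morph (@complex.Im R) (id1 := 0) (op1 := +%R)) //.
    by apply: eq_bigr => x _ /=; rewrite mul0r addr0.
  by case=> a b [c d].
rewrite /pw /abs2 RE IE !expr2 !mulr_suml -big_split /=.
apply: eq_bigr => x _; rewrite !mulr_sumr -big_split /=.
by apply: eq_bigr => y _; rewrite cosB; ring.
Qed.

Lemma pw_le_sqr f k : (forall x, 0 <= f x) -> pw f k <= (\sum_x f x) ^+ 2.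
Proof.
move=> f0; rewrite pwE expr2 mulr_suml; apply: ler_sum => x _.
rewrite mulr_sumr; apply: ler_sum => y _.
by rewrite -[leRHS]mulr1 ler_wpM2l ?mulr_ge0 // cos_le1.
Qed.

(** The convolution of the [n] functions [F i]; [convol] below is the case of
two functions in a form without finite functions. *)
Definition convn {n : nat} (F : 'I_n -> G -> R) (s : G) : R :=
  \sum_(x : {ffun 'I_n -> G} | \sum_i x i == s) \prod_i F i (x i).

Lemma convn_ge0 n (F : 'I_n -> G -> R) s :
  (forall i x, 0 <= F i x) -> 0 <= convn F s.
Proof. by move=> F0; apply: sumr_ge0 => x _; apply: prodr_ge0. Qed.

Lemma sum_fibre_ffun n (V : nmodType) (Phi : {ffun 'I_n -> G} -> V) :
  \sum_s \sum_(x : {ffun 'I_n -> G} | \sum_i x i == s) Phi x = \sum_x Phi x.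
Proof.
rewrite [RHS](partition_big (fun x : {ffun 'I_n -> G} => \sum_i x i) xpredT) //=.
Qed.

Lemma ft_convn n (F : 'I_n -> G -> R) k :
  ft (convn F) k = \prod_i ft (F i) k.
Proof.
rewrite /ft bigA_distr_bigA /= -[RHS]sum_fibre_ffun; apply: eq_bigr => s _.
rewrite /convn (rmorph_sum (real_complex R)) mulr_suml.
apply: eq_bigr => x /eqP <-.
by rewrite (rmorph_prod (real_complex R)) big_split /= chi_sumr.
Qed.

Lemma pw_convn n (F : 'I_n -> G -> R) k :
  pw (convn F) k = \prod_i pw (F i) k.
Proof. by rewrite /pw ft_convn abs2_prod. Qed.

Definition convol f g (s : G) : R := \sum_x f x * g (s - x).

Lemma ft_convol f g k : ft (convol f g) k = ft f k * ft g k.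
Proof.
rewrite /ft mulr_suml.
under eq_bigr do rewrite /convol (rmorph_sum (real_complex R)) mulr_suml.
rewrite exchange_big /=; apply: eq_bigr => x _.
rewrite mulr_sumr (reindex_inj (addIr x)) /=.
apply: eq_bigr => y _.
by rewrite (rmorphM (real_complex R)) addrK chi_addr [RHS]mulrACA [chi k y * _]mulrC.
Qed.

Lemma pw_convol f g k : pw (convol f g) k = pw f k * pw g k.
Proof. by rewrite /pw ft_convol abs2M. Qed.

Lemma convol_ge0 f g s : (forall x, 0 <= f x) -> (forall x, 0 <= g x) ->
  0 <= convol f g s.
Proof. by move=> f0 g0; apply: sumr_ge0 => x _; rewrite mulr_ge0. Qed.

Lemma sum_convol f g : \sum_s convol f g s = (\sum_x f x) * (\sum_x g x).
Proof.
rewrite mulr_suml exchange_big /=; apply: eq_bigr => x _.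
rewrite mulr_sumr (reindex_inj (addIr x)) /=.
by apply: eq_bigr => y _; rewrite addrK.
Qed.

Lemma fourier_inversion f s :
  \sum_(k : G) ft f k * chi k (- s)%R = (M.+1%:R * f s)%:C%C.
Proof.
have [t Et] : exists t : G, t = - s by eexists.
rewrite -Et.
have E (k x : G) : chi k x * chi k t = chi k (x - s)%R by rewrite Et -chi_addr.
under eq_bigr do rewrite /ft mulr_suml.
rewrite exchange_big /= (bigD1 s) //= addrC big1 ?add0r => [|x xs].
  under eq_bigr do rewrite -mulrA E subrr chi0 mulr1.
  by rewrite sumr_const card_ord mulr_natl (rmorphMn (real_complex R)).
under eq_bigr do rewrite -mulrA E.
by rewrite -mulr_sumr sum_chi subr_eq0 (negbTE xs) mulr0.
Qed.

Lemma parseval f : \sum_(k : G) pw f k = M.+1%:R * \sum_x f x ^+ 2.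
Proof.
under eq_bigr do rewrite pwE.
rewrite exchange_big /= mulr_sumr; apply: eq_bigr => x _.
rewrite exchange_big /= (bigD1 x) //= addrC big1 ?add0r => [|y yx].
  under eq_bigr do rewrite subrr cos0 mulr1.
  by rewrite sumr_const card_ord mulr_natl.
rewrite -mulr_sumr.
have := congr1 (@complex.Re R) (sum_chi (x - y)).
rewrite subr_eq0 eq_sym (negbTE yx) /= => E.
apply/eqP; rewrite mulf_eq0; apply/orP; right; apply/eqP.
rewrite -[RHS]E (big_morph (@complex.Re R) (id1 := 0) (op1 := +%R)) //; last first.
  by case=> a b [c d].
apply: eq_bigr => k _.
by rewrite chi_subr.
Qed.

End fourier.

(** * Exponential kernels on a cyclic group *)

Section kernels.
Context {R : realType} {M : nat}.
Local Notation G := 'I_M.+1.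
Implicit Types (f g v : G -> R) (x y s t : G) (a : R).

(** The distance to 0 in the cyclic group. *)
Definition nrm x : nat := minn x (M.+1 - x).

Lemma nrmN x : nrm (- x) = nrm x.
Proof.
rewrite /nrm /=; have := ltn_ord x; case: (posnP x) => [->|x0] xM.
  by rewrite subn0 modnn !min0n.
rewrite modn_small; first lia.
lia.
Qed.

Lemma nrmD x y : (nrm (x + y)%R <= nrm x + nrm y)%N.
Proof.
rewrite /nrm /=; have := ltn_ord x; have := ltn_ord y => yM xM.
case: (ltnP (x + y) M.+1) => h; first by rewrite modn_small //; lia.
have -> : ((x + y) %% M.+1 = x + y - M.+1)%N.
  by rewrite -{1}(subnK h) modnDr modn_small //; lia.
lia.
Qed.

Lemma nrm_sum (I : finType) (F : I -> G) :
  (nrm (\sum_i F i)%R <= \sum_i nrm (F i))%N.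
Proof.
apply: (big_ind2 (fun x k => nrm x <= k)%N) => //.
by move=> x k y l xk yl; apply: leq_trans (nrmD x y) _; exact: leq_add.
Qed.

Lemma nrm_subC x y : nrm (x - y) = nrm (y - x).
Proof. by rewrite -nrmN opprB. Qed.

Lemma nrm_le_dist x y : (nrm (x - y)%R)%:R <= `|x%:R - y%:R| :> R.
Proof.
wlog yx : x y / (y <= x)%N.
  move=> H; case/orP: (leq_total y x) => h; first exact: H.
  by rewrite nrm_subC distrC; exact: H.
rewrite -natrB // normr_nat ler_nat /nrm.
have -> : nat_of_ord (x - y)%R = (x - y)%N.
  rewrite /= modnDmr; have := ltn_ord y; have := ltn_ord x => xM yM.
  have -> : (x + (M.+1 - y) = (x - y) + M.+1)%N by lia.
  by rewrite modnDr modn_small //; lia.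
exact: geq_minl.
Qed.

(** The exponential is chosen because products of kernels are kernels of sums
of distances, to which the triangle inequality applies. *)
Definition kern a x : R := expR (- (a * (nrm x)%:R)).

Definition kmass a : R := \sum_x kern a x.

Lemma kern_gt0 a x : 0 < kern a x.
Proof. exact: expR_gt0. Qed.

Lemma kern_ge0 a x : 0 <= kern a x.
Proof. exact: expR_ge0. Qed.

Lemma kern_sym a x y : kern a (x - y) = kern a (y - x).
Proof. by rewrite /kern nrm_subC. Qed.

Lemma kernE a x : kern a x = expR (- a) ^+ nrm x.
Proof. by rewrite /kern -mulNr expRM_natr. Qed.

Lemma sum_kern_shift a t : \sum_x kern a (x - t) = kmass a.
Proof.
by rewrite (reindex_inj (addIr t)) /=; apply: eq_bigr => x _; rewrite addrK.
Qed.

Lemma kmass_gt0 a : 0 < kmass a.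
Proof.
rewrite /kmass (bigD1 0) //= ltr_wpDr ?kern_gt0 //.
by apply: sumr_ge0 => x _; exact: kern_ge0.
Qed.

(** Each distance occurs at most twice in the group, so that [kmass] agrees up
to a factor 2 with a truncated geometric sum, for which scaling in [a] is
explicit. *)
Definition half_geo a : R := \sum_(i < (M.+1)./2.+1) expR (- a) ^+ i.

Lemma half_geo_le_kmass a : half_geo a <= kmass a.
Proof.
have H : ((M.+1)./2.+1 <= M.+1)%N.
  by have := odd_double_half M.+1; rewrite -addnn; lia.
rewrite /half_geo (big_ord_widen _ (fun i => expR (- a) ^+ i) H) /kmass.
rewrite big_mkcond /=; apply: ler_sum => x _; case: ifP => xH; last exact: kern_ge0.
rewrite kernE /nrm; have /minn_idPl -> // : (x <= M.+1 - x)%N.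
have := odd_double_half M.+1; move: xH; rewrite -addnn; lia.
Qed.

Lemma kmass_le_half_geo a : kmass a <= 2 * half_geo a.
Proof.
(* The two residues at distance [i] from 0 are [i] and [M.+1 - i]. *)
pose h (x : G) (i : nat) : R := (nat_of_ord x == i)%:R + ((M.+1 - x)%N == i)%:R.
have H x : kern a x <=
    \sum_(i < (M.+1)./2.+1) h x i * expR (- a) ^+ i.
  have nH : (nrm x < (M.+1)./2.+1)%N.
    rewrite /nrm; have := odd_double_half M.+1; have := ltn_ord x.
    rewrite -addnn; lia.
  rewrite (bigD1 (Ordinal nH)) //= kernE -[leLHS]addr0; apply: lerD.
    rewrite -[leLHS]mul1r ler_wpM2r ?exprn_ge0 ?expR_ge0 // /h /nrm.
    by rewrite /minn; case: ifP => _; rewrite eqxx ?lerDl ?lerDr ler0n.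
  by apply: sumr_ge0 => i _; rewrite mulr_ge0 ?exprn_ge0 ?expR_ge0 // addr_ge0.
apply: (le_trans (ler_sum _ (fun x _ => H x))).
rewrite exchange_big /= mulr_sumr; apply: ler_sum => i _.
rewrite -mulr_suml ler_wpM2r ?exprn_ge0 ?expR_ge0 // big_split /=.
have c1 (Q : pred G) : (forall x y, Q x -> Q y -> x = y) ->
    \sum_x (Q x)%:R <= 1 :> R.
  move=> Qi; have [[x0 Qx0]|NQ] := pselect (exists x, Q x).
    rewrite (bigD1 x0) //= Qx0 big1 ?addr0 // => x xx0.
    by case E : (Q x) => //; move: xx0; rewrite (Qi _ _ E Qx0) eqxx.
  by rewrite big1 // => x _; case E : (Q x) => //; case: NQ; exists x.
apply: lerD; apply: c1 => x y /eqP E1 /eqP E2; apply: val_inj => /=.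
  by rewrite E1.
by have := ltn_ord x; have := ltn_ord y; lia.
Qed.

(** Halving [a] replaces the ratio of the geometric sum by its square root:
consecutive terms of the finer sum pair up. *)
Lemma half_geo_double a : 0 <= a -> half_geo (a / 2) <= 2 * half_geo a.
Proof.
move=> a0; rewrite /half_geo; set q := expR (- (a / 2)).
have q0 : 0 <= q by exact: expR_ge0.
have q1 : q <= 1 by rewrite expR_le1 oppr_le0 divr_ge0.
have -> : expR (- a) = q ^+ 2.
  by rewrite -expRM_natr mulNr divfK.
set H := _.+1.
apply: (@le_trans _ _ (\sum_(i < H.*2) q ^+ i)).
  have HH : (H <= H.*2)%N by rewrite -addnn leq_addr.
  rewrite (big_ord_widen _ (fun i => q ^+ i) HH) big_mkcond /=.
  by apply: ler_sum => i _; case: ifP => // _; rewrite exprn_ge0.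
elim: H => [|H IH]; first by rewrite !big_ord0 mulr0.
rewrite doubleS !big_ord_recr /= mulrDr -addrA lerD // -exprM mul2n.
rewrite exprS; have : q * q ^+ H.*2 <= q ^+ H.*2.
  by rewrite ler_piMl // exprn_ge0.
move: (_ ^+ _) => u; lra.
Qed.

Lemma kmass_half a : 0 <= a -> kmass (a / 2) <= 4 * kmass a.
Proof.
move=> a0; apply: le_trans (kmass_le_half_geo _) _.
have := half_geo_double a0; have := half_geo_le_kmass a.
move: (half_geo _) (half_geo _) (kmass _) => u v w; lra.
Qed.

Lemma kmass_dyadic a j : 0 <= a -> kmass (a / 2 ^+ j) <= 2 * 2 ^+ j * kmass a.
Proof.
move=> a0; apply: le_trans (kmass_le_half_geo _) _.
have H : half_geo (a / 2 ^+ j) <= 2 ^+ j * half_geo a.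
  elim: j => [|j IH]; first by rewrite expr0 divr1 mul1r.
  rewrite exprSr invfM mulrA.
  apply: le_trans (half_geo_double _) _; first by rewrite divr_ge0 ?exprn_ge0.
  by rewrite [2 ^+ j * 2]mulrC -mulrA ler_pM2l.
rewrite -mulrA ler_pM2l //; apply: le_trans H _.
by rewrite ler_pM2l ?exprn_gt0 // half_geo_le_kmass.
Qed.

Lemma kmass_le a : 0 < a <= 1 -> kmass a <= 4 / a.
Proof.
move=> /andP[a0 a1]; apply: le_trans (kmass_le_half_geo _) _.
set q := expR (- a).
have q0 : 0 < q by exact: expR_gt0.
have qa : a / 2 <= 1 - q.
  have : (1 + a) * q <= 1.
    rewrite -[leRHS](expRxMexpNx_1 a) ler_pM2r //; exact: expR_ge1Dx.
  move: q0; move: q => q; nra.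
have E : (1 - q) * half_geo a <= 1.
  have := subrX1 q (M.+1)./2.+1; rewrite -/(half_geo a).
  have : 0 <= q ^+ (M.+1)./2.+1 by rewrite exprn_ge0 // ltW.
  move: (_ ^+ _) (half_geo a) => u h u0; nra.
rewrite ler_pdivlMr //.
have h0 : 0 <= half_geo a by apply: sumr_ge0 => i _; rewrite exprn_ge0 // ltW.
move: qa E h0; move: (half_geo a) => h; nra.
Qed.

(** Replacing [a] by [a * (1 + n^-1)] loses the fraction [a * y / n] of the
kernel at distance [y], which is at most [2 / n] times the wider kernel with
parameter [a / 2].  The relative loss is thus of order [1 / n], and the
[2 * n]-th powers remain comparable up to an absolute constant. *)
Lemma kmass_perturb a (n : nat) : 0 <= a -> (16 <= n)%N ->
  kmass a ^+ (2 * n) <= expR 32 * kmass (a * (1 + n%:R^-1)) ^+ (2 * n).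
Proof.
move=> a0 n16; have n0 : 0 < n%:R :> R by rewrite ltr0n; lia.
have H1 : kmass a * (1 - 8 / n%:R) <= kmass (a * (1 + n%:R^-1)).
  apply: (@le_trans _ _ (kmass a - 2 / n%:R * kmass (a / 2))).
    have := kmass_half a0; have : 0 < n%:R^-1 :> R by rewrite invr_gt0.
    move: (n%:R^-1) (kmass a) (kmass _) => w k k'; nra.
  rewrite /kmass mulr_sumr -sumrB; apply: ler_sum => x _.
  rewrite /kern; set y := (nrm x)%:R.
  have y0 : 0 <= y by exact: ler0n.
  have -> : - (a * (1 + n%:R^-1) * y) = - (a * y) + - (a * y / n%:R) by ring.
  have -> : - (a * y) = - (a / 2 * y) + - (a / 2 * y) by lra.
  rewrite !expRD; set e := expR (- (a / 2 * y)).
  have e0 : 0 < e by exact: expR_gt0.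
  have h1 : a / 2 * y * e <= 1.
    rewrite -[leRHS](expRxMexpNx_1 (a / 2 * y)) ler_pM2r //.
    by have := expR_ge1Dx (a / 2 * y); move: (a / 2 * y) => u; lra.
  have h2 := expR_ge1Dx (- (a * y / n%:R)).
  have h3 : 0 < n%:R^-1 :> R by rewrite invr_gt0.
  have h4 : e * e * (1 + - (a * y / n%:R)) <= e * e * expR (- (a * y / n%:R)).
    by rewrite ler_pM2l // mulr_gt0.
  apply: le_trans h4.
  have : n%:R^-1 * e * (a / 2 * y * e) <= n%:R^-1 * e * 1.
    by rewrite ler_pM2l // mulr_gt0.
  by move: (n%:R^-1) => w; lra.
have H2 : kmass a <= expR (16 / n%:R) * kmass (a * (1 + n%:R^-1)).
  have k0 := kmass_gt0 (a * (1 + n%:R^-1)).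
  have : (1 + 16 / n%:R) * kmass (a * (1 + n%:R^-1)) <=
    expR (16 / n%:R) * kmass (a * (1 + n%:R^-1)).
    by rewrite ler_pM2r // expR_ge1Dx.
  apply: le_trans.
  have w0 : 0 < n%:R^-1 :> R by rewrite invr_gt0.
  have w1 : n%:R^-1 <= 16^-1 :> R by rewrite lef_pV2 ?posrE // ler_nat.
  have ka := kmass_gt0 a.
  have : (1 + 16 / n%:R) * (kmass a * (1 - 8 / n%:R)) <=
         (1 + 16 / n%:R) * kmass (a * (1 + n%:R^-1)).
    rewrite ler_pM2l //; lra.
  apply: le_trans; move: (n%:R^-1) w0 w1 (kmass a) ka => w wp w1 k kp.
  have : 0 <= k * w * (8 - 128 * w) by apply: mulr_ge0; [rewrite mulr_ge0 // ltW | lra].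
  lra.
have := @lerXn2r R (2 * n)%N _ _ _ _ H2.
rewrite !nnegrE (ltW (kmass_gt0 a)) mulr_ge0 ?expR_ge0 ?(ltW (kmass_gt0 _)) //.
move=> /(_ isT isT); rewrite exprMn -expRM_natr.
suff -> : 16 / n%:R * (2 * n)%N%:R = 32 :> R by [].
by rewrite natrM; move: (n%:R) n0 => w w0; field; exact: lt0r_neq0.
Qed.

(** Positive weights with [lam]-Lipschitz logarithm: the class which the
induction on scales runs over.  Multiplication by a kernel of parameter [a]
stays in it, at the price of adding [a] to [lam]. *)
Definition tame (lam : R) v :=
  (forall x, 0 < v x) /\
  forall x y, v x <= expR (lam * (nrm (x - y)%R)%:R) * v y.

Lemma tame_one lam : 0 <= lam -> tame lam (fun=> 1).
Proof.
move=> l0; split => // x y; rewrite mulr1.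
by apply: le_trans (expR_ge1Dx _); rewrite lerDl mulr_ge0.
Qed.

Lemma tame_kern_shift a t : 0 <= a -> tame a (fun x => kern a (x - t)).
Proof.
move=> a0; split => [x|x y]; first exact: kern_gt0.
rewrite /kern -expRD ler_expR -mulrBr.
rewrite -[X in X <= _]mulrN ler_wpM2l // lerBrDl.
rewrite lerBlDr -natrD ler_nat.
by have := nrmD (y - x) (x - t); rewrite addrA subrK (nrm_subC y x).
Qed.

Lemma tameM lam mu v w : tame lam v -> tame mu w ->
  tame (lam + mu) (fun x => v x * w x).
Proof.
move=> [v0 vl] [w0 wl]; split => [x|x y]; first by rewrite mulr_gt0.
rewrite mulrDl expRD mulrACA; apply: ler_pM => //; exact: ltW.
Qed.

End kernels.

(** * Energies and their decoupling *)

Section decoupling.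
Context {R : realType} {M : nat}.
Local Notation G := 'I_M.+1.
Local Notation nrm := (@nrm M).
Local Notation kmass := (@kmass R M).
Implicit Types (f g v m : G -> R) (x y s t : G) (a E : R).

(** The mean of the [2 * n]-th power of the modulus of the Fourier transform.
By Parseval it is the squared L^2 norm of the [n]-fold convolution power, that
is, the additive energy of order [n] ([energy_convn]). *)
Definition energy (n : nat) f : R := M.+1%:R^-1 * \sum_(k : G) pw f k ^+ n.

Lemma energy_ge0 n f : 0 <= energy n f.
Proof.
by rewrite mulr_ge0 ?invr_ge0 ?ler0n // sumr_ge0 // => k _; rewrite exprn_ge0 ?pw_ge0.
Qed.

Lemma energy_convn n f :
  energy n f = \sum_s convn (fun _ : 'I_n => f) s ^+ 2.
Proof.
rewrite /energy; apply: (@mulfI _ M.+1%:R); first by rewrite pnatr_eq0.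
rewrite mulrA mulfV ?pnatr_eq0 // mul1r -parseval; apply: eq_bigr => k _.
by rewrite pw_convn prodr_const card_ord.
Qed.

Lemma energy_le_mass n f : (forall x, 0 <= f x) ->
  energy n f <= (\sum_x f x) ^+ (2 * n).
Proof.
move=> f0; rewrite /energy mulrC ler_pdivrMr ?ltr0n // mulr_natr.
rewrite (_ : _ *+ _ = \sum_(k : G) (\sum_x f x) ^+ (2 * n)); last first.
  by rewrite sumr_const card_ord.
apply: ler_sum => k _; rewrite exprM; apply: lerXn2r; rewrite ?nnegrE ?pw_ge0 ?sqr_ge0 //.
exact: pw_le_sqr.
Qed.

Lemma pw_eq0 f k : (forall x, f x = 0) -> pw f k = 0.
Proof.
move=> f0; rewrite pwE big1 // => x _; rewrite big1 // => y _.
by rewrite f0 !mul0r.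
Qed.

(** On the Fourier side the convolution is a product over [i]; after
normalisation of each factor by [m i] the inequality of the means separates
them. *)
Lemma sum_convn_sqr_le n (F : 'I_n -> G -> R) (m : 'I_n -> R) E : (0 < n)%N ->
  0 <= E -> (forall i, 0 <= m i) -> (forall i k, m i = 0 -> pw (F i) k = 0) ->
  (forall i, energy n (F i) <= E * m i ^+ (2 * n)) ->
  \sum_s convn F s ^+ 2 <= E * (\prod_i m i) ^+ 2.
Proof.
move=> n0 E0 m0 mF HE; have N0 : 0 < M.+1%:R :> R by rewrite ltr0n.
rewrite -(ler_pM2l N0) -parseval.
pose al i (k : nat) := pw (F i) k / m i ^+ 2.
have alE i k : pw (F i) k = al i k * m i ^+ 2.
  rewrite /al; have [mi|mi] := eqVneq (m i) 0.
    by rewrite mF // mul0r mul0r.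
  by rewrite divfK // expf_neq0.
have al0 i k : 0 <= al i k by rewrite divr_ge0 ?pw_ge0 ?sqr_ge0.
have pE (k : nat) : pw (convn F) k = (\prod_i al i k) * \prod_i m i ^+ 2.
  by rewrite pw_convn -big_split /=; apply: eq_bigr.
rewrite (eq_bigr _ (fun (k : G) _ => pE k)).
rewrite -mulr_suml -[in leRHS]prodrXl mulrA ler_wpM2r //.
  by apply: prodr_ge0 => i _; exact: sqr_ge0.
apply: (@le_trans _ _ (\sum_(k : G) n%:R^-1 * \sum_(i < n) al i k ^+ n)).
  by apply: ler_sum => k _; exact: prod_le_mean_expr.
rewrite -mulr_sumr exchange_big /= mulrC ler_pdivrMr ?ltr0n // mulr_natr.
rewrite (_ : _ *+ n = \sum_(i < n) M.+1%:R * E); last first.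
  by rewrite sumr_const card_ord.
apply: ler_sum => i _.
have [mi|mi] := eqVneq (m i) 0.
  rewrite big1 ?mulr_ge0 ?(ltW N0) // => k _.
  by rewrite /al mF // mul0r expr0n gtn_eqF.
have mp : 0 < m i ^+ (2 * n) by rewrite exprn_gt0 // lt_neqAle eq_sym mi m0.
under eq_bigr do rewrite /al expr_div_n -exprM.
rewrite -mulr_suml ler_pdivrMr // -mulrA -ler_pdivrMl //.
by apply: le_trans (HE i).
Qed.

(** The contribution to the [n]-fold convolution at [s] of the families
[F (t i)] whose centres [t i] add up to [tau]. *)
Definition joint n (F : G -> G -> R) (s tau : G) : R :=
  \sum_(t : {ffun 'I_n -> G} | \sum_i t i == tau)
    convn (fun i => F (t i)) s.

(** For each tuple of centres [sum_convn_sqr_le] applies, with the masses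
[m t] of the pieces; Cauchy-Schwarz with weights [\prod_i m (t i)] collects
the tuples with a given sum, and the sums of these weights form the
convolution power of [m]. *)
Lemma sum_joint_sqr_le n (F : G -> G -> R) E : (0 < n)%N -> 0 <= E ->
  (forall t x, 0 <= F t x) ->
  (forall t, energy n (F t) <= E * (\sum_x F t x) ^+ (2 * n)) ->
  \sum_s \sum_tau joint n F s tau ^+ 2 <=
  E * energy n (fun t => \sum_x F t x).
Proof.
move=> n0 E0 F0 HE; pose m t := \sum_x F t x.
have m0 t : 0 <= m t by apply: sumr_ge0.
have Fm t x : m t = 0 -> F t x = 0.
  move=> /eqP; rewrite psumr_eq0 // => /allP /(_ x (mem_index_enum x)).
  by move=> /eqP.
rewrite energy_convn exchange_big /= mulr_sumr; apply: ler_sum => tau _.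
pose mm (t : {ffun 'I_n -> G}) := \prod_i m (t i).
have mm0 (t : {ffun 'I_n -> G}) : 0 <= mm t by apply: prodr_ge0.
pose c (t : {ffun 'I_n -> G}) s := convn (fun i => F (t i)) s.
have H (t : {ffun 'I_n -> G}) : \sum_s c t s ^+ 2 <= E * mm t ^+ 2.
  apply: sum_convn_sqr_le => // i k mi; apply: pw_eq0 => x; exact: Fm.
apply: (@le_trans _ _ (\sum_s
   (convn (fun=> m) tau *
    \sum_(t : {ffun 'I_n -> G} | \sum_i t i == tau) c t s ^+ 2 / mm t))).
  apply: ler_sum => s _; apply: sum_sqr_le_weighted => // t.
  move=> /eqP; rewrite prodf_seq_eq0 => /hasP[i _ /= /eqP mi].
  rewrite /c /convn big1 // => x _; rewrite (bigD1 i) //= Fm // mul0r //.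
rewrite -mulr_sumr exchange_big /= -/m expr2 [leRHS]mulrCA.
rewrite ler_wpM2l //; first by apply: convn_ge0.
rewrite [in leRHS]/convn mulr_sumr.
apply: ler_sum => t _; rewrite -mulr_suml.
rewrite -/(mm t); have [mt|mt] := eqVneq (mm t) 0.
  by rewrite mt invr0 !mulr0.
rewrite ler_pdivrMr ?lt_neqAle 1?eq_sym ?mt ?mm0 //.
by rewrite -mulrA -expr2; exact: H.
Qed.

(** Each [f (x i)] is an average over centres [t i] of localised pieces.  The
kernels have slightly too large a parameter, [a * (1 + n^-1)]: the excess
[a / n] spent on all of them is, by the triangle inequality, at least a kernel
of parameter [a / n] in [s - tau].  This keeps [tau] close to [s], so that
the sum over [tau] costs only [kmass (a / n)] in [energy_step]. *)
Lemma convn_le_joint n a f s : (0 < n)%N -> 0 <= a -> (forall x, 0 <= f x) ->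
  kmass (a * (1 + n%:R^-1)) ^+ n * convn (fun _ : 'I_n => f) s <=
  \sum_tau kern (a / n%:R) (s - tau) *
    joint n (fun t x => f x * kern a (x - t)) s tau.
Proof.
move=> n0 a0 f0; set a' := a * _.
rewrite /joint /convn mulr_sumr.
pose T (x t : {ffun 'I_n -> G}) := \prod_i (f (x i) * kern a (x i - t i)).
apply: (@le_trans _ _ (\sum_(x : {ffun 'I_n -> G} | \sum_i x i == s)
   \sum_(t : {ffun 'I_n -> G}) kern (a / n%:R) (s - \sum_i t i) * T x t)).
  apply: ler_sum => x /eqP xs.
  have -> : kmass a' ^+ n * \prod_i f (x i) =
    \prod_i \sum_t (f (x i) * kern a' (x i - t)).
    rewrite (_ : _ ^+ n = \prod_(i < n) kmass a'); last first.
      by rewrite prodr_const card_ord.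
    rewrite -big_split /=.
    apply: eq_bigr => i _; rewrite -mulr_sumr mulrC; congr (_ * _).
    by rewrite -(sum_kern_shift a' (x i)); apply: eq_bigr => t _; rewrite kern_sym.
  rewrite bigA_distr_bigA /=; apply: ler_sum => t _.
  rewrite /T !big_split /= mulrCA ler_wpM2l ?prodr_ge0 //.
  have S (b : R) : \prod_i kern b (x i - t i) =
      expR (- (b * (\sum_i nrm (x i - t i)%R)%:R)).
    by rewrite /kern -expR_sum; congr expR; rewrite sumrN -mulr_sumr natr_sum.
  rewrite !S /kern -expRD ler_expR -xs -sumrB.
  have := nrm_sum (fun i => x i - t i); rewrite -(ler_nat R).
  set u := (_)%:R; set w := (_)%:R => uw.
  have : a / n%:R * u <= a / n%:R * w by rewrite ler_wpM2l // divr_ge0.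
  by rewrite /a'; lra.
rewrite exchange_big /= -(sum_fibre_ffun (fun t : {ffun 'I_n -> G} =>
  \sum_(x : {ffun 'I_n -> G} | \sum_i x i == s)
    kern (a / n%:R) (s - \sum_i t i) * T x t)) /=.
apply: ler_sum => tau _; rewrite mulr_sumr; apply: ler_sum => t /eqP ->.
by rewrite -mulr_sumr.
Qed.

(** If all localisations of [f] satisfy an energy bound with constant [E],
then so does [f], with [E] multiplied by the energy of the smoothing
of [f] by [kern a] and by quotients of kernel masses. *)
Lemma energy_step n a f E : (0 < n)%N -> 0 <= a -> 0 <= E ->
  (forall x, 0 <= f x) ->
  (forall t, energy n (fun x => f x * kern a (x - t)) <=
     E * (\sum_x f x * kern a (x - t)) ^+ (2 * n)) ->
  kmass (a * (1 + n%:R^-1)) ^+ (2 * n) * energy n f <=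
  kmass (a / n%:R) * (E * (M.+1%:R^-1 * \sum_(k : G) (pw f k * pw (@kern R M a) k) ^+ n)).
Proof.
move=> n0 a0 E0 f0 HE; rewrite energy_convn mulr_sumr.
pose F t x := f x * kern a (x - t).
have F0 t x : 0 <= F t x by rewrite mulr_ge0 ?kern_ge0.
have J0 s tau : 0 <= joint n F s tau.
  by apply: sumr_ge0 => t _; apply: convn_ge0 => i x; exact: F0.
apply: (@le_trans _ _
  (\sum_s kmass (a / n%:R) * \sum_tau joint n F s tau ^+ 2)).
  apply: ler_sum => s _; rewrite mulnC exprM -exprMn.
  apply: (@le_trans _ _ ((\sum_tau kern (a / n%:R) (s - tau) * joint n F s tau) ^+ 2)).
    rewrite lerXn2r ?nnegrE //.
    - by rewrite mulr_ge0 ?exprn_ge0 ?(ltW (kmass_gt0 _)) // convn_ge0.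
    - by apply: sumr_ge0 => tau _; rewrite mulr_ge0 ?kern_ge0.
    exact: convn_le_joint.
  pose r tau := Num.sqrt (kern (a / n%:R) (s - tau)).
  have rE tau : r tau ^+ 2 = kern (a / n%:R) (s - tau) by rewrite sqr_sqrtr ?kern_ge0.
  have := sum_cauchy_schwarz xpredT r (fun tau => r tau * joint n F s tau).
  under eq_bigr do rewrite mulrA -expr2 rE.
  move=> /le_trans; apply.
  under eq_bigr do rewrite rE kern_sym.
  rewrite sum_kern_shift ler_wpM2l ?(ltW (kmass_gt0 _)) //.
  apply: ler_sum => tau _; rewrite exprMn rE -[leRHS]mul1r ler_wpM2r ?sqr_ge0 //.
  by rewrite /kern expR_le1 oppr_le0 mulr_ge0 // divr_ge0.
rewrite -mulr_sumr ler_wpM2l ?(ltW (kmass_gt0 _)) //.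
apply: le_trans (sum_joint_sqr_le n0 E0 F0 HE) _.
rewrite ler_wpM2l // /energy ler_wpM2l ?invr_ge0 ?ler0n //.
apply: ler_sum => k _; rewrite -pw_convol.
rewrite le_eqVlt; apply/predU1l; congr (_ ^+ _); congr (pw _ k).
by apply/funext => t; rewrite /convol; apply: eq_bigr => x _; rewrite kern_sym.
Qed.

End decoupling.

(** * Intermediate frequencies: one scale of halving *)

Section single_scale.
Context {R : realType} {M : nat}.
Local Notation G := 'I_M.+1.
Local Notation N := (M.+1%:R : R).
Local Notation freq := (@freq R M).
Implicit Types (u v : G -> R) (x y : G).

Lemma cosD_2pin (t : R) (k : nat) : cos (t + k%:R * (2 * pi)) = cos t.
Proof.
have /(congr1 (@complex.Re R)) : cis (t + k%:R * (2 * pi)) = cis t.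
  by rewrite cisD cis_2pi mulr1.
by [].
Qed.

(** The frequencies [k] and [M.+1 - k] are conjugate, so only the distance of
[k] to 0 matters. *)
Lemma cos_freq_nrm (k x y : G) :
  cos (freq (nrm k) x - freq (nrm k) y : R) = cos (freq k x - freq k y).
Proof.
rewrite /nrm /minn; case: ifP => // _.
rewrite -[LHS](cosD_2pin _ y).
have -> : freq (M.+1 - k) x - freq (M.+1 - k) y + y%:R * (2 * pi) =
   - (freq k x - freq k y) + x%:R * (2 * pi) :> R.
  rewrite /freq natrB; last exact: ltnW.
  have : N != 0 by rewrite pnatr_eq0.
  by move: N => n n0; field.
by rewrite cosD_2pin cosN.
Qed.

Lemma cos_freq_sub (k : nat) x y :
  cos (freq k x - freq k y : R) = cos (2 * pi * (k%:R / N * (x%:R - y%:R))).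
Proof. by congr cos; rewrite /freq; ring. Qed.

Lemma cos_far (del e : R) : 0 <= del -> del <= `|e| <= 2^-1 ->
  cos (2 * pi * e) <= cos (2 * pi * del).
Proof.
move=> d0 /andP[de e2]; have pi0 := @pi_gt0 R.
rewrite -(cos_norm (2 * pi * e)) normrM (ger0_norm (_ : 0 <= 2 * pi)); last lra.
rewrite leNgt ltr_cos ?in_itv /=.
- by rewrite -leNgt ler_pM2l // mulr_gt0.
- apply/andP; split; first by rewrite !mulr_ge0 // ltW.
  nra.
- apply/andP; split; first by rewrite !mulr_ge0 // ltW.
  nra.
Qed.

(** The halving property for a vector indexed by an interval of integers: the
distances are those of the line, not of the cyclic group.  The centres are
real, since the ones arising from a frequency are not integers. *)
Definition nonconc (A d : R) u := forall y r : R, 1 <= r -> A * r <= d ->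
  \sum_(x : G | `|x%:R - y| <= r) u x <= 2^-1 * \sum_(x : G | `|x%:R - y| <= A * r) u x.

Lemma expR_quarter : expR (4^-1) <= 3 / 2 :> R.
Proof.
have h := expR_ge1Dx (- 4^-1 : R); have := expRxMexpNx_1 (4^-1 : R).
have : 0 < expR (4^-1) :> R := expR_gt0 _.
by move: (expR _) (expR _) h => p q; nra.
Qed.

(** On a ball of radius [A * r] a tame weight varies by a factor of at most
[exp (1 / 8)] on either side of its value at a fixed point, so that halving for
[u] gives the ratio [exp (1 / 4) / 2 <= 3 / 4] for [v * u].  The predicate
[S] isolates one of the clusters which occur in [cos_sum_le]. *)
Lemma near_mass_le (A d lam al c r : R) u v (S : pred G) :
  nonconc A d u -> (forall x, 0 <= u x) -> tame lam v -> 0 <= lam ->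
  1 <= A -> 1 <= r -> A * r <= d -> 0 < al -> 8 * lam <= al -> A * r * 2 <= al^-1 ->
  (forall x, `|x%:R - c| <= A * r -> S x) ->
  \sum_(x : G | S x && (`|x%:R - c| <= r)) v x * u x <= 3 / 4 * \sum_(x : G | S x) v x * u x.
Proof.
move=> Hu u0 [v0 vl] lam0 A1 r1 Ard al0 lal Aral HS.
have F0 (P : pred G) : 0 <= \sum_(x | P x) v x * u x.
  by apply: sumr_ge0 => x _; rewrite mulr_ge0 // ltW.
have [[x0 Hx0]|NX] := pselect (exists x : G, `|x%:R - c| <= r); last first.
  rewrite big_pred0 ?mulr_ge0 // => x; apply/negP => /andP[_ h].
  by apply: NX; exists x.
have rA : r <= A * r by rewrite ler_peMl //; lra.
have near x : `|x%:R - c| <= A * r -> lam * (nrm (x - x0)%R)%:R <= 8^-1.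
  move=> hx.
  have h1 : (nrm (x - x0)%R)%:R <= al^-1 :> R.
    apply: le_trans (nrm_le_dist x x0) _.
    have -> : x%:R - x0%:R = (x%:R - c) - (x0%:R - c) :> R by ring.
    apply: le_trans (ler_normB _ _) _; lra.
  have : lam * (nrm (x - x0)%R)%:R <= lam * al^-1 by rewrite ler_wpM2l.
  have : 8 * lam / al <= 1 by rewrite ler_pdivrMr // mul1r.
  by move: (al^-1) ((nrm (x - x0)%R)%:R) => w z; lra.
have e18 : expR 8^-1 * expR 8^-1 = expR 4^-1 :> R.
  by rewrite -expRD; congr expR; lra.
apply: (@le_trans _ _ (expR 8^-1 * v x0 * \sum_(x : G | `|x%:R - c| <= r) u x)).
  rewrite mulr_sumr (eq_bigl (fun x : G => `|x%:R - c| <= r)) => [|x]; last first.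
    by apply: andb_idl => h; apply: HS; exact: le_trans h rA.
  apply: ler_sum => x h; rewrite ler_wpM2r //.
  apply: le_trans (vl x x0) _; rewrite ler_wpM2r ?(ltW (v0 _)) // ler_expR.
  by apply: near; exact: le_trans h rA.
apply: (@le_trans _ _ (expR 8^-1 * v x0 * (2^-1 * \sum_(x : G | `|x%:R - c| <= A * r) u x))).
  by rewrite ler_wpM2l ?Hu // mulr_ge0 ?expR_ge0 // ltW.
apply: (@le_trans _ _ (3 / 4 * \sum_(x : G | `|x%:R - c| <= A * r) v x * u x)).
  rewrite mulrA !mulr_sumr; apply: ler_sum => x h.
  rewrite [leRHS]mulrA ler_wpM2r //.
  have vx : v x0 <= expR 8^-1 * v x.
    apply: le_trans (vl x0 x) _; rewrite ler_wpM2r ?(ltW (v0 _)) // ler_expR.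
    by rewrite nrm_subC; exact: near.
  have := ler_wpM2l (expR_ge0 8^-1) vx; rewrite mulrA e18 => H.
  have := ler_wpM2r (ltW (v0 x)) expR_quarter; lra.
rewrite ler_wpM2l //.
rewrite [leRHS](bigID (fun x : G => `|x%:R - c| <= A * r)) /=.
rewrite (eq_bigl (fun x : G => S x && (`|x%:R - c| <= A * r))) => [|x]; last first.
  by rewrite andb_idl // => h; exact: HS.
by rewrite lerDl.
Qed.

(** The points where the phase is close to an integer form clusters, one for
each integer.  By [near_mass_le] each cluster carries at most three quarters of
the mass of the points for which that integer is the nearest one, hence at least
one quarter of the total mass sees a cosine bounded away from 1. *)
Lemma cos_sum_le (A d lam al : R) u v (y : G) :
  nonconc A d u -> (forall x, 0 <= u x) -> tame lam v -> 0 < lam ->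
  1 <= A -> 1 <= lam * d -> 8 * lam <= al -> al * (4 * A) <= 1 ->
  \sum_x v x * u x * cos (2 * pi * (al * (x%:R - y%:R))) <=
  (1 - (1 - cos (2 * pi / (4 * A))) / 4) * \sum_x v x * u x.
Proof.
move=> Hu u0 vl lam0 A1 ld lal alA; have v0 := vl.1.
have al0 : 0 < al by lra.
have f0 x : 0 <= v x * u x by rewrite mulr_ge0 // ltW.
have A40 : 0 < 4 * A by lra.
pose del := (4 * A)^-1; pose K := M.+1.
have del0 : 0 < del by rewrite invr_gt0.
have del4 : del <= 4^-1 by rewrite /del lef_pV2 ?posrE //; lra.
have aldel : al <= del by rewrite /del -div1r ler_pdivlMr.
pose phi (x : G) := al * (x%:R - y%:R).
(* [j x] is the integer nearest to the phase, shifted by [K] to be a natural. *)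
pose j (x : G) := Num.truncn (phi x + 2^-1 + K%:R).
have xN (x : G) : 0 <= (x%:R : R) <= N by rewrite ler0n ler_nat ltnW.
have phiB x : - N <= phi x <= N.
  have := xN x; have := xN y => /andP[y0 yN] /andP[x0 xxN].
  by rewrite /phi; apply/andP; split; nra.
have jP x : (j x)%:R <= phi x + 2^-1 + K%:R < (j x)%:R + 1.
  rewrite natr1; apply: truncn_itv; have := phiB x; rewrite -/N /K; lra.
have jB x : (j x < (2 * M.+1).+2)%N.
  rewrite -(ltr_nat R) -natr1 -natr1 natrM.
  have := jP x; have := phiB x; rewrite /K; lra.
pose e x := phi x + K%:R - (j x)%:R.
have eB x : `|e x| <= 2^-1 by rewrite ler_norml /e; have := jP x; lra.
have cosE x : cos (2 * pi * phi x) = cos (2 * pi * e x).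
  rewrite -[LHS](cosD_2pin _ K) -[RHS](cosD_2pin _ (j x)); congr cos.
  by rewrite /e; ring.
have near : \sum_(x | `|e x| < del) v x * u x <= 3 / 4 * \sum_x v x * u x.
  rewrite (partition_big (fun x => inord (j x) : 'I_(2 * M.+1).+2) xpredT) //=.
  rewrite [in leRHS](partition_big (fun x => inord (j x) : 'I_(2 * M.+1).+2) xpredT) //=.
  rewrite mulr_sumr; apply: ler_sum => i _.
  (* The point of the line at which the phase equals the integer coded by [i]. *)
  pose c := y%:R + (i%:R - K%:R) / al.
  have dist (x : G) : `|x%:R - c| = `|phi x + K%:R - i%:R| / al.
    rewrite -[X in _ / X](gtr0_norm al0) -normf_div; congr (`|_|).
    by rewrite /c /phi; field; rewrite gt_eqF.
  have jE x : (inord (j x) == i) = (j x == i) by rewrite -val_eqE /= inordK.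
  apply: (@le_trans _ _ (\sum_(x : G | (inord (j x) == i) && (`|x%:R - c| <= del / al))
     v x * u x)).
    rewrite [leRHS](bigID (fun x => `|e x| < del)) /=.
    rewrite (eq_bigl (fun x : G => (inord (j x) == i) &&
       (`|x%:R - c| <= del / al) && (`|e x| < del))); last first.
      move=> x; rewrite jE; case: eqP => // ji; rewrite ?andbF //= andbT.
      rewrite andb_idl // dist ler_pM2r ?invr_gt0 //.
      by rewrite -ji -/(e x) => /ltW.
    by rewrite lerDl sumr_ge0.
  have AA : A * (del / al) = (4 * al)^-1 by rewrite /del; field; lra.
  apply: (@near_mass_le A d lam al) => //.
  - exact: ltW.
  - by rewrite ler_pdivlMr // mul1r.
  - rewrite AA -div1r ler_pdivrMr; last lra.
    have := ler_wpM2l (ltW lam0) (lexx d); nra.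
  - have : 0 < al^-1 by rewrite invr_gt0.
    by rewrite AA invfM; lra.
  - move=> x; rewrite dist AA invfM ler_pM2r ?invr_gt0 // => h.
    rewrite jE eqn_leq -ltnS -[(i <= _)%N]ltnS -!(ltr_nat R) -!natr1.
    by move: h; rewrite ler_norml; have := jP x; lra.
rewrite mulrBl mul1r.
have split_sum : \sum_x v x * u x = \sum_(x | `|e x| < del) v x * u x +
    \sum_(x | ~~ (`|e x| < del)) v x * u x by rewrite [LHS](bigID (fun x => `|e x| < del)).
have H : \sum_x v x * u x * cos (2 * pi * phi x) <=
   \sum_(x | `|e x| < del) v x * u x +
   cos (2 * pi / (4 * A)) * \sum_(x | ~~ (`|e x| < del)) v x * u x.
  rewrite (bigID (fun x => `|e x| < del)) /=; apply: lerD.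
    by apply: ler_sum => x _; rewrite ler_piMr // cos_le1.
  rewrite mulr_sumr; apply: ler_sum => x; rewrite -leNgt => ex.
  rewrite mulrC ler_wpM2r // cosE; apply: cos_far; first exact: ltW.
  by rewrite ex eB.
apply: le_trans H _; move: split_sum near (cos_le1 (2 * pi / (4 * A))).
move: (\sum_x v x * u x) (\sum_(x | `|e x| < del) v x * u x)
  (\sum_(x | ~~ (`|e x| < del)) v x * u x) (cos _) => T Ne Fa co TE NeT co1.
have : 0 <= (1 - co) * (Fa - T / 4) by apply: mulr_ge0; lra.
lra.
Qed.

Lemma pw_single_scale (A d lam : R) u v (k : G) :
  nonconc A d u -> (forall x, 0 <= u x) -> tame lam v -> 0 < lam ->
  1 <= A -> 1 <= lam * d ->
  8 * lam <= (nrm k)%:R / N -> (nrm k)%:R / N * (4 * A) <= 1 ->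
  pw (fun x => v x * u x) k <=
  (1 - (1 - cos (2 * pi / (4 * A))) / 4) * (\sum_x v x * u x) ^+ 2.
Proof.
move=> Hu u0 vl lam0 A1 ld lal alA; have v0 := vl.1.
rewrite pwE exchange_big /= expr2 mulrA mulr_sumr; apply: ler_sum => y _.
rewrite [leRHS]mulrC.
apply: le_trans (ler_wpM2l _ (cos_sum_le y Hu u0 vl lam0 A1 ld lal alA)); last first.
  by rewrite mulr_ge0 // ltW.
rewrite mulr_sumr; apply: ler_sum => x _.
rewrite -cos_freq_nrm cos_freq_sub le_eqVlt; apply/orP; left; apply/eqP; ring.
Qed.

End single_scale.

(** * High and low frequencies *)

Section high_frequencies.
Context {R : realType} {M : nat}.
Local Notation G := 'I_M.+1.
Local Notation N := (M.+1%:R : R).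
Local Notation kern := (@kern R M).
Local Notation kmass := (@kmass R M).
Local Notation nrm := (@nrm M).
Hypothesis M0 : (0 < M)%N.

Lemma kern_le_shift (a : R) (x y : G) : 0 <= a ->
  kern a x <= expR (a * (nrm (x - y)%R)%:R) * kern a y.
Proof.
move=> a0; have [_ /(_ x y)] := tame_kern_shift (0 : G) a0.
by rewrite !subr0.
Qed.

Lemma sum_kern_sqr (a : R) : \sum_x kern a x ^+ 2 = kmass (2 * a).
Proof.
by apply: eq_bigr => x _; rewrite /kern -expRM_natr; congr expR; ring.
Qed.

Lemma kmass_mono (a b : R) : a <= b -> kmass b <= kmass a.
Proof.
move=> ab; apply: ler_sum => x _; rewrite /kern ler_expR lerN2.
by rewrite ler_wpM2r.
Qed.

(** Convolution with the difference [h] of two neighbouring unit masses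
multiplies the power spectrum by a factor that is bounded below at high
frequencies, and it turns [kern a] into something at most [expR a - 1] times
[kern a].  Parseval compares the two. *)
Lemma sum_pw_kern_high (a del : R) : 0 <= a -> 0 < del <= 2^-1 ->
  2 * (1 - cos (2 * pi * del)) *
    \sum_(k : G | del < (nrm k)%:R / N) pw (kern a) k <=
  N * ((expR a - 1) ^+ 2 * kmass (2 * a)).
Proof.
move=> a0 /andP[d0 d2].
pose e1 : G := inord 1.
have e1E : nat_of_ord e1 = 1%N by rewrite inordK.
pose h (x : G) : R := (x == e1)%:R - (x == 0)%:R.
have sum_delta (V : nmodType) (z : G) (F : G -> V) :
  \sum_(x : G) (if x == z then F x else 0) = F z by rewrite -big_mkcond big_pred1_eq.
have convE s : convol (kern a) h s = kern a (s - e1) - kern a s.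
  rewrite /convol /h; under eq_bigr do rewrite mulrBr.
  rewrite sumrB; congr (_ - _).
    rewrite -[RHS](sum_delta _ (s - e1) (kern a)); apply: eq_bigr => x _.
    rewrite (_ : (s - x == e1) = (x == s - e1)).
      by case: eqP => _; rewrite ?mulr1 ?mulr0.
    by apply/eqP/eqP => [<-|->]; rewrite opprB addrC subrK.
  rewrite -[RHS](sum_delta _ s (kern a)); apply: eq_bigr => x _.
  rewrite subr_eq0 eq_sym.
  by case: eqP => _; rewrite ?mulr1 ?mulr0.
have pwh (k : G) : pw h k = 2 - 2 * cos (freq (M := M) k 1).
  rewrite /pw; have -> : ft h k = chi (M := M) k 1 - 1.
    rewrite /ft /h.
    under eq_bigr do rewrite (rmorphB (real_complex R)) mulrBl.
    rewrite sumrB; congr (_ - _).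
      rewrite -[in RHS]e1E -[RHS](sum_delta _ e1 (fun x : G => chi k x)).
      by apply: eq_bigr => x _; case: eqP => _; rewrite ?mul1r ?mul0r.
    rewrite -[RHS](@chi0 R M k) -[RHS](sum_delta _ 0 (fun x : G => chi k x)).
    by apply: eq_bigr => x _; case: eqP => _; rewrite ?mul1r ?mul0r.
  rewrite /abs2 /= oppr0 addr0.
  have := cos2Dsin2 (freq (M := M) k 1 : R).
  move: (cos _) (sin _) => c s; lra.
have high (k : G) : del < (nrm k)%:R / N -> 2 * (1 - cos (2 * pi * del)) <= pw h k.
  move=> dk; rewrite pwh.
  suff : cos (freq (M := M) k 1) <= cos (2 * pi * del) by lra.
  have := @cos_freq_nrm R M k e1 0.
  rewrite e1E => E.
  have f0 (j : nat) : freq (M := M) j 0 = 0 :> R by rewrite /freq !(mulr0, mul0r).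
  rewrite -[freq k 1]subr0 -(f0 k) -E f0 subr0.
  rewrite /freq mulr1; apply: cos_far; first exact: ltW.
  rewrite ger0_norm ?divr_ge0 // (ltW dk) /= ler_pdivrMr ?ltr0n //.
  have : (2 * nrm k <= M.+1)%N by rewrite /nrm; have := ltn_ord k; lia.
  by rewrite -(ler_nat R) natrM; lra.
apply: (@le_trans _ _ (\sum_(k : G) pw (convol (kern a) h) k)).
  rewrite mulr_sumr [leRHS](bigID (fun k : G => del < (nrm k)%:R / N)) /=.
  rewrite -[leLHS]addr0 lerD //; last by apply: sumr_ge0 => k _; exact: pw_ge0.
  apply: ler_sum => k dk; rewrite pw_convol mulrC ler_wpM2l ?pw_ge0 //; exact: high.
rewrite parseval ler_wpM2l // -sum_kern_sqr mulr_sumr; apply: ler_sum => x _.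
rewrite convE -exprMn -[leLHS]real_normK ?num_real //.
have ea0 : 0 <= expR a - 1 by rewrite subr_ge0 -expR0 ler_expR.
rewrite lerXn2r ?nnegrE ?mulr_ge0 ?kern_ge0 //.
have n1 : (nrm e1 <= 1)%N by rewrite /nrm e1E geq_minl.
have ea : expR (a * (nrm e1)%:R) <= expR a.
  by rewrite ler_expR -[leRHS]mulr1 ler_wpM2l // lern1.
have h1 : kern a (x - e1) <= expR a * kern a x.
  apply: le_trans (kern_le_shift _ x a0) _.
  by rewrite addrAC subrr add0r nrmN ler_wpM2r ?kern_ge0.
have h2 : kern a x <= expR a * kern a (x - e1).
  apply: le_trans (kern_le_shift _ (x - e1) a0) _.
  by rewrite opprB addrCA subrr addr0 ler_wpM2r ?kern_ge0.
have k1 := kern_ge0 a x; have k2 := kern_ge0 a (x - e1).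
move: (kern _ x) (kern _ (x - e1)) (expR a) h1 h2 ea0 k1 k2 => p q w h1 h2 w1 p0 q0.
rewrite ler_norml; apply/andP; split; last lra.
have : 0 <= (w - 1) * (q - p) \/ q - p <= 0.
  by case: (leP p q) => pq; [left; rewrite mulr_ge0 // subr_ge0|right; lra].
case; nra.
Qed.

(** Markov's inequality with the exponential kernel, which avoids counting
points of the cyclic group. *)
Lemma count_low_freq (B : R) : 1 <= B ->
  \sum_(k : G | (nrm k)%:R < B) 1 <= expR 1 * (4 * B).
Proof.
move=> B1; have B0 : 0 < B by lra.
apply: (@le_trans _ _ (expR 1 * kmass B^-1)); last first.
  rewrite ler_pM2l ?expR_gt0 //; apply: le_trans (@kmass_le R M B^-1 _) _.
    by rewrite invr_gt0 B0 invf_le1.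
  by rewrite invrK.
rewrite /kmass mulr_sumr [leRHS](bigID (fun k : G => (nrm k)%:R < B)) /=.
rewrite -[leLHS]addr0 lerD //; last first.
  by apply: sumr_ge0 => k _; rewrite mulr_ge0 ?expR_ge0 ?kern_ge0.
apply: ler_sum => k kB; rewrite /kern -expRD -[leLHS]expR0 ler_expR subr_ge0.
by rewrite mulrC ler_pdivrMr // mul1r ltW.
Qed.

End high_frequencies.

(** * One step of the induction on scales *)

Section one_step.
Context {R : realType} {M : nat}.
Local Notation G := 'I_M.+1.
Local Notation N := (M.+1%:R : R).
Local Notation kern := (@kern R M).
Local Notation kmass := (@kmass R M).
Local Notation nrm := (@nrm M).
Hypothesis M0 : (0 < M)%N.
Variables (A d : R) (u : G -> R).
Hypothesis A1 : 1 <= A.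
Hypothesis u0 : forall x, 0 <= u x.
Hypothesis Hu : nonconc A d u.

(** A lower bound for [1 - cos (2 * pi * e)] when [e] is at distance at
least [(4 * A)^-1] from the integers. *)
Definition gap : R := 1 - cos (2 * pi / (4 * A)).

Lemma gap_gt0 : 0 < gap.
Proof.
rewrite subr_gt0; apply: cos_lt1; have pi0 := @pi_gt0 R.
have A4 : 0 < 4 * A by have := A1; lra.
apply/andP; split; first by rewrite divr_gt0 // mulr_gt0.
rewrite ltr_pdivrMr // ltr_pMr ?mulr_gt0 //.
by have := A1; lra.
Qed.

Lemma gap_le2 : gap <= 2.
Proof. by have := cos_geN1 (2 * pi / (4 * A)); rewrite /gap; lra. Qed.

(** Three ranges of frequencies.  Below [8 * lam] only their number is used;
in between, [pw_single_scale] gives the factor [1 - gap / 4], raised to the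
power [n]; above [(4 * A)^-1] the kernel itself is small. *)
Lemma smoothed_energy_le (lam a : R) (v : G -> R) (n : nat) : (0 < n)%N ->
  tame lam v -> 0 < lam -> 1 <= lam * d -> 1 <= 8 * lam * N -> 0 <= a ->
  N^-1 * \sum_(k : G) (pw (fun x => v x * u x) k * pw (kern a) k) ^+ n <=
  ((\sum_x v x * u x) * kmass a) ^+ (2 * n) *
  (32 * expR 1 * lam + ((1 - gap / 4) ^+ n + (expR a - 1) ^+ 2 / (2 * gap)) / kmass a).
Proof.
move=> n0 tv lam0 ld lN a0; have v0 := tv.1.
set f := fun x => v x * u x; set S := \sum_x v x * u x; set Z := kmass a.
have f0 x : 0 <= f x by rewrite mulr_ge0 // ltW.
have Z0 : 0 < Z := kmass_gt0 a.
have S0 : 0 <= S by apply: sumr_ge0 => x _; exact: f0.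
have N0 : 0 < N by rewrite ltr0n.
have g0 := gap_gt0; have g2 := gap_le2.
set th := 1 - gap / 4; have th0 : 0 <= th by rewrite /th; lra.
pose p (k : nat) := pw (kern a) k / Z ^+ 2.
have pE k : pw (kern a) k = p k * Z ^+ 2 by rewrite /p divfK // expf_neq0 // gt_eqF.
have p0 k : 0 <= p k by rewrite divr_ge0 ?pw_ge0 ?sqr_ge0.
have p1 k : p k <= 1.
  rewrite ler_pdivrMr ?exprn_gt0 // mul1r; apply: pw_le_sqr => x; exact: kern_ge0.
have pn k : p k ^+ n <= p k.
  by rewrite -(prednK n0) exprS ler_piMr // exprn_ile1.
have fS k : pw f k <= S ^+ 2 by exact: pw_le_sqr.
have fSn k : pw f k ^+ n <= S ^+ (2 * n).
  by rewrite exprM lerXn2r ?nnegrE ?pw_ge0 ?sqr_ge0.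
pose lo (k : G) := (nrm k)%:R < 8 * lam * N.
pose hi (k : G) := (4 * A)^-1 < (nrm k)%:R / N.
have A40 : 0 < 4 * A by have := A1; lra.
have term (k : G) : (pw f k * pw (kern a) k) ^+ n <=
   (S * Z) ^+ (2 * n) * ((lo k)%:R + th ^+ n * p k + (hi k)%:R * p k).
  rewrite pE mulrA exprMn -exprM exprMn [in leRHS]exprMn -[leRHS]mulrA [leRHS]mulrCA.
  rewrite [leRHS]mulrC ler_wpM2r ?exprn_ge0 ?(ltW Z0) //.
  have pn0 : 0 <= p k ^+ n by rewrite exprn_ge0.
  have SS0 : 0 <= S ^+ (2 * n) by rewrite exprn_ge0.
  have tp0 : 0 <= th ^+ n * p k by rewrite mulr_ge0 // exprn_ge0.
  have hp0 : 0 <= (hi k)%:R * p k by rewrite mulr_ge0.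
  case E1 : (lo k).
    apply: (@le_trans _ _ (S ^+ (2 * n) * 1)); last first.
      by rewrite ler_wpM2l // -addrA lerDl addr_ge0.
    by rewrite ler_pM ?exprn_ge0 ?pw_ge0 // exprn_ile1.
  case E2 : (hi k).
    apply: (@le_trans _ _ (S ^+ (2 * n) * p k)); last first.
      by rewrite ler_wpM2l // mul1r lerDr addr_ge0.
    by rewrite ler_pM ?exprn_ge0 ?pw_ge0.
  rewrite add0r mul0r addr0 mulrA ler_pM ?exprn_ge0 ?pw_ge0 //.
  rewrite exprM -exprMn lerXn2r ?nnegrE ?pw_ge0 ?mulr_ge0 ?sqr_ge0 //.
  rewrite mulrC; apply: (pw_single_scale Hu u0 tv lam0 A1 ld).
    by rewrite ler_pdivlMr // leNgt -/(lo k) E1.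
  by rewrite -ler_pdivlMr // div1r leNgt -/(hi k) E2.
apply: (@le_trans _ _ (N^-1 * ((S * Z) ^+ (2 * n) *
   \sum_(k : G) ((lo k)%:R + th ^+ n * p k + (hi k)%:R * p k)))).
  rewrite ler_wpM2l ?invr_ge0 ?(ltW N0) // mulr_sumr; apply: ler_sum => k _.
  exact: term.
rewrite mulrCA ler_wpM2l ?exprn_ge0 ?mulr_ge0 ?(ltW Z0) //.
rewrite !big_split /= -mulr_sumr.
have Z2a : kmass (2 * a) <= Z by apply: kmass_mono; lra.
have H1 : \sum_(k : G) (lo k)%:R <= expR 1 * (4 * (8 * lam * N)).
  apply: le_trans (count_low_freq lN); rewrite [leRHS]big_mkcond /=.
  by apply: ler_sum => k _; rewrite -/(lo k); case: (lo k).
have H2 : \sum_(k : G) p k <= N / Z.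
  rewrite -mulr_suml parseval sum_kern_sqr ler_pdivrMr ?exprn_gt0 //.
  by rewrite expr2 mulrA divfK ?gt_eqF // ler_wpM2l // ltW.
have H3 : \sum_(k : G) (hi k)%:R * p k <= N * ((expR a - 1) ^+ 2 / (2 * gap)) / Z.
  have := @sum_pw_kern_high R M M0 a (4 * A)^-1 a0.
  rewrite invr_gt0 A40 -/gap => /(_ _) H.
  have {}H := H ltac:(rewrite lef_pV2 ?posrE //; have := A1; lra).
  have -> : \sum_(k : G) (hi k)%:R * p k =
     (\sum_(k : G | hi k) pw (kern a) k) / Z ^+ 2.
    rewrite mulr_suml [RHS]big_mkcond /=; apply: eq_bigr => k _.
    by case: (hi k); rewrite ?mul1r ?mul0r.
  have ZZ (X : R) : X / Z * Z ^+ 2 = X * Z by rewrite expr2 mulrA divfK ?gt_eqF.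
  rewrite ler_pdivrMr ?exprn_gt0 // ZZ.
  rewrite -(ler_pM2l (_ : 0 < 2 * gap)); last by rewrite mulr_gt0.
  apply: le_trans H _.
  have -> : 2 * gap * (N * ((expR a - 1) ^+ 2 / (2 * gap)) * Z) =
    N * ((expR a - 1) ^+ 2 * Z) by field; rewrite gt_eqF.
  by rewrite ler_wpM2l ?(ltW N0) // ler_wpM2l ?sqr_ge0.
rewrite mulrC ler_pdivrMr //.
have H2' : th ^+ n * \sum_(k : G) p k <= th ^+ n * (N / Z).
  by rewrite ler_wpM2l // exprn_ge0.
apply: le_trans (lerD (lerD H1 H2') H3) _.
rewrite le_eqVlt; apply/orP; left; apply/eqP.
by rewrite /Z; field; rewrite !gt_eqF.
Qed.

(** The assertion which is propagated through the scales.  As it concerns all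
tame weights, it applies to the localised pieces in [energy_step]. *)
Definition energy_controlled (n : nat) (lam E : R) :=
  forall v : G -> R, tame lam v ->
  energy n (fun x => v x * u x) <= E * (\sum_x v x * u x) ^+ (2 * n).

(** A localised piece of [v * u] is [v' * u] with [v'] tame for the constant
[lam + a], so [energy_step] applies.  The three terms come from the three
ranges of frequencies, and the factor in front from the quotients of kernel
masses. *)
Lemma energy_controlled_step (j : nat) (lam a E : R) : (4 <= j)%N ->
  0 < lam -> 1 <= lam * d -> 1 <= 8 * lam * N -> 0 < a <= 1 -> 0 <= E ->
  energy_controlled (2 ^ j) (lam + a) E ->
  energy_controlled (2 ^ j) lam
    (expR 32 * (2 * 2 ^+ j) * (128 * expR 1 * lam / a +
      (1 - gap / 4) ^+ (2 ^ j) + (expR a - 1) ^+ 2 / (2 * gap)) * E).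
Proof.
move=> j4 lam0 ld lN /andP[a0 a1] E0 HE v tv; have v0 := tv.1.
set n := (2 ^ j)%N.
have nR : n%:R = 2 ^+ j :> R by rewrite natrX.
have n16 : (16 <= n)%N by rewrite (leq_pexp2l (isT : 0 < 2)%N j4).
have n0 : (0 < n)%N by lia.
set S := \sum_x v x * u x; set Z := kmass a; set Za := kmass (a * (1 + n%:R^-1)).
have f0 x : 0 <= v x * u x by rewrite mulr_ge0 // ltW.
have S0 : 0 <= S by apply: sumr_ge0.
have Z0 : 0 < Z := kmass_gt0 _.
have Za0 : 0 < Za := kmass_gt0 _.
have := @energy_step R M n a (fun x => v x * u x) E n0 (ltW a0) E0 f0.
move=> /(_ _) H.
have {}H := H ltac:(move=> t; have := HE _ (tameM tv (tame_kern_shift t (ltW a0)));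
  under eq_fun do rewrite mulrAC; under eq_bigr do rewrite mulrAC; exact).
have := smoothed_energy_le n0 tv lam0 ld lN (ltW a0).
rewrite -/S -/Z -/Za in H *; set X := (_ ^-1 * _) in H *; set br := (32 * _ * _ + _).
move=> HX.
have br0 : 0 <= br.
  have g0 := gap_gt0; have g2 := gap_le2.
  rewrite addr_ge0 ?mulr_ge0 ?expR_ge0 ?(ltW lam0) ?invr_ge0 ?(ltW Z0) //.
  rewrite addr_ge0 ?exprn_ge0 //; first by lra.
  by rewrite mulr_ge0 ?sqr_ge0 // invr_ge0; lra.
have Zan : 0 < Za ^+ (2 * n) by rewrite exprn_gt0.
have H1 : Za ^+ (2 * n) * energy n (fun x => v x * u x) <=
   kmass (a / n%:R) * (E * ((S * Z) ^+ (2 * n) * br)).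
  apply: le_trans H _; rewrite ler_wpM2l ?(ltW (kmass_gt0 _)) //.
  by rewrite ler_wpM2l.
have H2 : kmass (a / n%:R) <= 2 * 2 ^+ j * Z by rewrite nR; apply: kmass_dyadic; exact: ltW.
have H3 := @kmass_perturb R M a n (ltW a0) n16; rewrite -/Z -/Za in H3.
have S2 : 0 <= S ^+ (2 * n) by rewrite exprn_ge0.
rewrite -(ler_pM2l Zan); apply: le_trans H1 _.
apply: (@le_trans _ _ (2 * 2 ^+ j * Z * (E * (S ^+ (2 * n) * (expR 32 * Za ^+ (2 * n)) * br)))).
  apply: ler_pM => //; first exact: ltW (kmass_gt0 _).
    by rewrite !mulr_ge0 ?exprn_ge0 ?mulr_ge0 ?(ltW Z0).
  by rewrite ler_wpM2l // ler_wpM2r // exprMn ler_wpM2l.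
have HZ : Z * br <= 128 * expR 1 * lam / a +
      (1 - gap / 4) ^+ n + (expR a - 1) ^+ 2 / (2 * gap).
  rewrite /br mulrDr [Z * (_ / Z)]mulrC divfK ?gt_eqF // -addrA lerD //.
  have : Z * (32 * expR 1 * lam) <= 4 / a * (32 * expR 1 * lam).
    by rewrite ler_wpM2r ?kmass_le ?a0 // !mulr_ge0 ?expR_ge0 ?(ltW lam0).
  move=> /le_trans; apply.
  rewrite le_eqVlt; apply/orP; left; apply/eqP; ring.
set br' := (_ + _ + _) in HZ *.
have -> : 2 * 2 ^+ j * Z * (E * (S ^+ (2 * n) * (expR 32 * Za ^+ (2 * n)) * br)) =
  Za ^+ (2 * n) * (expR 32 * (2 * 2 ^+ j) * (E * S ^+ (2 * n))) * (Z * br) by ring.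
have -> : Za ^+ (2 * n) * (expR 32 * (2 * 2 ^+ j) * br' * E * S ^+ (2 * n)) =
  Za ^+ (2 * n) * (expR 32 * (2 * 2 ^+ j) * (E * S ^+ (2 * n))) * br' by ring.
by rewrite ler_wpM2l // !mulr_ge0 ?expR_ge0 ?exprn_ge0 ?(ltW Za0).
Qed.

End one_step.

Lemma powR_expR {R : realType} (x : R) (y : R) : 0 < x -> x `^ y = expR (y * ln x).
Proof. by move=> x0; rewrite /powR gt_eqF. Qed.

Lemma ler_powR_npos {R : realType} (x y r : R) : 0 < x -> x <= y -> r <= 0 ->
  y `^ r <= x `^ r.
Proof.
move=> x0 xy r0; have y0 : 0 < y by exact: lt_le_trans xy.
rewrite -[r]opprK powRN [leRHS]powRN lef_pV2 ?posrE ?powR_gt0 //.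
by apply: ge0_ler_powR; rewrite ?nnegrE ?oppr_ge0 // ltW.
Qed.

(** * Iteration over the scales *)

Section iteration.
Context {R : realType} {M : nat}.
Local Notation G := 'I_M.+1.
Local Notation N := (M.+1%:R : R).
Hypothesis M0 : (0 < M)%N.
Variables (A d : R) (u : G -> R).
Hypothesis A1 : 1 <= A.
Hypothesis u0 : forall x, 0 <= u x.
Hypothesis Hu : nonconc A d u.

(** One step replaces [lam + a] by [lam]; with [a = b * lam] this is a
multiplication by [1 + b], and the quotient [lam / a] in the step becomes the
constant [b^-1].  The hypothesis on [I] says that [a] stays small along the
way, and the induction starts from the trivial bound by the mass. *)
Lemma energy_controlled_iter (j : nat) (b a0 rho : R) : (4 <= j)%N ->
  0 < b -> a0 <= 1 ->
  (forall a, 0 < a <= a0 -> expR 32 * (2 * 2 ^+ j) * (128 * expR 1 / b +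
      (1 - gap A / 4) ^+ (2 ^ j) + (expR a - 1) ^+ 2 / (2 * gap A)) <= rho) ->
  forall (I : nat) (lam : R), 0 < lam -> 1 <= lam * d -> 1 <= 8 * lam * N ->
  b * (1 + b) ^+ I * lam <= a0 -> energy_controlled u (2 ^ j) lam (rho ^+ I).
Proof.
move=> j4 b0 a01 Hrho; elim=> [|I IH] lam lam0 ld lN ba.
  move=> v [v0 _]; rewrite expr0 mul1r; apply: energy_le_mass => x.
  by rewrite mulr_ge0 // ltW.
have b1 : 1 <= 1 + b by lra.
have bl : 0 < b * lam <= a0.
  rewrite mulr_gt0 //=; apply: le_trans ba.
  by rewrite ler_wpM2r ?(ltW lam0) // ler_peMr ?(ltW b0) // exprn_ege1.
have rho0 : 0 <= rho.
  apply: le_trans (Hrho _ bl); have g0 := gap_gt0 A1; have g2 := @gap_le2 R A.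
  apply: mulr_ge0; first by rewrite mulr_ge0 ?expR_ge0 // mulr_ge0 // exprn_ge0.
  have e1 : 0 <= 128 * expR 1 / b by rewrite divr_ge0 ?mulr_ge0 ?expR_ge0 // ltW.
  have e2 : 0 <= (1 - gap A / 4) ^+ (2 ^ j) by rewrite exprn_ge0 //; lra.
  have e3 : 0 <= (expR (b * lam) - 1) ^+ 2 / (2 * gap A).
    by rewrite divr_ge0 ?sqr_ge0 //; lra.
  by rewrite !addr_ge0.
have H : energy_controlled u (2 ^ j) (lam + b * lam) (rho ^+ I).
  have -> : lam + b * lam = (1 + b) * lam by ring.
  apply: IH; first by rewrite mulr_gt0 //; lra.
  - by rewrite -mulrA; apply: (le_trans ld); rewrite ler_peMl // (le_trans ler01 ld).
  - apply: le_trans lN _; rewrite ler_wpM2r ?ler0n // ler_wpM2l // ler_peMl //.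
    exact: ltW.
  - by move: ba; rewrite exprSr !mulrA.
move=> v tv.
have := energy_controlled_step M0 A1 u0 Hu j4 lam0 ld lN (a := b * lam) _
  (exprn_ge0 I rho0) H tv.
have /andP[bl0 bla] := bl.
rewrite bl0 (le_trans bla a01) => /(_ isT) /le_trans; apply.
rewrite ler_wpM2r ?exprn_ge0 //.
  by apply: sumr_ge0 => x _; rewrite mulr_ge0 // ltW // tv.1.
rewrite [rho ^+ I.+1]exprS ler_wpM2r ?exprn_ge0 //.
apply: le_trans (Hrho _ bl).
have -> // : 128 * expR 1 * lam / (b * lam) = 128 * expR 1 / b.
by field; rewrite !gt_eqF.
Qed.

End iteration.

Lemma largest_power_below {R : realType} (be x : R) : 1 < be -> 1 <= x ->
  exists I : nat, be ^+ I <= x < be ^+ I.+1.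
Proof.
move=> be1 x1; have be0 : 0 < be by lra.
have x0 : 0 < x by lra.
have lb : 0 < ln be by exact: ln_gt0.
pose y := ln x / ln be.
have y0 : 0 <= y by rewrite divr_ge0 ?ln_ge0 // ltW.
exists (Num.truncn y); have /andP[h1 h2] := truncn_itv y0.
have E (n : nat) : be ^+ n = expR (n%:R * ln be).
  by rewrite expRM_natl lnK.
have xE : x = expR (y * ln be) by rewrite divfK ?gt_eqF // lnK.
rewrite !E; apply/andP; split.
  by rewrite [leRHS]xE ler_expR ler_pM2r.
by rewrite [ltLHS]xE ltr_expR ltr_pM2r.
Qed.

Lemma expR_sub1_le {R : realType} (a : R) : 0 <= a <= 2^-1 ->
  expR a - 1 <= 2 * a.
Proof.
move=> /andP[a0 a2]; have h := expR_ge1Dx (- a).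
have ee := expRxMexpNx_1 a; have e0 : 0 < expR a := expR_gt0 _.
have h1 : expR a * (1 + - a) <= expR a * expR (- a) by rewrite ler_wpM2l // ltW.
have a1 : 0 < 1 - a by lra.
have h3 : 0 <= a * (1 - 2 * a) by apply: mulr_ge0 => //; lra.
by rewrite -subr_ge0 -(pmulr_rge0 _ a1); lra.
Qed.

(** The factor is of order [n / b] with [n = 2 ^ j] and with [b] exponential
in [n], hence at most [(1 + b) ^ (kap - 1)] for large [n]. *)
Lemma step_factor_le {R : realType} (A kap : R) : 1 <= A -> 0 < kap < 1 ->
  exists (j : nat) (b a0 : R), [/\ (4 <= j)%N, 1 <= b, 0 < a0 <= 2^-1 &
    forall a, 0 < a <= a0 ->
      expR 32 * (2 * 2 ^+ j) * (128 * expR 1 / b +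
        (1 - gap A / 4) ^+ (2 ^ j) + (expR a - 1) ^+ 2 / (2 * gap A)) <=
      (1 + b) `^ (kap - 1)].
Proof.
move=> A1 /andP[k0 k1].
have g0 := gap_gt0 A1; have g2 := @gap_le2 R A.
have [th thE] : exists th : R, th = 1 - gap A / 4 by eexists.
have th0 : 0 < th by rewrite thE; lra.
have th1 : th < 1 by rewrite thE; lra.
have [L LE] : exists L : R, L = - ln th by eexists.
have L0 : 0 < L by rewrite LE oppr_gt0 ln_lt0 // th0.
have [K1 K1E] : exists K1 : R, K1 = expR 32 * 2 * (128 * expR 1 + 2) by eexists.
have K10 : 0 < K1 by rewrite K1E !mulr_gt0 ?addr_gt0 ?mulr_gt0 ?expR_gt0.
(* From [expR x >= x ^ 2 / 2], this makes [b ^ kap] dominate [2 * K1 * n]. *)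
pose B : R := 4 * K1 / (kap * L) ^+ 2.
have kL : 0 < kap * L by rewrite mulr_gt0.
(* [n] is a power of two because kernel masses are compared by halving. *)
have [j [j4 jB]] : exists j : nat, (4 <= j)%N /\ B <= (2 ^ j)%N%:R.
  exists (Num.truncn B + 4)%N; split; first exact: leq_addl.
  have : B < (Num.truncn B).+1%:R by apply: truncnS_gt.
  move=> /ltW /le_trans; apply; rewrite ler_nat.
  by apply: leq_ltn_trans (ltn_expl _ (isT : 1 < 2)%N); exact: leq_addr.
have [n nE] : exists n : nat, n = (2 ^ j)%N by eexists.
have nB : B <= n%:R by rewrite nE.
have nR0 : 0 < n%:R :> R by rewrite ltr0n nE expn_gt0.
have [b bE] : exists b : R, b = (th ^+ n)^-1 by eexists.
have thn0 : 0 < th ^+ n by rewrite exprn_gt0.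
have b1 : 1 <= b by rewrite bE invf_ge1 // exprn_ile1 // ltW.
have b0 : 0 < b by lra.
have bk : 2 * K1 * n%:R <= b `^ kap.
  have -> : b `^ kap = expR (n%:R * (kap * L)).
    by rewrite powR_expR // bE lnV ?posrE // lnXn // LE -mulr_natl; congr expR; ring.
  have h : 0 <= n%:R * (kap * L) by rewrite mulr_ge0 ?ltW.
  apply: le_trans (expR_ge1Dxn 1 h); rewrite -[leLHS]add0r lerD //.
  rewrite (_ : (1.+1)`! = 2)%N // ler_pdivlMr // exprMn.
  have : B * (kap * L) ^+ 2 <= n%:R * (kap * L) ^+ 2.
    by rewrite ler_wpM2r // exprn_ge0 // ltW.
  rewrite /B divfK ?expf_neq0 ?gt_eqF // => h2.
  have -> : 2 * K1 * n%:R * 2 = n%:R * (4 * K1) by ring.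
  rewrite [n%:R ^+ 2]expr2 -mulrA.
  by rewrite ler_wpM2l.
(* For [a <= a0] the high frequencies contribute at most [b^-1] to the step. *)
have [a0 a0E] : exists a0 : R, a0 = gap A / (4 * b) by eexists.
have a00 : 0 < a0 by rewrite a0E divr_gt0 // mulr_gt0.
have a02 : a0 <= 2^-1.
  by rewrite a0E ler_pdivrMr ?mulr_gt0 //; lra.
exists j, b, a0; split=> // [|a]; first exact/andP.
move=> /andP[ap aa].
have ea : expR a - 1 <= 2 * a by apply: expR_sub1_le; rewrite (ltW ap) (le_trans aa a02).
have ea0 : 0 <= expR a - 1 by rewrite subr_ge0 -expR0 ler_expR ltW.
have H3 : (expR a - 1) ^+ 2 / (2 * gap A) <= b^-1.
  rewrite ler_pdivrMr ?mulr_gt0 //.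
  apply: (@le_trans _ _ ((2 * a) ^+ 2)).
    by rewrite lerXn2r ?nnegrE // mulr_ge0 // ltW.
  have : a * b * 4 <= gap A.
    have := aa; rewrite a0E ler_pdivlMr ?mulr_gt0 // => h.
    by clear -h; lra.
  move=> hab; rewrite ler_pdivlMl //.
  have h1 : a * (a * b * 4) <= a * gap A by rewrite ler_wpM2l // ltW.
  have h2 : a * gap A <= 1 * gap A.
    by rewrite ler_wpM2r ?(ltW g0) //; clear -aa a02; lra.
  by clear -h1 h2 g0; lra.
have H2 : (1 - gap A / 4) ^+ (2 ^ j) = b^-1 by rewrite -nE bE invrK thE.
apply: (@le_trans _ _ (K1 * n%:R / b)).
  rewrite H2 K1E -natrX -nE.
  have -> : expR 32 * 2 * (128 * expR 1 + 2) * n%:R / b =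
    expR 32 * (2 * n%:R) * (128 * expR 1 / b + b^-1 + b^-1).
    by ring.
  by rewrite ler_wpM2l ?lerD2l // !mulr_ge0 ?expR_ge0.
apply: (@le_trans _ _ ((2 * b) `^ (kap - 1))); last first.
  by apply: ler_powR_npos; clear -b1 k1; lra.
have b2 : 0 < 2 * b by rewrite mulr_gt0.
rewrite ler_pdivrMr //.
have E : (2 * b) `^ (kap - 1) * (2 * b) = (2 * b) `^ kap.
  by rewrite -[X in _ * X]powRr1 ?(ltW b2) // -powRD ?gt_eqF ?implybT // subrK.
have h : 2 * (K1 * n%:R) <= (2 * b) `^ (kap - 1) * (2 * b).
  rewrite E powRM ?(ltW b0) // mulrA; apply: le_trans bk _.
  rewrite ler_peMl ?powR_ge0 //.
  by rewrite -[leLHS](powRr0 2) ler_powR ?ler1n // ltW.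
by clear -h; lra.
Qed.

(** The number [I] of steps
is chosen so that [(1 + b) ^ I] is comparable to [d], starting from
[lam = d^-1] and the weight 1. *)
Lemma energy_bound {R : realType} (A kap : R) : 1 <= A -> 0 < kap < 1 ->
  exists2 n : nat, (0 < n)%N & exists2 C : R, 0 < C &
    forall (M : nat) (d : R) (u : 'I_M.+1 -> R), (0 < M)%N ->
      0 < d <= 8 * M.+1%:R -> nonconc A d u -> (forall x, 0 <= u x) ->
      \sum_x u x = 1 -> energy n u <= C * d `^ (kap - 1).
Proof.
move=> A1 kap01; have [j [b [a0 [j4 b1 /andP[a00 a02] Hrho]]]] := step_factor_le A1 kap01.
have [k0 k1] := andP kap01; have b0 : 0 < b by lra.
have kneg : kap - 1 <= 0 by lra.
have be1 : 1 < 1 + b by lra.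
have be0 : 0 <= 1 + b by lra.
have a01 : a0 <= 1 by lra.
pose rho : R := (1 + b) `^ (kap - 1).
have bb0 : 0 < b * (1 + b) by rewrite mulr_gt0 // (lt_trans ltr01).
pose D : R := a0 / (b * (1 + b)).
have D0 : 0 < D by rewrite divr_gt0.
exists (2 ^ j)%N; first by rewrite expn_gt0.
exists (D `^ (kap - 1)); first exact: powR_gt0.
move=> M d u M0 /andP[d0 dN] Hu u0 u1.
rewrite -powRM ?(ltW D0) ?(ltW d0) //.
have Dd0 : 0 < D * d by rewrite mulr_gt0.
(* For bounded [d] the trivial bound by the mass suffices. *)
have [small|big] := leP (a0 * d / b) 1.
  apply: le_trans (energy_le_mass _ u0) _; rewrite u1 expr1n.
  apply: (@le_trans _ _ (1 `^ (kap - 1))); first by rewrite powR1.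
  apply: ler_powR_npos => //.
  rewrite /D; apply: le_trans small.
  rewrite mulrAC ler_wpM2l //; first by rewrite mulr_ge0 // ltW.
  by rewrite lef_pV2 ?posrE // ler_peMr ?(ltW b0) // (ltW be1).
have [I /andP[I1 I2]] := largest_power_below be1 (ltW big).
have := energy_controlled_iter M0 A1 u0 Hu j4 b0 _ Hrho (I := I) (lam := d^-1).
rewrite invr_gt0 d0 mulVf ?gt_eqF // => /(_ _ isT (lexx _) _ _) H.
have := H _ _ _ (fun=> 1) (tame_one _); rewrite /energy_controlled.
have -> : (fun x => 1 * u x) = u by apply/funext => x; rewrite mul1r.
under eq_bigr do rewrite mul1r.
rewrite u1 expr1n mulr1 => {}H.
apply: le_trans (H _ _ _ _) _.
- exact: a01.
- by rewrite mulrAC ler_pdivlMr // mul1r.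
- rewrite ler_pdivrMr //.
  by move: I1; rewrite ler_pdivlMr // mulrC.
- by rewrite invr_ge0 ltW.
have -> : rho ^+ I = ((1 + b) ^+ I) `^ (kap - 1).
  by rewrite /rho -powR_mulrn ?powR_ge0 // -powRrM mulrC powRrM powR_mulrn.
apply: ler_powR_npos => //.
have : a0 * d / b <= (1 + b) ^+ I * (1 + b) by rewrite -exprSr ltW.
rewrite /D -ler_pdivrMr; last by rewrite (lt_trans ltr01).
move=> h; apply: le_trans h; rewrite le_eqVlt; apply/orP; left; apply/eqP.
by rewrite invfM; ring.
Qed.

(** * Moments of a convolution *)

Section Lq_gain.
Context {R : realType} {M : nat}.
Local Notation G := 'I_M.+1.
Local Notation N := (M.+1%:R : R).
Variables (q : R) (p u : G -> R).
Hypothesis q1 : 1 < q.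
Hypothesis p0 : forall x, 0 <= p x.
Hypothesis u0 : forall x, 0 <= u x.
Hypothesis p1 : \sum_x p x = 1.
Hypothesis u1 : \sum_x u x = 1.

Let S := \sum_x p x `^ q.
Let h x := p x `^ (q / 2).
Let F := convol u p.
Let S' := \sum_x F x `^ q.

Lemma moment_ge_powN : N `^ (1 - q) <= S.
Proof.
have N0 : 0 < N by rewrite ltr0n.
have := @sum_powR_jensen R G xpredT (fun=> N^-1) p q (ltW q1).
rewrite -!mulr_sumr p1 mulr1 -/S => /(_ _ p0 _) H.
have {}H := H ltac:(by move=> _; rewrite invr_ge0 ltW)
  ltac:(by rewrite sumr_const card_ord -[N^-1 *+ _]mulr_natr mulVf ?gt_eqF).
rewrite -(ler_pM2l (_ : 0 < N^-1)) ?invr_gt0 //; apply: le_trans H.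
rewrite powRV ?(ltW N0) // -powRN.
rewrite powRD ?pnatr_eq0 ?implybT // powRr1 ?(ltW N0) // mulKf ?pnatr_eq0 //.
Qed.

Lemma moment_gt0 : 0 < S.
Proof. by apply: lt_le_trans moment_ge_powN; rewrite powR_gt0 // ltr0n. Qed.

Lemma convol_moment_le : S' <= S.
Proof.
apply: (@le_trans _ _ (\sum_x convol u (fun x => p x `^ q) x)); last first.
  by rewrite sum_convol u1 mul1r.
apply: ler_sum => x _; apply: sum_powR_jensen => //; exact: ltW.
Qed.

Lemma sum_sqr_half : \sum_x h x ^+ 2 = S.
Proof.
apply: eq_bigr => x _; rewrite -powR_mulrn ?powR_ge0 // -powRrM.
by congr powR; field.
Qed.

(** For [q >= 2], convexity of the power [q / 2] bounds the convolution with
[p] by the one with [h = p ^ (q / 2)]. *)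
Lemma convol_moment_ge2 : 2 <= q -> S' <= \sum_x convol u h x ^+ 2.
Proof.
move=> q2; apply: ler_sum => x _.
have -> : F x `^ q = (F x `^ (q / 2)) ^+ 2.
  by rewrite -powR_mulrn ?powR_ge0 // -powRrM; congr powR; field.
rewrite lerXn2r ?nnegrE ?powR_ge0 //.
  by apply: convol_ge0 => // y; exact: powR_ge0.
by apply: sum_powR_jensen => //; lra.
Qed.

(** For [q < 2] the convolution with [p] is interpolated by Hoelder between
those with [h = p ^ (q / 2)] and with [p ^ q], and the mass of the last one
is [S]. *)
Lemma convol_moment_le2 : q < 2 ->
  S' <= (\sum_x convol u h x ^+ 2) `^ (q - 1) * S `^ (2 - q).
Proof.
move=> q2; have q1' := q1; pose H := convol u h; pose K := convol u (fun x => p x `^ q).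
have H0 x : 0 <= H x by apply: convol_ge0 => // y; exact: powR_ge0.
have K0 x : 0 <= K x by apply: convol_ge0 => // y; exact: powR_ge0.
have q0 : q != 0 by rewrite gt_eqF //; lra.
pose s := 2 * (q - 1) / q.
have s01 : 0 < s < 1.
  by rewrite /s divr_gt0 ?mulr_gt0 ?subr_gt0 //=; [rewrite ltr_pdivrMr; lra | lra].
have F0 x : 0 <= F x by exact: convol_ge0.
have FH x : F x <= H x `^ s * K x `^ (1 - s).
  have := @sum_powR_holder R G xpredT (fun y => u y * h (x - y))
    (fun y => u y * p (x - y) `^ q) s s01.
  move=> /(_ (fun y => mulr_ge0 (u0 y) (powR_ge0 _ _))).
  move=> /(_ (fun y => mulr_ge0 (u0 y) (powR_ge0 _ _))); apply: le_trans.
  rewrite /F /convol le_eqVlt; apply/orP; left; apply/eqP.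
  apply: eq_bigr => y _; rewrite !powRM ?powR_ge0 // mulrACA -!powRrM.
  have [->|uy] := eqVneq (u y) 0.
    by rewrite powR0 ?mul0r //; case/andP: s01 => ? _; rewrite gt_eqF.
  rewrite -powRD ?uy ?implybT // subrKC powRr1 //; congr (_ * _).
  have [->|py] := eqVneq (p (x - y)) 0.
    by rewrite powR0 ?mul0r // mulf_neq0 ?gt_eqF //; case/andP: s01; lra.
  rewrite -powRD ?py ?implybT //.
  have -> : q / 2 * s + q * (1 - s) = 1 by rewrite /s; field.
  by rewrite powRr1.
have pow_s (g k : R) : 0 <= g ->
    (g `^ s * k `^ (1 - s)) `^ q = (g ^+ 2) `^ (q - 1) * k `^ (1 - (q - 1)).
  move=> g0; rewrite (powRM _ (powR_ge0 _ _) (powR_ge0 _ _)) -!powRrM.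
  rewrite -(powR_mulrn _ g0) -powRrM.
  by congr (_ `^ _ * _ `^ _); rewrite /s; field.
have q01 : 0 < q - 1 < 1 by lra.
apply: (@le_trans _ _ (\sum_x (H x ^+ 2) `^ (q - 1) * K x `^ (1 - (q - 1)))).
  apply: ler_sum => x _.
  have := ge0_ler_powR (ltW (lt_trans ltr01 q1)) _ _ (FH x).
  rewrite !nnegrE mulr_ge0 ?powR_ge0 // F0 => /(_ isT isT) /le_trans; apply.
  by rewrite le_eqVlt; apply/predU1l; exact: pow_s (H0 x).
apply: le_trans (sum_powR_holder _ q01 _ _) _ => //.
  by move=> x; exact: sqr_ge0.
have -> : 1 - (q - 1) = 2 - q by ring.
by rewrite sum_convol u1 mul1r.
Qed.

(** By Parseval the left-hand side is an average of [pw u] with weights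
proportional to [pw f].  Convexity moves the power inside, after which the
weights are bounded by the squared mass of [f]. *)
Lemma convol_energy_le (n : nat) (f : G -> R) : (0 < n)%N ->
  (forall x, 0 <= f x) -> 0 < \sum_x f x ^+ 2 ->
  (\sum_x convol u f x ^+ 2 / \sum_x f x ^+ 2) ^+ n <=
  (\sum_x f x) ^+ 2 * energy n u / \sum_x f x ^+ 2.
Proof.
move=> n0 f0 f20; set f2 := \sum_x f x ^+ 2 in f20 *.
have N0 : 0 < N by rewrite ltr0n.
pose w (k : G) := pw f k / (N * f2).
have w0 k : 0 <= w k by rewrite divr_ge0 ?pw_ge0 // mulr_ge0 // ltW.
have w1 : \sum_k w k = 1.
  by rewrite -mulr_suml parseval mulfV // mulf_neq0 ?gt_eqF.
have -> : \sum_x convol u f x ^+ 2 / f2 = \sum_(k : G) w k * pw u k.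
  have E : \sum_x convol u f x ^+ 2 = N^-1 * \sum_(k : G) pw (convol u f) k.
    by rewrite parseval mulKf ?pnatr_eq0.
  rewrite -mulr_suml E mulr_sumr mulr_suml; apply: eq_bigr => k _.
  by rewrite pw_convol /w invfM; ring.
apply: le_trans (sum_expr_jensen n0 w0 (fun k => pw_ge0 u k) w1) _.
have -> : (\sum_x f x) ^+ 2 * energy n u / f2 =
   \sum_(k : G) ((\sum_x f x) ^+ 2 / (N * f2)) * pw u k ^+ n.
  by rewrite -mulr_sumr /energy invfM; ring.
apply: ler_sum => k _; rewrite ler_wpM2r ?exprn_ge0 ?pw_ge0 //.
rewrite /w ler_wpM2r ?invr_ge0 ?mulr_ge0 ?(ltW N0) ?(ltW f20) //.
exact: pw_le_sqr.
Qed.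

Lemma sum_half_ge2 : 2 <= q -> (\sum_x h x) ^+ 2 <= S `^ (1 - (q - 1)^-1).
Proof.
move=> q2; have q1' := q1; have S0 := moment_gt0.
have h0 : 0 <= \sum_x h x by apply: sumr_ge0 => x _; exact: powR_ge0.
have qq : q - 1 != 0 by rewrite gt_eqF //; lra.
have -> : S `^ (1 - (q - 1)^-1) = (S `^ ((q - 2) / (2 * (q - 1)))) ^+ 2.
  rewrite -powR_mulrn ?powR_ge0 // -powRrM; congr powR; field.
  by [].
rewrite lerXn2r ?nnegrE ?powR_ge0 //.
move: q2; rewrite le_eqVlt => /predU1P[q2|q2].
  rewrite -q2 subrr mul0r powRr0 -p1 le_eqVlt; apply/orP; left; apply/eqP.
  by apply: eq_bigr => x _; rewrite /h -q2 divff // powRr1.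
set al := (q - 2) / (2 * (q - 1)).
have al01 : 0 < al < 1.
  rewrite /al divr_gt0 ?mulr_gt0 ?subr_gt0 //=.
  by rewrite ltr_pdivrMr ?mulr_gt0 ?subr_gt0 //; lra.
have := @sum_powR_holder R G xpredT (fun x => p x `^ q) p al al01.
move=> /(_ (fun x => powR_ge0 _ _) p0); rewrite p1 powR1 mulr1; apply: le_trans.
apply: ler_sum => x _; rewrite /h -powRrM.
have [->|px] := eqVneq (p x) 0.
  by rewrite powR0 ?mulr_ge0 ?powR_ge0 // mulf_neq0 // gt_eqF //; lra.
rewrite -powRD ?px ?implybT // le_eqVlt; apply/orP; left; apply/eqP; congr powR.
by rewrite /al; field.
Qed.

Lemma sum_half_le2 : q < 2 -> (\sum_x h x) ^+ 2 <= N `^ (2 - q).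
Proof.
move=> q2; have q1' := q1; have N0 : 0 < N by rewrite ltr0n.
have h0 : 0 <= \sum_x h x by apply: sumr_ge0 => x _; exact: powR_ge0.
have -> : N `^ (2 - q) = (N `^ (1 - q / 2)) ^+ 2.
  by rewrite -powR_mulrn ?powR_ge0 // -powRrM; congr powR; field.
rewrite lerXn2r ?nnegrE ?powR_ge0 //.
have q01 : 0 < q / 2 < 1 by lra.
have := @sum_powR_holder R G xpredT p (fun=> 1) (q / 2) q01 p0 (fun=> ler01).
rewrite p1 !powR1 mul1r sumr_const card_ord; apply: le_trans.
by apply: ler_sum => x _; rewrite mulr1.
Qed.

(** With [h = p ^ (q / 2)], the quotient bounded in [convol_energy_le] is
small if the squared mass of [h] is not too large compared with [S]; this is
where the lower bound on [S], saying that [p] is not spread almost uniformly,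
is used. *)
Lemma convol_moment_gain (n : nat) (a E : R) : (0 < n)%N ->
  energy n u <= E -> N `^ (- ((q - 1) * a)) <= S ->
  S' <= S * (E * N `^ (1 - Num.min 1 (q - 1) * (1 - a))) `^ (Num.min 1 (q - 1) / n%:R).
Proof.
move=> n0 uE Sa; have q1' := q1; have S0 := moment_gt0; have N0 : 0 < N by rewrite ltr0n.
have nR : 0 < n%:R :> R by rewrite ltr0n.
have E0 : 0 <= E by exact: le_trans (energy_ge0 _ _) uE.
pose T := \sum_x convol u h x ^+ 2.
have T0 : 0 <= T by apply: sumr_ge0 => x _; exact: sqr_ge0.
have h20 : 0 < \sum_x h x ^+ 2 by rewrite sum_sqr_half.
have := convol_energy_le n0 (fun x => powR_ge0 _ _) h20.
rewrite -mulr_suml sum_sqr_half -/T => HT.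
have qq : 0 < q - 1 by rewrite subr_gt0.
pose la := Num.min 1 (q - 1); rewrite -/la.
have la0 : 0 < la by rewrite lt_min ltr01.
have Sle r : 0 <= r -> S `^ (- r) <= N `^ ((q - 1) * a * r).
  move=> r0; have := ler_powR_npos (powR_gt0 _ N0) Sa (_ : - r <= 0).
  rewrite oppr_le0 => /(_ r0); rewrite -powRrM mulrNN; exact.
have key : (T / S) ^+ n <= E * N `^ (1 - la * (1 - a)) ->
    S * (T / S) `^ la <= S * (E * N `^ (1 - la * (1 - a))) `^ (la / n%:R).
  move=> H; rewrite ler_pM2l //.
  have -> : (T / S) `^ la = ((T / S) ^+ n) `^ (la / n%:R).
    rewrite -powR_mulrn ?divr_ge0 ?(ltW S0) // -powRrM [n%:R * _]mulrC divfK //.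
    by rewrite gt_eqF.
  apply: ge0_ler_powR; rewrite ?nnegrE ?divr_ge0 ?exprn_ge0 ?mulr_ge0 ?powR_ge0 //.
    exact: ltW.
  by rewrite invr_ge0 ltW.
have mono (X Y : R) : (\sum_x h x) ^+ 2 <= X -> X * S^-1 <= Y ->
    (T / S) ^+ n <= E * Y.
  move=> hX XY; apply: le_trans HT _; rewrite mulrAC.
  have s0 : 0 <= S^-1 by rewrite invr_ge0 ltW.
  have : (\sum_x h x) ^+ 2 / S <= Y by apply: le_trans XY; rewrite ler_wpM2r.
  move=> hY; rewrite mulrC ler_pM ?energy_ge0 // divr_ge0 ?sqr_ge0 //; exact: ltW.
have [q2|q2] := leP 2 q.
  have la1 : la = 1 by apply: min_idPl; lra.
  apply: le_trans (key _).
    rewrite la1 powRr1 ?divr_ge0 ?(ltW S0) // mulrC divfK ?gt_eqF //.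
    exact: convol_moment_ge2.
  apply: (mono _ _ (sum_half_ge2 q2)).
  rewrite -[S^-1]powR_inv1 ?(ltW S0) // -powRD ?(gt_eqF S0) ?implybT //.
  have -> : 1 - (q - 1)^-1 + -1 = - (q - 1)^-1 by ring.
  apply: le_trans (Sle _ _) _; first by rewrite invr_ge0 ltW.
  rewrite la1 mulrAC mulfV ?gt_eqF //.
  by rewrite le_eqVlt; apply/orP; left; apply/eqP; congr powR; ring.
have laE : la = q - 1 by apply: min_idPr; lra.
apply: le_trans (key _).
  apply: le_trans (convol_moment_le2 q2) _; rewrite -/T laE.
  rewrite powRM ?invr_ge0 ?(ltW S0) // mulrCA ler_wpM2l ?powR_ge0 //.
  rewrite powRV ?(ltW S0) // -powRN -{2}(powRr1 (ltW S0)) -powRD ?(gt_eqF S0) ?implybT //.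
  by rewrite le_eqVlt; apply/orP; left; apply/eqP; congr powR; ring.
apply: (mono _ _ (sum_half_le2 q2)).
rewrite -[S^-1]powR_inv1 ?(ltW S0) //.
apply: (@le_trans _ _ (N `^ (2 - q) * N `^ ((q - 1) * a * 1))).
  by rewrite ler_wpM2l ?powR_ge0 // Sle.
rewrite -powRD ?pnatr_eq0 ?implybT // laE.
by rewrite le_eqVlt; apply/orP; left; apply/eqP; congr powR; ring.
Qed.

End Lq_gain.

(** * Discretisation of measures *)

Section discretisation.
Context {R : realType}.
Implicit Types (mu nu : borel_prob R) (m M : nat).

Definition cls {M} (k : int) : 'I_M.+1 := inZp `|(k %% M.+1%:Z)%Z|%N.

Lemma clsE M k : (cls k : 'I_M.+1)%:Z = (k %% M.+1%:Z)%Z :> int.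
Proof.
have k0 : (0 <= k %% M.+1%:Z)%Z by rewrite modz_ge0.
rewrite /cls /= modn_small ?gez0_abs //.
by rewrite -ltz_nat gez0_abs // ltz_pmod.
Qed.

Lemma clsD M j k : cls (j + k) = cls j + cls k :> 'I_M.+1.
Proof.
apply: val_inj; apply/eqP; rewrite -eqz_nat clsE /= -modz_nat PoszD !clsE.
by rewrite modzDm.
Qed.

Lemma cls_nat M (x : 'I_M.+1) : cls x%:Z = x.
Proof.
by apply: val_inj; apply/eqP; rewrite -eqz_nat clsE modz_nat modn_small.
Qed.

Definition cell m (k : int) : set R := [set t | Num.floor (2 ^+ m * t) = k].

Lemma cellE m k : cell m k = dyadic m k.
Proof.
have p0 : 0 < 2 ^+ m :> R by rewrite exprn_gt0.
apply/seteqP; split => t; rewrite /cell /dyadic /= in_itv /=.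
  by move=> <-; rewrite ler_pdivrMr // ltr_pdivlMr // mulrC floor_itv.
rewrite ler_pdivrMr // ltr_pdivlMr // mulrC => H.
exact: floor_def.
Qed.

Lemma measurable_cell m k : measurable (cell m k : set (measurableTypeR R)).
Proof. by rewrite cellE /dyadic; exact: measurable_itv. Qed.

Definition cell_class {M} m (x : 'I_M.+1) : set R :=
  [set t | cls (Num.floor (2 ^+ m * t)) = x].

Lemma cell_classE M m (x : 'I_M.+1) :
  cell_class m x = \bigcup_k (if cls k == x then cell m k else set0).
Proof.
apply/seteqP; split => t.
  by move=> tx; exists (Num.floor (2 ^+ m * t)) => //; rewrite tx eqxx.
by move=> [k _]; case: eqP => // <- tk; rewrite /cell_class /= tk.
Qed.

Lemma measurable_cell_class M m (x : 'I_M.+1) :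
  measurable (cell_class m x : set (measurableTypeR R)).
Proof.
rewrite cell_classE; apply: countable_bigcupT_measurable.
  exact: countableP.
by move=> k; case: eqP => _ //; exact: measurable_cell.
Qed.

(** The push-forward of [mu] to the cyclic group under
[t |-> floor (2 ^ m * t)]. *)
Definition disc mu m M (x : 'I_M.+1) : R := fine (mu (cell_class m x)).

Lemma disc_ge0 mu m M (x : 'I_M.+1) : 0 <= disc mu m x.
Proof. by rewrite /disc fine_ge0. Qed.

Lemma discE mu m M (x : 'I_M.+1) : (disc mu m x)%:E = mu (cell_class m x).
Proof. by rewrite /disc fineK // fin_num_measure //; exact: measurable_cell_class. Qed.

Lemma trivIset_cell_class M m : trivIset setT (@cell_class M m).
Proof.
apply/trivIsetP => x y _ _ xy; apply/seteqP; split => t //= [tx ty].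
by move: xy; rewrite -tx -ty eqxx.
Qed.

Lemma bigsetU_finP (T : Type) (I : finType) (P : pred I) (F : I -> set T) t :
  (\big[setU/set0]_(y | P y) F y) t <-> exists2 y, P y & F y t.
Proof.
split=> [|[x Px Fxt]]; last by rewrite (bigD1 x) //=; left.
by elim/big_rec: _ => [//|y A Py IH [Fy|/IH//]]; exists y.
Qed.

Lemma sum_disc mu m M : \sum_(x : 'I_M.+1) disc mu m x = 1.
Proof.
apply: EFin_inj; rewrite -sumEFin; under eq_bigr do rewrite discE.
rewrite -measure_bigsetU_ord //; last 2 first.
- by move=> x; exact: measurable_cell_class.
- exact: trivIset_cell_class.
rewrite -(@probability_setT _ _ _ mu); congr (mu _).
apply/seteqP; split => // t _.
by apply/bigsetU_finP; exists (cls (Num.floor (2 ^+ m * t))).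
Qed.

Lemma measure_bigsetU_le d (T : measurableType d)
  (P : {measure set T -> \bar R}) (I : Type) (r : seq I) (F : I -> set T) :
  (forall i, measurable (F i)) ->
  (P (\big[setU/set0]_(i <- r) F i) <= \sum_(i <- r) P (F i))%E.
Proof.
move=> mF; elim: r => [|i r IH]; first by rewrite !big_nil measure0.
rewrite !big_cons; apply: le_trans (leeD2l _ IH).
by apply: measureU2 => //; exact: bigsetU_measurable.
Qed.

Lemma floorD_cases (s t : R) :
  Num.floor (s + t) = Num.floor s + Num.floor t \/
  Num.floor (s + t) = Num.floor s + Num.floor t + 1.
Proof.
have := floor_itv s; have := floor_itv t; rewrite !intrD.
set a := Num.floor s; set b := Num.floor t => tb sa.
have [h|h] := ltP (s + t) ((a + b + 1)%:~R).
  left; apply: floor_def; rewrite h andbT intrD.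
  by move: sa tb; lra.
right; apply: floor_def; rewrite h /= !intrD.
by move: sa tb; lra.
Qed.

Lemma convolutionE mu nu (A : set (measurableTypeR R)) :
  convolution mu nu A = (mu \x nu)%E (@Defs.add_pair R @^-1` A).
Proof. by []. Qed.

(** The integer part of a sum is the sum of the integer parts or exceeds it
by 1, whence the two shifts. *)
Lemma disc_convolution_le mu nu m M (z : 'I_M.+1) :
  disc (convolution mu nu) m z <=
  \sum_x disc mu m x * (disc nu m (z - x) + disc nu m (z - x - cls 1)).
Proof.
rewrite -lee_fin discE -sumEFin.
pose Y x : set (measurableTypeR R) := cell_class m (z - x) `|` cell_class m (z - x - cls 1).
have mY x : measurable (Y x) by apply: measurableU; exact: measurable_cell_class.
pose B (x : 'I_M.+1) : set (measurableTypeR R * measurableTypeR R) :=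
  (cell_class m x : set (measurableTypeR R)) `*` Y x.
have mB x : measurable (B x) by apply: measurableX => //; exact: measurable_cell_class.
apply: (@le_trans _ _ (\sum_x (mu \x nu)%E (B x))%E); last first.
  apply: lee_sum => x _; rewrite /B product_measure1E //; last exact: measurable_cell_class.
  rewrite EFinM discE lee_wpmul2l // EFinD !discE.
  by apply: measureU2; exact: measurable_cell_class.
apply: (@le_trans _ _ ((mu \x nu)%E (\big[setU/set0]_x B x))).
  rewrite convolutionE.
  apply: le_measure.
  - rewrite inE -[X in measurable X]setTI.
    by apply: measurable_add_pair => //; exact: measurable_cell_class.
  - by rewrite inE; apply: bigsetU_measurable.
  move=> [s t] /= stz.
  apply/bigsetU_finP; exists (cls (Num.floor (2 ^+ m * s))) => //; split => //=.
  move: stz; rewrite /Defs.add_pair /cell_class /Y /= mulrDr => stz.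
  have := floorD_cases (2 ^+ m * s) (2 ^+ m * t).
  case=> E; [left|right]; rewrite /cell_class /= -stz E !clsD.
    by rewrite addrAC subrr add0r.
  by rewrite addrAC addrK addrAC subrr add0r.
exact: measure_bigsetU_le.
Qed.

End discretisation.

(** * Supports and uniform perfectness *)

Section supports.
Context {R : realType}.
Implicit Types (mu nu : borel_prob R) (m J : nat).

Lemma measurable_ballR (x r : R) : measurable (ball x r : set (measurableTypeR R)).
Proof. by rewrite ball_itv; exact: measurable_itv. Qed.

(** The complement of the support is covered by the countably many balls with
rational centres and radii [n.+1^-1] that have measure 0. *)
Lemma not_spt_negligible nu : nu.-negligible (~` spt nu).
Proof.
pose F (k : nat) : set (measurableTypeR R) :=
  if (unpickle k : option (rat * nat)) is Some (a, n) then
    if `[< nu (ball (ratr a : R) n.+1%:R^-1) = 0%E >] then ball (ratr a : R) n.+1%:R^-1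
    else set0
  else set0.
have : nu.-negligible (\bigcup_k F k).
  apply: negligible_bigcup => k; rewrite /F.
  case: (unpickle k) => [[a n]|]; last exact: negligible_set0.
  case: asboolP => [E|_]; last exact: negligible_set0.
  by exists (ball (ratr a : R) n.+1%:R^-1); split => //; exact: measurable_ballR.
suff H (x : R) : ~ spt nu x -> (\bigcup_k F k) x by apply: negligibleS => x /H.
move=> /existsNP[r /not_implyP[r0 xr]].
have nu0 : nu (ball x r) = 0%E.
  by apply/eqP; rewrite -measure_le0 leNgt; apply/negP.
have [n nr] : exists n : nat, n.+1%:R^-1 < r / 2.
  exists (Num.truncn (2 / r)).
  rewrite -[ltRHS]invrK ltf_pV2 ?posrE ?invr_gt0 ?divr_gt0 ?ltr0n // invf_div.
  exact: truncnS_gt.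
have n0 : 0 < n.+1%:R :> R by rewrite ltr0n.
have [a /andP[a1 a2]] : exists a : rat, x - n.+1%:R^-1 < ratr a < x + n.+1%:R^-1.
  have : x - n.+1%:R^-1 < x + n.+1%:R^-1.
    have : 0 < n.+1%:R^-1 :> R by rewrite invr_gt0.
    move: (n.+1%:R^-1) => e e0; rewrite ltrBlDr -addrA ltrDl; lra.
  by move=> /rat_in_itvoo[a]; rewrite in_itv /=; exists a.
exists (pickle (a, n)); first exact: I.
rewrite /F pickleK.
have sub : ball (ratr a : R) n.+1%:R^-1 `<=` ball x r.
  suff K (y e : R) : e < r / 2 -> x - e < ratr a < x + e ->
      ratr a - e < y < ratr a + e -> x - r < y < x + r.
    by rewrite !ball_itv => y /=; rewrite !in_itv /=; apply: K => //; rewrite a1 a2.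
  move=> er /andP[h1 h2] /andP[h3 h4]; apply/andP; split; lra.
rewrite asboolT.
  suff K (e : R) : x - e < ratr a < x + e -> ratr a - e < x < ratr a + e.
    by rewrite ball_itv /= in_itv /=; apply: K; rewrite a1 a2.
  by move=> /andP[h1 h2]; apply/andP; split; lra.
exact: (subset_measure0 (measurable_ballR _ _) (measurable_ballR _ _) sub nu0).
Qed.

(** Half-open, so that it is a union of dyadic cells at every scale. *)
Definition box J : set R := `[(- 2 ^+ J), (2 ^+ J)[%classic.

Lemma measurable_box J : measurable (box J : set (measurableTypeR R)).
Proof. exact: measurable_itv. Qed.

Definition concentrated nu J := nu (box J) = 1%E.

Lemma compactly_supported_concentrated nu : compactly_supported nu ->
  exists J, concentrated nu J.
Proof.
move=> /compact_bounded/pinfty_ex_gt0[B B0 HB].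
exists (Num.truncn B).+1; set J := _.+1.
have BJ : B < 2 ^+ J.
  apply: (@lt_le_trans _ _ J%:R); first exact: truncnS_gt.
  by rewrite -natrX ler_nat ltnW // ltn_expl.
have /negligibleP : nu.-negligible (~` box J).
  apply: negligibleS (not_spt_negligible nu) => x /= xJ xs; apply: xJ.
  have := HB _ xs; rewrite /= ler_norml /box /= in_itv /= => /andP[h1 h2].
  by apply/andP; split; lra.
move=> /(_ (measurableC (measurable_box J))) h.
by rewrite /concentrated -[box J]setCK probability_setC ?h ?sube0 //; exact: measurableC (measurable_box J).
Qed.

Lemma concentratedW nu J J' : (J <= J')%N -> concentrated nu J -> concentrated nu J'.
Proof.
move=> JJ' h; apply/eqP; rewrite eq_le probability_le1 /=; last exact: measurable_box.
rewrite -h; apply: le_measure; rewrite ?inE; [exact: measurable_box|exact: measurable_box|].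
have p2 : 2 ^+ J <= 2 ^+ J' :> R by rewrite ler_weXn2l // ler1n.
by move=> x; rewrite /box /= !in_itv /= => /andP[h1 h2]; apply/andP; split; lra.
Qed.

Lemma concentrated_convolution mu nu J : concentrated mu J -> concentrated nu J ->
  concentrated (convolution mu nu) J.+1.
Proof.
move=> hm hn; apply/eqP; rewrite eq_le probability_le1 /=; last exact: measurable_box.
have <- : (mu \x nu)%E (box J `*` box J) = 1%E.
  rewrite product_measure1E; [|exact: measurable_box..].
  by transitivity (1 * 1 : \bar R)%E; [congr (_ * _)%E|rewrite mule1].
apply: le_measure; rewrite ?inE.
- by apply: measurableX; exact: measurable_box.
- rewrite -[X in measurable X]setTI.
  by apply: measurable_add_pair => //; exact: measurable_box.
move=> [s t] /=; rewrite /box /Defs.add_pair /= !in_itv /= exprS.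
by move=> [/andP[h1 h2] /andP[h3 h4]]; apply/andP; split; lra.
Qed.

Lemma prob_setI_full nu (A I : set (measurableTypeR R)) :
  measurable A -> measurable I -> nu I = 1%E -> nu (A `&` I) = nu A.
Proof.
move=> mA mI hI; rewrite [RHS](measureDI nu mA mI).
have nI0 : nu (~` I) = 0%E by rewrite (probability_setC nu mI) hI subee.
by rewrite (subset_measure0 (measurableD mA mI) (measurableC mI) _ nI0) ?add0e // => t [].
Qed.

Lemma spt_two_points nu : ~ point_mass nu -> exists x y, [/\ spt nu x, spt nu y & x < y].
Proof.
move=> npm.
have [x sx] : exists x, spt nu x.
  apply: contrapT => /forallNP ns.
  have /negligibleP := not_spt_negligible nu.
  have -> : ~` spt nu = setT by apply/seteqP; split => // x _; exact: ns.
  move=> /(_ measurableT) h0; have := @probability_setT _ _ _ nu.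
  by rewrite h0 => /eqP; rewrite eq_sym onee_eq0.
have [y [sy xy]] : exists y, spt nu y /\ y <> x.
  apply: contrapT => /forallNP ny; apply: npm; exists x.
  apply/seteqP; split => [y sy|y ->//].
  by apply: contrapT => yx; apply: (ny y).
have [h|h|h] := ltgtP x y; last by case: xy.
  by exists x, y.
by exists y, x.
Qed.

Lemma uniformly_perfect_iter nu (N gamma : R) (k : nat) : uniformly_perfect N gamma nu ->
  forall x r : R, 0 < r -> ~ (spt nu `<=` ball x (N ^+ k * r)) ->
  (((2 `^ gamma) ^+ k)%:E * nu (ball x r) <= nu (ball x (N ^+ k * r)))%E.
Proof.
move=> [N1 _ H]; elim: k => [|k IH] x r r0.
  by rewrite !expr0 !mul1r mul1e.
move=> ns.
have Nk : 0 < N ^+ k * r by rewrite mulr_gt0 // exprn_gt0 //; lra.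
have ns' : ~ (spt nu `<=` ball x (N ^+ k * r)).
  move=> sub; apply: ns => y /sub; apply: le_ball.
  by rewrite exprS -mulrA ler_peMl // ltW.
have := H x (N ^+ k * r) Nk; rewrite mulrA -exprS => /(_ ns); apply: le_trans.
rewrite exprS EFinM -muleA lee_wpmul2l //.
exact: IH.
Qed.

(** Iterating uniform perfectness about [gamma^-1] times gives the factor 2.
The condition on [s] and [t] ensures that none of the balls contains the
support. *)
Lemma uniformly_perfect_halving (N gamma : R) : 1 < N -> 0 < gamma ->
  exists2 A : R, 1 <= A & forall nu (x r s t : R), uniformly_perfect N gamma nu ->
    spt nu s -> spt nu t -> 0 < r -> 2 * (A * r) <= t - s ->
    fine (nu (ball x r)) <= 2^-1 * fine (nu (ball x (A * r))).
Proof.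
move=> N1 g0; pose k := (Num.truncn gamma^-1).+1.
have kg : 1 <= gamma * k%:R.
  rewrite -ler_pdivrMl // mulr1 ltW //; exact: truncnS_gt.
exists (N ^+ k); first by rewrite exprn_ege1 // ltW.
move=> nu x r s t up ss st r0 dr.
have ns : ~ (spt nu `<=` ball x (N ^+ k * r)).
  move=> sub; have := sub _ ss; have := sub _ st.
  rewrite -!ball_normE /= !ltr_norml => /andP[h1 h2] /andP[h3 h4]; lra.
have := uniformly_perfect_iter up r0 ns.
have E b : nu (ball x b) = (fine (nu (ball x b)))%:E.
  by rewrite fineK // fin_num_measure //; exact: measurable_ballR.
rewrite (E r) (E (N ^+ k * r)) -EFinM lee_fin.
have g2 : 2 <= (2 `^ gamma) ^+ k :> R.
  rewrite -powR_mulrn ?powR_ge0 // -powRrM -[leLHS]powRr1 //.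
  by rewrite ler_powR // ler1n.
rewrite -!E => H.
have f0 : 0 <= fine (nu (ball x r)) by rewrite fine_ge0.
have := ler_wpM2r f0 g2; lra.
Qed.

End supports.

(** * Dyadic masses of a concentrated measure *)

Section moments.
Context {R : realType}.
Implicit Types (mu nu : borel_prob R) (m J : nat) (k : int).

(** The cells of scale [m] in [box J] are numbered from 0 to [top_index J m];
the left end of the cell with number [mid_index J m] is 0. *)
Definition top_index (J m : nat) : nat := (2 ^ (J + m).+1).-1.

Lemma top_indexE J m : (top_index J m).+1 = (2 ^ (J + m).+1)%N.
Proof. by rewrite /top_index prednK // expn_gt0. Qed.

Definition mid_index (J m : nat) : int := (2 ^ (J + m))%N%:Z.

Lemma top_mid_index J m : (top_index J m).+1%:Z = mid_index J m + mid_index J m.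
Proof. by rewrite top_indexE expnS mul2n -addnn PoszD. Qed.

Lemma top_index_gt0 J m : (0 < top_index J m)%N.
Proof.
rewrite -ltnS top_indexE expnS; have : (0 < 2 ^ (J + m))%N by rewrite expn_gt0.
lia.
Qed.

Definition in_range J m k := (- mid_index J m <= k) && (k < mid_index J m).

Lemma floor_range J m (t : R) : box J t <-> in_range J m (Num.floor (2 ^+ m * t)).
Proof.
have p0 : 0 < 2 ^+ m :> R by rewrite exprn_gt0.
have E : (mid_index J m)%:~R = 2 ^+ m * 2 ^+ J :> R.
  by rewrite /mid_index -pmulrn natrX exprD mulrC.
rewrite /box /in_range /= in_itv /= floor_ge_int floor_lt_int mulrNz E -mulrN.
by rewrite ler_pM2l // ltr_pM2l.
Qed.

Lemma cls_inj_range J m j k : in_range J m j -> in_range J m k ->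
  cls j = cls k :> 'I_(top_index J m).+1 -> j = k.
Proof.
move=> /andP[j1 j2] /andP[k1 k2] /(congr1 (fun x : 'I__ => x%:Z)).
rewrite !clsE => /eqP; rewrite eqz_mod_dvd top_mid_index => /dvdzP[c hc].
have h0 : 0 < mid_index J m by rewrite /mid_index ltz_nat expn_gt0.
move: (mid_index J m) h0 hc j1 j2 k1 k2 => h h0 hc j1 j2 k1 k2.
have : c = 0 by nia.
by move=> c0; move: hc; rewrite c0 mul0r => /eqP; rewrite subr_eq0 => /eqP.
Qed.

Lemma prob_cell_out nu J m k : concentrated nu J -> ~~ in_range J m k ->
  nu (cell m k) = 0%E.
Proof.
move=> hJ kr; rewrite -(prob_setI_full (@measurable_cell R m k) (measurable_box J) hJ).
rewrite (_ : cell m k `&` box J = set0) ?measure0 //.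
apply/seteqP; split => // t [tk /(floor_range J m)].
by rewrite tk; apply/negP.
Qed.

Lemma disc_cell nu J m k : concentrated nu J -> in_range J m k ->
  disc nu m (cls k : 'I_(top_index J m).+1) = fine (nu (cell m k)).
Proof.
move=> hJ kr; rewrite /disc; congr fine.
rewrite -(prob_setI_full _ (measurable_box J) hJ); last exact: measurable_cell_class.
congr (nu _); apply/seteqP; split => t.
  move=> [tk /(floor_range J m) tJ]; exact: cls_inj_range tk.
by move=> tk; split; [rewrite /cell_class /= tk|apply/(floor_range J m); rewrite tk].
Qed.

(** The same masses as [disc], numbered in the order of the line.  Halving
refers to this order, whereas convolution is compatible with [disc]; the two
differ by a translation of the cyclic group ([lineE]), which the power spectrum
does not see. *)
Definition line nu J m (y : 'I_(top_index J m).+1) : R :=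
  fine (nu (cell m (y%:Z - mid_index J m))).

Lemma in_range_shift J m (y : 'I_(top_index J m).+1) : in_range J m (y%:Z - mid_index J m).
Proof.
have := ltn_ord y; rewrite -ltz_nat top_mid_index /in_range => h.
by rewrite lerBrDr addNr ltrBlDr h andbT.
Qed.

Lemma range_shift_onto J m k : in_range J m k ->
  exists y : 'I_(top_index J m).+1, y%:Z - mid_index J m = k.
Proof.
move=> /andP[k1 k2].
have kp : (0 <= k + mid_index J m)%R by rewrite addrC -lerBlDl sub0r.
have kl : (absz (k + mid_index J m)%R < (top_index J m).+1)%N.
  by rewrite -ltz_nat gez0_abs // top_mid_index ltrD2r.
by exists (Ordinal kl); rewrite /= gez0_abs // addrK.
Qed.

Lemma lineE nu J m y : concentrated nu J ->
  line nu y = disc nu m (y + cls (- mid_index J m) : 'I_(top_index J m).+1).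
Proof.
move=> hJ; rewrite /line -(disc_cell hJ (in_range_shift y)); congr disc.
by rewrite clsD cls_nat.
Qed.

Lemma Lq_momentE nu J m (q : R) : 0 < q -> concentrated nu J ->
  Lq_moment nu q m = (\sum_(x : 'I_(top_index J m).+1) disc nu m x `^ q)%:E.
Proof.
move=> q0 hJ; rewrite /Lq_moment.
pose e (y : 'I_(top_index J m).+1) : int := y%:Z - mid_index J m.
pose a k := (nu (dyadic m k) `^ q)%E.
have a0 k : (0 <= a k)%E by exact: poweR_ge0.
transitivity (\esum_(k in [set k | in_range J m k]) a k)%E.
  rewrite [RHS]esum_mkcond; apply: eq_esum => k _; case: ifPn => //.
  rewrite notin_setE /= => /negP kr.
  by rewrite /a -cellE (prob_cell_out hJ kr) poweR0r // gt_eqF.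
rewrite (@reindex_esum _ _ _ setT _ e); last first.
  split.
  - by move=> y _; exact: in_range_shift.
  - by move=> y z _ _ /addIr/eqP; rewrite eqz_nat => /eqP/val_inj.
  - by move=> k /range_shift_onto[y yk]; exists y.
rewrite esum_fset //; last exact: finite_finset.
have -> : \sum_(y \in [set: 'I_(top_index J m).+1]) a (e y) = \sum_y a (e y).
  rewrite [RHS]fsbig_seq ?index_enum_uniq //; apply: eq_fsbigl.
  by apply/seteqP; split => y //= _; exact: mem_index_enum.
rewrite -sumEFin [RHS](reindex_inj (addIr (cls (- mid_index J m)))) /=.
apply: eq_bigr => y _.
rewrite -lineE // /line /a -cellE -poweR_EFin fineK // fin_num_measure //.
exact: measurable_cell.
Qed.

Lemma sum_line nu J m : concentrated nu J ->
  \sum_(y : 'I_(top_index J m).+1) line nu y = 1.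
Proof.
move=> hJ; under eq_bigr do rewrite lineE //.
rewrite -(sum_disc nu m (top_index J m)) [RHS](reindex_inj (addIr (cls (- mid_index J m)))) //.
Qed.

(** The balls are enlarged so as to contain, respectively be covered by, whole
cells; this replaces the halving constant [A0] by [2 * A0 + 1]. *)
Lemma nonconc_line (N gamma : R) : 1 < N -> 0 < gamma ->
  exists2 A : R, 1 <= A & forall nu J m (s t : R), uniformly_perfect N gamma nu ->
    concentrated nu J -> spt nu s -> spt nu t ->
    nonconc A ((t - s) / 2 * 2 ^+ m) (@line nu J m).
Proof.
move=> N1 g0; have [A0 A01 HA] := uniformly_perfect_halving N1 g0.
exists (2 * A0 + 1); first lra.
move=> nu J m s t up hJ ss st c r r1 Ard.
have p0 : 0 < 2 ^+ m :> R by rewrite exprn_gt0.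
pose T : R := 2 ^+ (J + m).
have halfE : (mid_index J m)%:~R = T by rewrite /mid_index -pmulrn natrX.
pose x0 := (c - T) / 2 ^+ m; pose rho := (r + 1) / 2 ^+ m.
have rho0 : 0 < rho by rewrite divr_gt0 //; lra.
have A0rho : 2 * (A0 * rho) <= t - s.
  rewrite /rho !mulrA ler_pdivrMr //; move: Ard.
  have : A0 <= A0 * r by rewrite ler_peMr //; lra.
  lra.
have H := HA nu x0 rho s t up ss st rho0 A0rho.
have msum (P : pred 'I_(top_index J m).+1) :
   \sum_(y | P y) line nu y = fine (nu (\big[setU/set0]_(y | P y) cell m (y%:Z - mid_index J m))).
  rewrite measure_bigsetU_ord /=; last 2 first.
  - by move=> y; exact: measurable_cell.
  - apply/trivIsetP => y z _ _ yz; apply/seteqP; split => u //= [].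
    rewrite /cell /= => -> /addIr/eqP; rewrite eqz_nat => /eqP/val_inj zy.
    by rewrite zy eqxx in yz.
  rewrite /line -sum_fine // => y _; rewrite fin_num_measure //.
  exact: measurable_cell.
have mU (P : pred 'I_(top_index J m).+1) :
  measurable (\big[setU/set0]_(y | P y) cell m (y%:Z - mid_index J m) : set (measurableTypeR R)).
  by apply: bigsetU_measurable => y _; exact: measurable_cell.
have cellP (y : 'I_(top_index J m).+1) u : cell m (y%:Z - mid_index J m) u ->
   y%:R - T <= 2 ^+ m * u < y%:R - T + 1.
  rewrite /cell /= => uy; have := floor_itv (2 ^+ m * u).
  by rewrite uy !intrD mulrNz halfE -pmulrn.
have ballP (a u : R) : ball x0 (a / 2 ^+ m) u <-> `|2 ^+ m * u - (c - T)| < a.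
  rewrite -ball_normE /= distrC -(ltr_pM2l p0).
  rewrite [2 ^+ m * (a / _)]mulrC divfK ?gt_eqF //.
  rewrite -{1}(gtr0_norm p0) -normrM mulrBr /x0 [2 ^+ m * (_ / _)]mulrC divfK ?gt_eqF //.
apply: le_trans (_ : _ <= fine (nu (ball x0 rho))) _.
  rewrite msum; apply: fine_le; rewrite ?fin_num_measure //; first exact: measurable_ballR.
  apply: le_measure; rewrite ?inE //; first exact: measurable_ballR.
  move=> u /bigsetU_finP[y yc /cellP uy]; apply/ballP; move: yc uy.
  by rewrite ler_norml ltr_norml; lra.
apply: le_trans H _; rewrite ler_pM2l //.
rewrite -[nu (ball _ _)](prob_setI_full _ (measurable_box J) hJ) //; last exact: measurable_ballR.
rewrite msum; apply: fine_le; rewrite ?fin_num_measure //.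
  by apply: measurableI; [exact: measurable_ballR|exact: measurable_box].
apply: le_measure; rewrite ?inE //.
  by apply: measurableI; [exact: measurable_ballR|exact: measurable_box].
move=> u [ub /(floor_range J m) /range_shift_onto[y yu]].
have uy : cell m (y%:Z - mid_index J m) u by rewrite /cell /= yu.
apply/bigsetU_finP; exists y => //.
have := cellP _ _ uy; move: ub; rewrite mulrA => /ballP.
have h1 : A0 <= A0 * r by rewrite ler_peMr //; lra.
by rewrite ler_norml ltr_norml; lra.
Qed.

End moments.

(** * Energies and masses of convolutions of measures *)

Section discretised_energy.
Context {R : realType}.
Implicit Types (mu nu : borel_prob R).

(** A translation multiplies the Fourier transform by a number of modulus 1. *)
Lemma pw_shift M (f : 'I_M.+1 -> R) (c : 'I_M.+1) (k : nat) :
  pw (fun y => f (y + c)) k = pw f k.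
Proof.
rewrite /pw; suff -> : ft (fun y => f (y + c)) k = ft f k * @chi R M k (- c)%R.
  by rewrite abs2M abs2_chi mulr1.
rewrite /ft mulr_suml [RHS](reindex_inj (addIr c)); apply: eq_bigr => y _.
by rewrite -mulrA -chi_addr addrK.
Qed.

(** The exponent [n] depends on [nu] through [N] and [gamma] only, while
[C] may depend on [nu] and [J].  The halving property holds up to the distance
of two points of the support; the bound [16 * 2 ^+ J] on [d0] meets the
restriction on [d] in [energy_bound]. *)
Lemma disc_energy_le (N gamma kap : R) : 1 < N -> 0 < gamma -> 0 < kap < 1 ->
  exists2 n : nat, (0 < n)%N & forall nu (J : nat), uniformly_perfect N gamma nu ->
    ~ point_mass nu -> concentrated nu J ->
    exists2 C : R, 0 < C & forall m : nat,
      energy n (fun x : 'I_(top_index J m).+1 => disc nu m x) <= C * (2 ^+ m) `^ (kap - 1).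
Proof.
move=> N1 g0 kap01.
have [A A1 HA] := nonconc_line N1 g0.
have [n n0 [C C0 HC]] := energy_bound A1 kap01.
exists n => // nu J up npm hJ.
have [s [t [ss st lt_st]]] := spt_two_points npm.
pose d0 : R := Num.min ((t - s) / 2) (16 * 2 ^+ J).
have d00 : 0 < d0.
  by rewrite lt_min divr_gt0 ?subr_gt0 //= mulr_gt0 // exprn_gt0.
exists (C * d0 `^ (kap - 1)); first by rewrite mulr_gt0 // powR_gt0.
move=> m; have p0 : 0 < 2 ^+ m :> R by rewrite exprn_gt0.
have -> : energy n (fun x : 'I_(top_index J m).+1 => disc nu m x) =
    energy n (@line R nu J m).
  rewrite /energy; congr (_ * _); apply: eq_bigr => k _; congr (_ ^+ _).
  rewrite -(pw_shift _ (cls (- mid_index J m))); congr (pw _ _).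
  by apply/funext => y; rewrite lineE.
rewrite -mulrA -powRM ?(ltW d00) ?(ltW p0) //.
apply: HC => //.
- exact: top_index_gt0.
- rewrite mulr_gt0 //= top_indexE natrX.
  have : d0 <= 16 * 2 ^+ J by rewrite ge_min lexx orbT.
  move=> /(ler_wpM2r (ltW p0)) /le_trans; apply.
  by rewrite -mulrA -exprD exprS mulrA; rewrite ler_pM2r ?exprn_gt0 // -natrM ler_nat.
- move=> c r r1 Ard; apply: (HA nu J m s t) => //.
  apply: le_trans Ard _; rewrite ler_pM2r // ge_min lexx //.
- by move=> y; rewrite /line fine_ge0.
exact: sum_line.
Qed.

(** The law of a fair carry bit; [smear u] is the average of [u] and its
translate by one cell. *)
Definition carry {M} (x : 'I_M.+1) : R := 2^-1 * ((x == 0)%:R + (x == cls 1)%:R).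

Lemma carry_ge0 M (x : 'I_M.+1) : 0 <= carry x.
Proof. by rewrite mulr_ge0 ?addr_ge0. Qed.

Lemma sum_deltaM M (z : 'I_M.+1) (F : 'I_M.+1 -> R) :
  \sum_x (x == z)%:R * F x = F z.
Proof.
rewrite (bigD1 z) //= eqxx mul1r big1 ?addr0 // => x /negbTE ->.
by rewrite mul0r.
Qed.

Lemma sum_carry M : \sum_(x : 'I_M.+1) carry x = 1.
Proof.
rewrite -mulr_sumr big_split /=.
under eq_bigr do rewrite -[(_ == 0)%:R]mulr1.
under [X in _ + X]eq_bigr do rewrite -[(_ == _)%:R]mulr1.
by rewrite (sum_deltaM 0 (fun=> 1)) (sum_deltaM _ (fun=> 1)) mulVf.
Qed.

Definition smear {M} (u : 'I_M.+1 -> R) := convol carry u.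

Lemma smearE M (u : 'I_M.+1 -> R) z : smear u z = 2^-1 * (u z + u (z - cls 1)).
Proof.
rewrite /smear /convol; under eq_bigr do rewrite -mulrA mulrDl.
by rewrite -mulr_sumr big_split /= !sum_deltaM subr0.
Qed.

Lemma smear_ge0 M (u : 'I_M.+1 -> R) z : (forall x, 0 <= u x) -> 0 <= smear u z.
Proof. by move=> u0; apply: convol_ge0 => // x; exact: carry_ge0. Qed.

Lemma pw_smear_le M (u : 'I_M.+1 -> R) k : pw (smear u) k <= pw u k.
Proof.
rewrite pw_convol -[leRHS]mul1r ler_wpM2r ?pw_ge0 //.
by apply: le_trans (pw_le_sqr _ _) _; [exact: carry_ge0 | rewrite sum_carry expr1n].
Qed.

(** The Fourier transform of a probability vector is bounded by 1, so the
carry does not increase energies. *)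
Lemma energy_smear_le M n (u : 'I_M.+1 -> R) : energy n (smear u) <= energy n u.
Proof.
rewrite ler_wpM2l ?invr_ge0 //; apply: ler_sum => k _.
by rewrite lerXn2r ?nnegrE ?pw_ge0 // pw_smear_le.
Qed.

Lemma convolC M (f g : 'I_M.+1 -> R) z : convol f g z = convol g f z.
Proof.
rewrite /convol (reindex_inj (subrI z)) /=; apply: eq_bigr => x _.
by rewrite subKr mulrC.
Qed.

Lemma disc_convolution_smear mu nu m M (z : 'I_M.+1) :
  disc (convolution mu nu) m z <= 2 * convol (@disc R mu m M) (smear (@disc R nu m M)) z.
Proof.
apply: le_trans (disc_convolution_le _ _ _ _) _.
rewrite /convol mulr_sumr; apply: ler_sum => x _.
rewrite smearE le_eqVlt; apply/orP; left; apply/eqP.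
by move: (disc mu _ _) (disc nu _ _ + _) => a b; field.
Qed.

Lemma convol_moment_le_disc mu nu J m (q : R) : 1 < q ->
  \sum_(x : 'I_(top_index J m).+1) disc (convolution mu nu) m x `^ q <=
  2 `^ q * \sum_x (convol (smear (@disc R nu m (top_index J m))) (@disc R mu m (top_index J m)) x) `^ q.
Proof.
move=> q1; rewrite mulr_sumr; apply: ler_sum => x _.
have c0 : 0 <= convol (smear (@disc R nu m (top_index J m))) (@disc R mu m (top_index J m)) x.
  apply: convol_ge0 => y; last exact: disc_ge0.
  by apply: smear_ge0 => z; exact: disc_ge0.
rewrite -powRM //; apply: ge0_ler_powR; rewrite ?nnegrE ?disc_ge0 ?mulr_ge0 //.
  by apply: ltW; exact: lt_trans q1.
by rewrite convolC; exact: disc_convolution_smear.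
Qed.

Lemma sum_smear M (u : 'I_M.+1 -> R) : \sum_x smear u x = \sum_x u x.
Proof. by rewrite sum_convol sum_carry mul1r. Qed.

(** Fourier inversion and the triangle inequality. *)
Lemma le_sum_sqrt_pw M (f : 'I_M.+1 -> R) z :
  f z <= M.+1%:R^-1 * \sum_(k : 'I_M.+1) Num.sqrt (pw f k).
Proof.
rewrite mulrC ler_pdivlMr ?ltr0n // mulrC.
have [t Et] : exists t : 'I_M.+1, t = - z by eexists.
have := congr1 (@complex.Re R) (fourier_inversion f z); rewrite -Et.
rewrite /= => <-.
rewrite (big_morph (@complex.Re R) (id1 := 0) (op1 := +%R)) //; last first.
  by case=> a b [c d].
apply: ler_sum => k _; have := abs2M (ft f k) (@chi R M k t).
rewrite abs2_chi mulr1 -/(pw f k) => <-.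
apply: (le_trans (ler_norm _)); rewrite -sqrtr_sqr ler_wsqrtr //.
by rewrite /abs2 lerDl sqr_ge0.
Qed.

(** Every convolution of measures spreads one carry, hence all factors but the
first are smeared. *)
Fixpoint smeared {M} (u : nat -> 'I_M.+1 -> R) (k : nat) : 'I_M.+1 -> R :=
  if k is k'.+1 then convol (smeared u k') (smear (u k)) else u 0%N.

Lemma disc_convolutions_le (nu : nat -> borel_prob R) k m M (z : 'I_M.+1) :
  disc (convolutions nu k) m z <=
  2 ^+ k * smeared (fun i => @disc R (nu i) m M) k z.
Proof.
elim: k z => [|k IH] z; first by rewrite expr0 mul1r.
rewrite /= ; apply: le_trans (disc_convolution_smear _ _ _ _) _.
rewrite exprS -mulrA ler_pM2l // /convol mulr_sumr; apply: ler_sum => x _.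
rewrite mulrA ler_wpM2r //; apply: smear_ge0 => y; exact: disc_ge0.
Qed.

Lemma pw_smeared_le M (u : nat -> 'I_M.+1 -> R) (k j : nat) :
  pw (smeared u k) j <= \prod_(i < k.+1) pw (u i) j.
Proof.
elim: k => [|k IH]; first by rewrite big_ord1.
rewrite big_ord_recr /= pw_convol; apply: ler_pM; rewrite ?pw_ge0 //.
exact: pw_smear_le.
Qed.

(** All but [2 * n] factors are dropped, being bounded by 1, and the
inequality of the means is applied to the remaining product of moduli. *)
Lemma smeared_le_energy M (u : nat -> 'I_M.+1 -> R) (n k : nat) z :
  (forall i x, 0 <= u i x) -> (forall i, \sum_x u i x = 1) ->
  (0 < n)%N -> (2 * n <= k.+1)%N ->
  smeared u k z <= (2 * n)%N%:R^-1 * \sum_(i < 2 * n) energy n (u i).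
Proof.
move=> u0 u1 n0 nk; apply: le_trans (le_sum_sqrt_pw _ _) _.
rewrite /energy -mulr_sumr exchange_big /= [leRHS]mulrCA.
rewrite ler_wpM2l ?invr_ge0 // mulr_sumr; apply: ler_sum => j _.
have pw1 i : pw (u i) j <= 1.
  by apply: le_trans (pw_le_sqr _ _) _; rewrite ?u1 ?expr1n.
apply: (@le_trans _ _ (\prod_(i < 2 * n) Num.sqrt (pw (u i) j))).
  have -> : \prod_(i < 2 * n) Num.sqrt (pw (u i) j) =
     Num.sqrt (\prod_(i < 2 * n) pw (u i) j).
    by elim/big_rec2 : _ => [|i x y _ ->]; rewrite ?sqrtr1 // sqrtrM ?pw_ge0.
  apply: ler_wsqrtr; apply: le_trans (pw_smeared_le u k j) _.
  rewrite (big_ord_widen _ (fun i => pw (u i) j) nk).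
  rewrite [leRHS]big_mkcond /=; apply: ler_prod => i _; rewrite pw_ge0 /=.
  by case: ifP.
apply: le_trans (prod_le_mean_expr _ _) _.
- by rewrite muln_gt0.
- by move=> i; exact: sqrtr_ge0.
rewrite ler_wpM2l ?invr_ge0 //; apply: ler_sum => i _.
by rewrite exprM sqr_sqrtr ?pw_ge0.
Qed.

Lemma concentrated_convolutions (nu : nat -> borel_prob R) k :
  (forall i, compactly_supported (nu i)) ->
  exists J, concentrated (convolutions nu k) J /\
    forall i, (i <= k)%N -> concentrated (nu i) J.
Proof.
move=> cs; elim: k => [|k [J [h1 h2]]].
  have [J hJ] := compactly_supported_concentrated (cs 0%N).
  by exists J; split => // i; rewrite leqn0 => /eqP ->.
have [J' hJ'] := compactly_supported_concentrated (cs k.+1).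
exists (maxn J J').+1; split.
  apply: concentrated_convolution; first exact: concentratedW (leq_maxl _ _) h1.
  exact: concentratedW (leq_maxr _ _) hJ'.
move=> i; rewrite leq_eqVlt => /predU1P[->|ik].
  by apply: concentratedW hJ'; rewrite leqW // leq_maxr.
by apply: concentratedW (h2 i ik); rewrite leqW // leq_maxl.
Qed.

(** By [smeared_le_energy] the cell masses of the convolution are bounded
by a mean of energies, each of which is controlled by [disc_energy_le]. *)
Lemma disc_convolutions_sup (N gamma kap : R) : 1 < N -> 0 < gamma -> 0 < kap < 1 ->
  exists n : nat, forall (nu : nat -> borel_prob R),
    (forall i, compactly_supported (nu i)) -> (forall i, ~ point_mass (nu i)) ->
    (forall i, uniformly_perfect N gamma (nu i)) ->
    forall k, (n <= k)%N ->
    exists J, concentrated (convolutions nu k) J /\ exists2 C : R, 0 < C &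
      forall m (z : 'I_(top_index J m).+1),
        disc (convolutions nu k) m z <= C * (2 ^+ m) `^ (kap - 1).
Proof.
move=> N1 g0 k01; have [n n0 Hn] := disc_energy_le N1 g0 k01.
exists (2 * n)%N => nu cs np up k nk.
have [J [h1 h2]] := concentrated_convolutions k cs.
exists J; split=> //.
have C_ (i : 'I_(2 * n)) : exists C : R, 0 < C /\ forall m : nat,
      energy n (fun x : 'I_(top_index J m).+1 => disc (nu i) m x) <= C * (2 ^+ m) `^ (kap - 1).
  have ik : (i <= k)%N by apply: leq_trans (ltnW (ltn_ord i)) nk.
  by have [C C0 HC] := Hn _ _ (up i) (np i) (h2 _ ik); exists C.
have [C HC] := choice C_.
have C0 i : 0 < C i := (HC i).1.
have nn : 0 < (2 * n)%N%:R :> R by rewrite ltr0n muln_gt0.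
exists (2 ^+ k * ((2 * n)%N%:R^-1 * (1 + \sum_i C i))).
  by rewrite !mulr_gt0 ?exprn_gt0 ?invr_gt0 // ltr_pwDl // sumr_ge0 // => i _; exact: ltW.
move=> m z; apply: le_trans (disc_convolutions_le _ _ _ _) _.
rewrite -mulrA ler_pM2l ?exprn_gt0 //.
apply: le_trans (smeared_le_energy _ _ _ n0 _) _.
- by move=> i x; exact: disc_ge0.
- by move=> i; exact: sum_disc.
- exact: leqW.
rewrite -mulrA ler_pM2l ?invr_gt0 // mulrDl mul1r mulr_suml.
apply: (@le_trans _ _ (\sum_(i < 2 * n) C i * (2 ^+ m) `^ (kap - 1))).
  by apply: ler_sum => i _; exact: (HC i).2.
by rewrite lerDr powR_ge0.
Qed.

End discretised_energy.

(** * Dimensions *)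

Section liminf_bounds.
Context {R : realType}.
Local Open Scope ereal_scope.
Implicit Types (u v : (\bar R)^nat) (c : \bar R).

(** This form of the lower limit reduces all comparisons to bounds on
tails. *)
Lemma limn_einf_sup_inf u : limn_einf u = ereal_sup (range (einfs u)).
Proof. by rewrite limn_einf_lim; apply/cvg_lim => //; exact: cvg_einfs_sup. Qed.

Lemma limn_einf_ge u c k : (forall m, (k <= m)%N -> c <= u m) ->
  c <= limn_einf u.
Proof.
move=> cu; rewrite limn_einf_sup_inf.
apply: (@le_trans _ _ (einfs u k)); last by apply: ereal_sup_ubound; exists k.
by apply: le_ereal_inf_tmp => _ [m /= km <-]; exact: cu.
Qed.

Lemma limn_einf_gt u c : c < limn_einf u ->
  exists k, forall m, (k <= m)%N -> c < u m.
Proof.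
rewrite limn_einf_sup_inf => /ereal_sup_gt[_ [k _ <-] ck].
exists k => m km; apply: (lt_le_trans ck).
by apply: ereal_inf_lbound; exists m.
Qed.

Lemma limn_einf_le u v k : (forall m, (k <= m)%N -> u m <= v m) ->
  limn_einf u <= limn_einf v.
Proof.
move=> uv; rewrite {1}limn_einf_sup_inf.
apply: ub_ereal_sup => _ [j _ <-].
apply: (@limn_einf_ge _ _ (maxn j k)) => m; rewrite geq_max => /andP[jm km].
apply: le_trans (uv m km).
by apply: ereal_inf_lbound; exists m.
Qed.

End liminf_bounds.

Lemma natr_eventually_ge (R : realType) (x : R) :
  exists k, forall m, (k <= m)%N -> x <= m%:R.
Proof.
exists (Num.bound `|x|) => m km.
apply: (le_trans (ler_norm x)).
apply: (le_trans (ltW (archi_boundP (normr_ge0 x)))).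
by rewrite ler_nat.
Qed.

Section finite_scale_dimension.
Context {R : realType}.
Implicit Types (q x S : R) (m : nat).

(** The quantity whose lower limit is the dimension, as a function of the
moment [S]. *)
Definition dim_at q m S : R := - (ln S / ln 2) / ((q - 1) * m%:R).

Lemma ln2_gt0 : 0 < ln 2 :> R.
Proof. by apply: ln_gt0; rewrite ltr1n. Qed.

Lemma le_dim_at q m S x : 1 < q -> (0 < m)%N -> 0 < S ->
  (x <= dim_at q m S) = (S <= 2 `^ (- ((q - 1) * m%:R * x))).
Proof.
move=> q1 m0 S0; have l2 := ln2_gt0.
have D0 : 0 < (q - 1) * m%:R by rewrite mulr_gt0 ?subr_gt0 ?ltr0n.
rewrite /dim_at ler_pdivlMr // -[RHS]ler_ln ?posrE ?powR_gt0 // ln_powR.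
by rewrite lerNr ler_pdivrMr // (mulrC x).
Qed.

Lemma dim_at_le q m S x : 1 < q -> (0 < m)%N -> 0 < S ->
  (dim_at q m S <= x) = (2 `^ (- ((q - 1) * m%:R * x)) <= S).
Proof.
move=> q1 m0 S0; have l2 := ln2_gt0.
have D0 : 0 < (q - 1) * m%:R by rewrite mulr_gt0 ?subr_gt0 ?ltr0n.
rewrite /dim_at ler_pdivrMr // -[RHS]ler_ln ?posrE ?powR_gt0 // ln_powR.
by rewrite lerNl ler_pdivlMr // (mulrC x).
Qed.

Lemma pow2_log S : 0 < S -> 2 `^ (ln S / ln 2) = S.
Proof.
move=> S0; have l2 := ln2_gt0.
by rewrite /powR pnatr_eq0 /= divfK ?gt_eqF // lnK // posrE.
Qed.

End finite_scale_dimension.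

Section dimension_of_a_measure.
Context {R : realType}.
Implicit Types (nu : borel_prob R) (q c : R) (J m : nat).

Definition moment nu q J m : R := \sum_(x < (top_index J m).+1) disc nu m x `^ q.

Lemma top_index_pow2 J m : (top_index J m).+1%:R = 2 `^ ((J + m).+1%:R) :> R.
Proof. by rewrite top_indexE natrX powR_mulrn. Qed.

Lemma moment_gt0_disc nu q J m : 1 < q -> 0 < moment nu q J m.
Proof.
by move=> q1; apply: moment_gt0 => //; [move=> x; exact: disc_ge0|exact: sum_disc].
Qed.

Lemma Lq_dimE nu J q : 1 < q -> concentrated nu J ->
  Lq_dim nu q = limn_einf (fun m => (dim_at q m (moment nu q J m))%:E).
Proof.
move=> q1 nuJ; rewrite /Lq_dim; congr limn_einf; apply/funext => m.
rewrite (Lq_momentE m _ nuJ) ?(lt_trans _ q1) //.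
by rewrite /log2e lne_EFin ?moment_gt0_disc.
Qed.

Lemma disc_le1 nu m M (x : 'I_M.+1) : disc nu m x <= 1.
Proof.
rewrite -(sum_disc nu m M) (bigD1 x) //= lerDl.
by apply: sumr_ge0 => y _; exact: disc_ge0.
Qed.

Lemma moment_le_sup nu q J m (b : R) : 1 < q ->
  (forall x : 'I_(top_index J m).+1, disc nu m x <= b) ->
  moment nu q J m <= b `^ (q - 1).
Proof.
move=> q1 le_b.
have -> : b `^ (q - 1) = \sum_(x < (top_index J m).+1) disc nu m x * b `^ (q - 1).
  by rewrite -mulr_suml sum_disc mul1r.
apply: ler_sum => x _.
rewrite -(mulr_powRB1 (disc_ge0 _ _ _)) ?(lt_trans _ q1) //.
apply: ler_wpM2l; first exact: disc_ge0.
have b0 : 0 <= b by apply: le_trans (le_b x); exact: disc_ge0.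
by apply: ge0_ler_powR; rewrite ?nnegrE ?disc_ge0 ?subr_ge0 ?(ltW q1).
Qed.

(** Since the masses add up to 1, the moment is at most the [(q - 1)]-th power
of the largest mass.  The bound does not depend on [q], so it passes to the
limit. *)
Lemma Lq_dim_ge_sup nu J q c (kap : R) : 1 < q -> concentrated nu J -> 0 < c ->
  (forall m (x : 'I_(top_index J m).+1), disc nu m x <= c * (2 ^+ m) `^ (kap - 1)) ->
  ((1 - kap)%:E <= Lq_dim nu q)%E.
Proof.
move=> q1 nuJ c0 sup; rewrite (Lq_dimE q1 nuJ).
apply/lee_addgt0Pr => e e0; rewrite -leeBlDr //.
have [k kP] := natr_eventually_ge (ln c / ln 2 / e).
apply: (@limn_einf_ge _ _ _ k.+1) => m km.
have m0 : (0 < m)%N by lia.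
rewrite -EFinB lee_fin le_dim_at ?moment_gt0_disc //.
apply: (le_trans (moment_le_sup q1 (sup m))).
rewrite -{1}(pow2_log c0) -powR_mulrn // -powRrM -powRD ?pnatr_eq0 ?implybT //.
rewrite -powRrM; apply: ler_powR; first by rewrite ler1n.
have : ln c / ln 2 <= m%:R * e.
  by rewrite -ler_pdivrMr // kP //; lia.
move: (ln c / ln 2) => l lme.
have q1' : 0 < q - 1 by rewrite subr_gt0.
rewrite -subr_ge0.
have -> : - ((q - 1) * m%:R * (1 - kap - e)) - (l + m%:R * (kap - 1)) * (q - 1)
  = (q - 1) * (m%:R * e - l) by ring.
by rewrite mulr_ge0 ?subr_ge0 // ltW.
Qed.

Lemma Lq_dim_ge0 nu J q : 1 < q -> concentrated nu J -> (0 <= Lq_dim nu q)%E.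
Proof.
move=> q1 nuJ; rewrite -[0%E]/((0 : R)%:E) -(subrr (1 : R)).
apply: (Lq_dim_ge_sup q1 nuJ (@ltr01 R)) => m x.
by rewrite subrr powRr0 mulr1 disc_le1.
Qed.

(** By convexity the moment is smallest for the uniform vector on the
[2 ^ (J + m).+1] cells of the box. *)
Lemma Lq_dim_le1 nu J q : 1 < q -> concentrated nu J -> (Lq_dim nu q <= 1)%E.
Proof.
move=> q1 nuJ; rewrite (Lq_dimE q1 nuJ).
apply/lee_addgt0Pr => e e0.
have [k kP] := natr_eventually_ge (J.+1%:R / e).
rewrite (_ : 1 + e%:E = limn_einf (fun=> (1 + e)%:E))%E; last first.
  by rewrite (cvg_limn_einf_sup (@cvg_cst _ _ _ _ _)).
apply: (@limn_einf_le _ _ _ k.+1) => m km.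
have m0 : (0 < m)%N by lia.
rewrite lee_fin dim_at_le ?moment_gt0_disc //.
apply: le_trans (moment_ge_powN q1 (fun x => disc_ge0 nu m x) (sum_disc nu m _)).
rewrite top_index_pow2 -powRrM; apply: ler_powR; first by rewrite ler1n.
have Jme : J.+1%:R <= m%:R * e by rewrite -ler_pdivrMr // kP //; lia.
have q1' : 0 < q - 1 by rewrite subr_gt0.
rewrite -addSn natrD -subr_ge0.
have -> : (J.+1%:R + m%:R) * (1 - q) - - ((q - 1) * m%:R * (1 + e))
  = (q - 1) * (m%:R * e - J.+1%:R) by ring.
by rewrite mulr_ge0 ?subr_ge0 // ltW.
Qed.

(** Jensen's inequality for the probability vector of the masses, the function
being their power [q - 1]. *)
Lemma moment_power_le nu q q' J m : 1 < q -> q <= q' ->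
  moment nu q J m `^ ((q' - 1) / (q - 1)) <= moment nu q' J m.
Proof.
move=> q1 qq'; rewrite /moment.
have q0 : 0 < q by rewrite (lt_trans _ q1).
have q0' : 0 < q' by rewrite (lt_le_trans q0).
have q1' : 0 < q - 1 by rewrite subr_gt0.
under eq_bigr do rewrite -(mulr_powRB1 (disc_ge0 _ _ _) q0).
under [leRHS]eq_bigr do rewrite -(mulr_powRB1 (disc_ge0 _ _ _) q0').
have r1 : 1 <= (q' - 1) / (q - 1) by rewrite ler_pdivlMr // mul1r lerD2r.
apply: (le_trans (sum_powR_jensen r1 _ _ (sum_disc nu m _))) => [x|x|].
- exact: disc_ge0.
- exact: powR_ge0.
apply: ler_sum => x _; rewrite -powRrM mulrCA divff ?mulr1 //.
by rewrite gt_eqF.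
Qed.

Lemma Lq_dim_nonincreasing nu J q q' : 1 < q -> q <= q' -> concentrated nu J ->
  (Lq_dim nu q' <= Lq_dim nu q)%E.
Proof.
move=> q1 qq' nuJ; have q1' := lt_le_trans q1 qq'.
rewrite (Lq_dimE q1 nuJ) (Lq_dimE q1' nuJ).
apply: (@limn_einf_le _ _ _ 1) => m m0.
rewrite lee_fin dim_at_le ?moment_gt0_disc //.
apply: le_trans (moment_power_le nu J m q1 qq').
have q10 : 0 < q - 1 by rewrite subr_gt0.
have q10' : 0 <= q' - 1 by rewrite subr_ge0 ltW.
have := lexx (dim_at q m (moment nu q J m)).
rewrite {1}(dim_at_le _ q1 m0 (moment_gt0_disc _ _ _ q1)).
move: (dim_at _ _ _) => x xS.
apply: le_trans (ge0_ler_powR _ _ _ xS); rewrite ?nnegrE ?powR_ge0 //.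
- rewrite -powRrM le_eqVlt; apply/orP; left; apply/eqP; congr (_ `^ _).
  by field; rewrite gt_eqF.
- by rewrite divr_ge0 // ltW.
- by rewrite ltW // moment_gt0_disc.
Qed.

(** The dimension is monotone only for exponents larger than 1, so that the
exponent is first truncated from below. *)
Lemma Linfty_dim_cvg nu J : concentrated nu J ->
  cvg (Lq_dim nu q @[q --> +oo]).
Proof.
move=> nuJ.
have mon : {homo (fun q => Lq_dim nu (Num.max q 2)) : x y / x <= y >-> (y <= x)%E}.
  move=> x y xy /=; apply: (@Lq_dim_nonincreasing _ J) => //.
    by rewrite lt_max ltr1n orbT.
  by rewrite ge_max !le_max xy lexx orbT.
have := nonincreasing_cvge mon.
move=> h; apply/cvg_ex; eexists; apply: cvg_trans h.
apply: near_eq_cvg; near=> q.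
by congr Lq_dim; apply/max_idPl; near: q; exact: nbhs_pinfty_ge.
Unshelve. all: by end_near. Qed.

Lemma Linfty_dim_ge nu J c : concentrated nu J ->
  (forall q, 1 < q -> (c%:E <= Lq_dim nu q)%E) -> (c%:E <= Linfty_dim nu)%E.
Proof.
move=> nuJ h; apply: lime_ge; first exact: Linfty_dim_cvg nuJ.
near=> q; apply: h; near: q; exact: nbhs_pinfty_gt.
Unshelve. all: by end_near. Qed.

Lemma Linfty_dim_le1 nu J : concentrated nu J -> (Linfty_dim nu <= 1)%E.
Proof.
move=> nuJ; apply: lime_le; first exact: Linfty_dim_cvg nuJ.
near=> q; apply: (Lq_dim_le1 _ nuJ); near: q; exact: nbhs_pinfty_gt.
Unshelve. all: by end_near. Qed.

End dimension_of_a_measure.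

(** * Strict growth under convolution *)

Section growth_under_convolution.
Context {R : realType}.
Implicit Types (mu nu : borel_prob R) (J m : nat).

Lemma moment_convolution_le mu nu J m (q : R) : 1 < q ->
  moment (convolution mu nu) q J m <= 2 `^ q * moment mu q J m.
Proof.
move=> q1; apply: (le_trans (convol_moment_le_disc mu nu J m q1)).
apply: ler_wpM2l; first exact: powR_ge0.
apply: convol_moment_le => //; first by move=> x; exact: disc_ge0.
  by move=> x; apply: smear_ge0 => y; exact: disc_ge0.
by rewrite sum_smear sum_disc.
Qed.

Lemma scale_factor_split (C x l : R) J m : 0 <= C ->
  (C * (2 ^+ m) `^ (x / 2 - 1) * (2 `^ (J + m).+1%:R) `^ (1 - x)) `^ l =
  (C * (2 `^ J.+1%:R) `^ (1 - x)) `^ l * 2 `^ (- (x / 2 * l * m%:R)).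
Proof.
move=> C0.
have -> : 2 `^ (- (x / 2 * l * m%:R)) = (2 `^ (m%:R * (- (x / 2)))) `^ l :> R.
  by rewrite -powRrM; congr (_ `^ _); ring.
have n2 : (2 : R) != 0 by rewrite pnatr_eq0.
have A0 : 0 <= C * (2 `^ J.+1%:R) `^ (1 - x) by rewrite mulr_ge0 // powR_ge0.
rewrite -(powRM _ A0 (powR_ge0 _ _)).
congr (_ `^ _); rewrite -(powR_mulrn _ (ler0n R 2)) -!powRrM -!mulrA.
congr (_ * _); rewrite -!powRD ?n2 ?implybT //; congr (_ `^ _).
by rewrite -addSn natrD; field.
Qed.

(** Combines [convol_moment_gain] with the energy bound for [kap] equal
to half of the power of [2 ^ m] that is won; the other half is the gain. *)
Lemma moment_convolution_gain mu nu J (q N gamma a : R) :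
  1 < q -> 0 <= a < 1 -> uniformly_perfect N gamma nu -> ~ point_mass nu ->
  concentrated nu J ->
  exists g K : R, [/\ 0 < g, 0 < K &
    forall m, 2 `^ (- ((q - 1) * m%:R * a)) <= moment mu q J m ->
      moment (convolution mu nu) q J m <=
        K * moment mu q J m * 2 `^ (- (g * m%:R))].
Proof.
move=> q1 /andP[a0 a1] unp npt nuJ.
have [N1 /andP[gam0 _] _] := unp.
pose la : R := Num.min 1 (q - 1).
have la0 : 0 < la by rewrite lt_min ltr01 subr_gt0.
have la1 : la <= 1 by rewrite ge_min lexx.
pose b := 1 - a.
have b0 : 0 < b by rewrite subr_gt0.
have b1 : b <= 1 by rewrite /b; lra.
have lab0 : 0 < la * b by rewrite mulr_gt0.
have lab1 : la * b <= 1 by rewrite mulr_ile1 // ltW.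
have kap01 : 0 < la * b / 2 < 1 by apply/andP; split; lra.
have [n n0 /(_ nu J unp npt nuJ)[C C0 HC]] := disc_energy_le N1 gam0 kap01.
have n0' : 0 < n%:R :> R by rewrite ltr0n.
have lan0 : 0 < la / n%:R by rewrite divr_gt0.
pose B : R := 2 `^ J.+1%:R `^ (1 - la * b).
have B0 : 0 < B by rewrite !powR_gt0.
exists (la * b / 2 * (la / n%:R)), (2 `^ q * (C * B) `^ (la / n%:R)); split.
- by case/andP: kap01 => k0 _; rewrite mulr_gt0.
- by rewrite mulr_gt0 ?powR_gt0 // mulr_gt0.
move=> m large.
apply: (le_trans (convol_moment_le_disc mu nu J m q1)).
rewrite -[leRHS]mulrA -[leRHS]mulrA; apply: ler_wpM2l; first exact: powR_ge0.
have q1' : 0 < q - 1 by rewrite subr_gt0.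
have large' : (top_index J m).+1%:R `^ (- ((q - 1) * a)) <=
    \sum_(x < (top_index J m).+1) disc mu m x `^ q.
  apply: le_trans large.
  rewrite top_index_pow2 -powRrM; apply: ler_powR; first by rewrite ler1n.
  rewrite mulrN lerN2 mulrAC [leRHS]mulrC; apply: ler_wpM2l.
    by rewrite mulr_ge0 // ltW.
  by rewrite ler_nat leqW ?leq_addl.
have en : energy n (smear (@disc R nu m (top_index J m))) <= C * (2 ^+ m) `^ (la * b / 2 - 1).
  exact: le_trans (energy_smear_le _ _) (HC m).
have dge0 nu' (x : 'I_(top_index J m).+1) : 0 <= disc nu' m x by exact: disc_ge0.
have su : \sum_x smear (@disc R nu m (top_index J m)) x = 1 by rewrite sum_smear sum_disc.
apply: (le_trans (convol_moment_gain q1 (dge0 mu)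
  (fun x => smear_ge0 x (dge0 nu)) (sum_disc mu m _) su n0 en large')).
rewrite -/la mulrCA; apply: ler_wpM2l.
  by apply: sumr_ge0 => x _; exact: powR_ge0.
rewrite -/b top_index_pow2 le_eqVlt; apply/predU1l.
exact: scale_factor_split (ltW C0).
Qed.

(** With [a] halfway between the dimension [r] of [mu] and 1: at scales where
the exponent of [mu] is at most [a] there is a gain, at the others the exponent
of the convolution is at least [a] up to a negligible term, since convolution
does not increase moments by more than a constant.  In both cases it exceeds
[r + eta] at all sufficiently small scales. *)
Lemma Lq_dim_convolution_gt mu nu J (q N gamma : R) :
  1 < q -> uniformly_perfect N gamma nu -> ~ point_mass nu ->
  concentrated mu J -> concentrated nu J -> concentrated (convolution mu nu) J ->
  Lq_dim mu q <> 1%E -> (Lq_dim mu q < Lq_dim (convolution mu nu) q)%E.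
Proof.
move=> q1 unp npt muJ nuJ munuJ ne1.
have D0 := Lq_dim_ge0 q1 muJ; have D1 := Lq_dim_le1 q1 muJ.
have : Lq_dim mu q \is a fin_num.
  by rewrite ge0_fin_numE // (le_lt_trans D1) // ltry.
move=> /fineK; move: (fine _) => r rE.
move: D0 D1 ne1; rewrite -rE !lee_fin => r0 r1 ne1.
have r_lt1 : r < 1.
  by rewrite lt_neqAle r1 andbT; apply/negP => /eqP e; apply: ne1; rewrite e.
have q10 : 0 < q - 1 by rewrite subr_gt0.
pose a := (r + 1) / 2.
have a01 : 0 <= a < 1 by apply/andP; split; rewrite /a; lra.
have [g [K [g0 K0 gain]]] := moment_convolution_gain mu q1 a01 unp npt nuJ.
(* At least half of the gain [g], and of the distance [a - r], remains to absorb the constants. *)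
pose eta := Num.min (g / (4 * (q - 1))) ((1 - r) / 4).
have eta0 : 0 < eta.
  by rewrite lt_min !divr_gt0 ?mulr_gt0 // ?subr_gt0.
have eta1 : (q - 1) * eta <= g / 4.
  rewrite mulrC -ler_pdivlMr //; rewrite /eta ge_min; apply/orP; left.
  by rewrite le_eqVlt; apply/orP; left; apply/eqP; field; rewrite gt_eqF.
have eta2 : eta <= (1 - r) / 4 by rewrite /eta ge_min lexx orbT.
apply: (@lt_le_trans _ _ (r + eta)%:E); first by rewrite lte_fin ltrDl.
have [k0 near_r] : exists k, forall m, (k <= m)%N ->
    r - eta < dim_at q m (moment mu q J m).
  have : ((r - eta)%:E < Lq_dim mu q)%E by rewrite -rE lte_fin ltrBlDr ltrDl.
  rewrite (Lq_dimE q1 muJ) => /limn_einf_gt[k kP]; exists k => m km.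
  by have := kP m km; rewrite lte_fin.
have [k1 k1P] := natr_eventually_ge (ln K / ln 2 / (g / 2)).
have [k2 k2P] := natr_eventually_ge (q / ((q - 1) * ((1 - r) / 4))).
rewrite (Lq_dimE q1 munuJ).
(* At scale 0 the exponent is a quotient by 0, whence the 1. *)
apply: (@limn_einf_ge _ _ _ (maxn (maxn k0 1) (maxn k1 k2))) => m.
rewrite !geq_max => /andP[/andP[km0 m0] /andP[km1 km2]].
rewrite lee_fin le_dim_at ?moment_gt0_disc //.
have S0 := moment_gt0_disc mu J m q1.
have [dima|/ltW dima] := leP (dim_at q m (moment mu q J m)) a.
  move: dima; rewrite dim_at_le // => /(gain m) h; apply: (le_trans h).
  have := ltW (near_r m km0); rewrite le_dim_at // => Sle.
  apply: (@le_trans _ _ (K * 2 `^ (- ((q - 1) * m%:R * (r - eta))) * 2 `^ (- (g * m%:R)))).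
    by rewrite ler_pM2r ?powR_gt0 // ler_pM2l.
  rewrite -(pow2_log K0) -!powRD ?pnatr_eq0 ?implybT //.
  apply: ler_powR; first by rewrite ler1n.
  have : ln K / ln 2 <= m%:R * (g / 2).
    by rewrite -ler_pdivrMr ?divr_gt0 // k1P.
  move: (ln K / ln 2) => l lm.
  have e1 : (q - 1) * eta * m%:R <= g / 4 * m%:R by rewrite ler_wpM2r.
  rewrite -subr_ge0.
  have -> : - ((q - 1) * m%:R * (r + eta)) -
    (l + - ((q - 1) * m%:R * (r - eta)) + - (g * m%:R)) =
    (m%:R * (g / 2) - l) + (g / 4 * m%:R - (q - 1) * eta * m%:R) * 2 by field.
  by rewrite addr_ge0 ?mulr_ge0 ?subr_ge0.
apply: (le_trans (moment_convolution_le mu nu J m q1)).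
move: dima; rewrite le_dim_at // => Sle.
apply: (le_trans (ler_wpM2l (powR_ge0 _ _) Sle)).
rewrite -powRD ?pnatr_eq0 ?implybT //.
apply: ler_powR; first by rewrite ler1n.
have qm : q <= m%:R * ((q - 1) * ((1 - r) / 4)).
  rewrite -ler_pdivrMr ?k2P // mulr_gt0 // divr_gt0 //.
  by rewrite subr_gt0.
have e2 : (q - 1) * m%:R * eta <= (q - 1) * m%:R * ((1 - r) / 4).
  by apply: ler_wpM2l => //; rewrite mulr_ge0 // ltW.
rewrite -subr_ge0.
have -> : - ((q - 1) * m%:R * (r + eta)) - (q + - ((q - 1) * m%:R * a)) =
  (m%:R * ((q - 1) * ((1 - r) / 4)) - q) +
  ((q - 1) * m%:R * ((1 - r) / 4) - (q - 1) * m%:R * eta) by rewrite /a; field.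
by rewrite addr_ge0 ?subr_ge0.
Qed.

Lemma Lq_dim_convolutions_increasing (nu : nat -> borel_prob R)
    (N gamma : nat -> R) (q : R) n :
  (forall i, compactly_supported (nu i)) -> (forall i, ~ point_mass (nu i)) ->
  (forall i, uniformly_perfect (N i) (gamma i) (nu i)) -> 1 < q ->
  Lq_dim (convolutions nu n) q <> 1%E ->
  (Lq_dim (convolutions nu n) q < Lq_dim (convolutions nu n.+1) q)%E.
Proof.
move=> cs npt unp q1 ne1.
have [J [nJ _]] := concentrated_convolutions n cs.
have [J' [nJ' /(_ n.+1 (leqnn _)) nuJ']] := concentrated_convolutions n.+1 cs.
apply: (Lq_dim_convolution_gt (J := maxn J J') q1 (unp n.+1) (npt n.+1) _ _ _ ne1).
- exact: concentratedW (leq_maxl _ _) nJ.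
- exact: concentratedW (leq_maxr _ _) nuJ'.
- exact: concentratedW (leq_maxr _ _) nJ'.
Qed.

End growth_under_convolution.

(** * Convergence to one *)

Section convergence_to_one.
Context {R : realType}.
Variables N gamma : R.

Definition admissible (nu : nat -> borel_prob R) :=
  [/\ forall i, compactly_supported (nu i), forall i, ~ point_mass (nu i) &
      forall i, uniformly_perfect N gamma (nu i)].

Definition uniform_bounds n : set R := [set e | 0 <= e /\
  forall nu, admissible nu ->
    ((1 - e)%:E <= Linfty_dim (convolutions nu n))%E /\
    forall q, 1 < q -> ((1 - e)%:E <= Lq_dim (convolutions nu n) q)%E].

(** The infimum of all error bounds at index [n] that are valid for every
admissible sequence; it depends on [N] and [gamma] only by construction. *)
Definition rate n := inf (uniform_bounds n).

Lemma uniform_bounds1 n : uniform_bounds n 1.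
Proof.
split=> // nu [cs _ _]; rewrite subrr.
have [J [nJ _]] := concentrated_convolutions n cs.
have h q : 1 < q -> (0 <= Lq_dim (convolutions nu n) q)%E.
  by move=> q1; exact: Lq_dim_ge0 nJ.
by split=> //; exact: Linfty_dim_ge nJ h.
Qed.

Lemma has_inf_uniform_bounds n : has_inf (uniform_bounds n).
Proof.
by split; [exists 1; exact: uniform_bounds1|exists 0 => e []].
Qed.

Lemma rate_ge0 n : 0 <= rate n.
Proof.
apply: lb_le_inf; first by exists 1; exact: uniform_bounds1.
by move=> e [].
Qed.

(** For parameters which no measure can satisfy there is no admissible
sequence, and the bounds hold vacuously. *)
Lemma uniform_bounds_eventually (kap : R) : 0 < kap < 1 ->
  exists n, forall k, (n <= k)%N -> uniform_bounds k kap.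
Proof.
move=> kap01; have [kap0 _] := andP kap01.
have [[N1 gam0]|deg] := pselect (1 < N /\ 0 < gamma); last first.
  exists 0%N => k _; split=> [|nu [_ _ unp]]; first exact: ltW.
  by case: deg; have [N1 /andP[gam0 _] _] := unp 0%N.
have [n nP] := disc_convolutions_sup N1 gam0 kap01.
exists n => k nk; split=> [|nu [cs npt unp]]; first exact: ltW.
have [J [kJ [C C0 sup]]] := nP nu cs npt unp k nk.
have h q : 1 < q -> ((1 - kap)%:E <= Lq_dim (convolutions nu k) q)%E.
  by move=> q1; exact: Lq_dim_ge_sup q1 kJ C0 sup.
by split=> //; exact: Linfty_dim_ge kJ h.
Qed.

Lemma rate_cvg0 : rate @ \oo --> (0 : R).
Proof.
apply/cvgrPdist_le => e e0.
pose kap := Num.min e 2^-1.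
have kap01 : 0 < kap < 1.
  by rewrite lt_min e0 invr_gt0 ltr0n /= gt_min invf_lt1 ?ltr1n ?orbT.
have [n nP] := uniform_bounds_eventually kap01.
exists n => // k /= nk.
rewrite sub0r normrN ger0_norm ?rate_ge0 //.
apply: (@le_trans _ _ kap); last by rewrite /kap ge_min lexx.
by apply: ge_inf (nP k nk); exact: (has_inf_uniform_bounds k).2.
Qed.

Lemma ge_1B_inf (A : set R) (d : \bar R) : A !=set0 -> (0 <= d <= 1)%E ->
  (forall e, A e -> ((1 - e)%:E <= d)%E) -> ((1 - inf A)%:E <= d)%E.
Proof.
case: d => [d| |] A0 /andP[d0 d1] //= h.
rewrite lee_fin lerBlDr -lerBlDl; apply: lb_le_inf => // e /h.
by rewrite lee_fin lerBlDr -lerBlDl.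
Qed.

Lemma dist_one_le (d : \bar R) (e : R) : ((1 - e)%:E <= d)%E -> (d <= 1)%E ->
  (`|d - 1| <= e%:E)%E.
Proof.
case: d => [d| |] //=; rewrite !lee_fin => h1 h2.
rewrite ler_norml; apply/andP; split; lra.
Qed.

Lemma dist_one_le_rate nu n : admissible nu ->
  (`|Linfty_dim (convolutions nu n) - 1| <= (rate n)%:E)%E /\
  (forall q, 1 < q -> (`|Lq_dim (convolutions nu n) q - 1| <= (rate n)%:E)%E).
Proof.
move=> adm; have [cs _ _] := adm.
have [J [nJ _]] := concentrated_convolutions n cs.
have ne0 := (has_inf_uniform_bounds n).1.
have h q : 1 < q -> ((1 - rate n)%:E <= Lq_dim (convolutions nu n) q)%E.
  move=> q1; apply: ge_1B_inf => //.
    by rewrite (Lq_dim_ge0 q1 nJ) (Lq_dim_le1 q1 nJ).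
  by move=> e [_ /(_ nu adm)[_ +]]; apply.
split=> [|q q1]; apply: dist_one_le.
- exact: Linfty_dim_ge nJ h.
- exact: Linfty_dim_le1 nJ.
- exact: h.
- exact: Lq_dim_le1 nJ.
Qed.

End convergence_to_one.

Theorem corollary3p6 (R : realType) :
  (forall (nu : nat -> borel_prob R) (N gamma : nat -> R),
     (forall i, compactly_supported (nu i)) ->
     (forall i, ~ point_mass (nu i)) ->
     (forall i, uniformly_perfect (N i) (gamma i) (nu i)) ->
     forall q : R, 1 < q -> forall n : nat,
       Lq_dim (convolutions nu n) q <> 1%E ->
       (Lq_dim (convolutions nu n) q < Lq_dim (convolutions nu n.+1) q)%E) /\
  (forall N gamma : R,
     exists rate : nat -> R,
       rate @ \oo --> (0 : R) /\
       forall nu : nat -> borel_prob R,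
         (forall i, compactly_supported (nu i)) ->
         (forall i, ~ point_mass (nu i)) ->
         (forall i, uniformly_perfect N gamma (nu i)) ->
         forall n : nat,
           (`|Linfty_dim (convolutions nu n) - 1| <= (rate n)%:E)%E /\
           (forall q : R, 1 < q ->
              (`|Lq_dim (convolutions nu n) q - 1| <= (rate n)%:E)%E)).
Proof.
split=> [nu N gamma cs npt unp q q1 n|N gamma].
  exact: Lq_dim_convolutions_increasing cs npt unp q1.
exists (rate N gamma); split; first exact: rate_cvg0.
by move=> nu cs npt unp n; exact: dist_one_le_rate.
Qed.
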